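(* Let $R$ be a Dedekind domain for which there exist $\gamma_1,\ldots,\gamma_6\in R$ such that the elements $0,1,\gamma_1,\ldots,\gamma_6$ are distinct modulo every maximal ideal of $R$. Let $G$ be a flat algebraic group over $R$. Then there exists an algebra $A$ over $R$, flat and finitely generated as an $R$-module, such that $G$ is isomorphic to $\underline{\mathrm{Aut}}(A)$, i.e., $G$ represents the functor $R'\mapsto \mathrm{Aut}_{R'}(R'\otimes_R A)$ on commutative $R$-algebras $R'$.
   Context: An algebraic group over $R$ is an affine group scheme of finite presentation over $R$. An algebra $A$ over $R$ is an $R$-module $V$ equipped with an $R$-linear map $t\colon V\otimes_R V\to V$, with no further conditions (not necessarily associative, commutative or unital). $\mathrm{Aut}_{R'}(R'\otimes_R A)$ is the group of $R'$-linear algebra automorphisms. *)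

(* Defs.v *)
From HB Require Import structures.
From mathcomp Require Import all_boot all_algebra.
From mathcomp Require Import boolp.
From mathcomp Require Import freeg mpoly.

Set Implicit Arguments.
Unset Strict Implicit.
Unset Printing Implicit Defensive.

Import GRing.Theory.

Local Open Scope ring_scope.
Local Open Scope quotient_scope.

Section TensorDef.
Variables (R : comPzRingType) (M N : lmodType R).

Definition free_ab := {freeg (M * N)%type}.
HB.instance Definition _ := GRing.Zmodule.on free_ab.

Definition free_gen (m : M) (n : N) : free_ab := << (m, n) >>.

(* The subgroup generated by the bilinearity relations. *)
Inductive tensor_rel : free_ab -> Prop :=
| TRel0 : tensor_rel 0
| TRelB x y : tensor_rel x -> tensor_rel y -> tensor_rel (x - y)
| TRelDl m m' n :
    tensor_rel (free_gen (m + m') n - (free_gen m n + free_gen m' n))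
| TRelDr m n n' :
    tensor_rel (free_gen m (n + n') - (free_gen m n + free_gen m n'))
| TRelZ r m n : tensor_rel (free_gen (r *: m) n - free_gen m (r *: n)).

Definition tensor_relb : {pred free_ab} := fun x => `[< tensor_rel x >].

Fact tensor_rel_zmod : zmod_closed tensor_relb.
Proof.
split; first by apply/asboolP; exact: TRel0.
by move=> x y /asboolP hx /asboolP hy; apply/asboolP; exact: TRelB.
Qed.
HB.instance Definition _ :=
  GRing.isZmodClosed.Build free_ab tensor_relb tensor_rel_zmod.

Definition tensor : Type := Quotient.quot tensor_relb.
HB.instance Definition _ := GRing.Zmodule.on tensor.

Definition tens (m : M) (n : N) : tensor :=
  \pi_(Quotient.quot tensor_relb) (free_gen m n).

Lemma pi_tensor_eq (x y : free_ab) : tensor_rel (x - y) ->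
  \pi_(Quotient.quot tensor_relb) x = \pi_(Quotient.quot tensor_relb) y.
Proof. by move=> h; apply/eqP; rewrite -Quotient.idealrBE; apply/asboolP. Qed.

Lemma pi_tensorD (x y : free_ab) :
  \pi_(Quotient.quot tensor_relb) (x + y) =
  \pi_(Quotient.quot tensor_relb) x + \pi_(Quotient.quot tensor_relb) y.
Proof. exact: raddfD. Qed.

Lemma tensDl m m' n : tens (m + m') n = tens m n + tens m' n.
Proof. by rewrite /tens -pi_tensorD; apply: pi_tensor_eq; exact: TRelDl. Qed.

Lemma tensDr m n n' : tens m (n + n') = tens m n + tens m n'.
Proof. by rewrite /tens -pi_tensorD; apply: pi_tensor_eq; exact: TRelDr. Qed.

Lemma tensZ r m n : tens (r *: m) n = tens m (r *: n).
Proof. by apply: pi_tensor_eq; exact: TRelZ. Qed.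

Lemma tens0l n : tens 0 n = 0.
Proof. by apply: (addrI (tens 0 n)); rewrite -tensDl !addr0. Qed.

Lemma tensNl m n : tens (- m) n = - tens m n.
Proof. by apply: (addrI (tens m n)); rewrite -tensDl !subrr tens0l. Qed.

Lemma tensor_ind (P : tensor -> Prop) :
  P 0 -> (forall x y, P x -> P y -> P (x + y)) ->
  (forall m n, P (tens m n)) -> forall x, P x.
Proof.
move=> P0 PD Pt; elim/quotW => D; rewrite -[D]freeg_sumE raddf_sum.
elim/big_ind: _ => // -[m n] _ /=.
have -> : << coeff (m, n) D *g (m, n) >> = (free_gen m n) *~ (coeff (m, n) D).
  by rewrite /free_gen freegU_mulz intz.
rewrite raddfMz -/(tens m n).
have PM k : P (tens m n *+ k).
  by elim: k => [|k ih]; rewrite ?mulr0n // mulrS; apply: PD.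
case: (coeff _ _) => k; first by rewrite -pmulrn.
rewrite NegzE -nmulrn -mulNrn -tensNl.
elim: k.+1 => [|j ih]; rewrite ?mulr0n // mulrS; exact: PD.
Qed.

Lemma tensor_ext (Z : zmodType) (f g : tensor -> Z) :
  {morph f : x y / x + y} -> {morph g : x y / x + y} ->
  (forall m n, f (tens m n) = g (tens m n)) -> f =1 g.
Proof.
move=> fD gD fg; have z0 (h : tensor -> Z) : {morph h : x y / x + y} -> h 0 = 0.
  by move=> hD; apply: (addrI (h 0)); rewrite -hD !addr0.
apply: tensor_ind => //; first by rewrite !z0.
by move=> x y fx fy; rewrite fD gD fx fy.
Qed.

Record balanced (Z : zmodType) (f : M -> N -> Z) : Prop := Balanced {
  balancedDl : forall n, {morph f^~ n : m m' / m + m'};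
  balancedDr : forall m, {morph f m : n n' / n + n'};
  balancedZ : forall r m n, f (r *: m) n = f m (r *: n) }.

(* Meaningful only for balanced maps (see tlift_tens and tliftD). *)
Definition tlift (Z : zmodType) (f : M -> N -> Z) (x : tensor) : Z :=
  fglift (fun p => f p.1 p.2 : zmodule Z) (repr x).

Section Lift.
Variables (Z : zmodType) (f : M -> N -> Z).
Hypothesis fP : balanced f.
Let lf : free_ab -> Z := fglift (fun p => f p.1 p.2 : zmodule Z).

Let lfB : {morph lf : x y / x - y}.
Proof. exact: (lift_is_additive (fun p => f p.1 p.2 : zmodule Z)). Qed.

Let lf0 : lf 0 = 0.
Proof. by have := lfB 0 0; rewrite !subrr. Qed.

Let lfD : {morph lf : x y / x + y}.
Proof.
move=> x y; have lfN z : lf (- z) = - lf z by rewrite -[- z]sub0r lfB lf0 sub0r.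
have -> : x + y = x - (- y) by rewrite opprK.
by rewrite lfB lfN opprK.
Qed.

Let lf_gen m n : lf (free_gen m n) = f m n.
Proof. by rewrite /lf /free_gen liftU scale1r. Qed.

Let lf_rel x : tensor_rel x -> lf x = 0.
Proof.
elim=> {x} => [|x y _ hx _ hy|m m' n|m n n'|r m n].
- exact: lf0.
- by rewrite lfB hx hy subrr.
- by rewrite lfB lfD !lf_gen balancedDl // subrr.
- by rewrite lfB lfD !lf_gen balancedDr // subrr.
- by rewrite lfB !lf_gen balancedZ // subrr.
Qed.

Let tlift_pi x : tlift f (\pi_(Quotient.quot tensor_relb) x) = lf x.
Proof.
apply/eqP; rewrite -subr_eq0 -lfB; apply/eqP/lf_rel/asboolP.
by have := Quotient.idealrBE tensor_relb (repr (\pi_(Quotient.quot tensor_relb) x)) x;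
   rewrite reprK eqxx.
Qed.

Lemma tlift_tens m n : tlift f (tens m n) = f m n.
Proof. by rewrite /tens tlift_pi lf_gen. Qed.

Lemma tliftD : {morph tlift f : x y / x + y}.
Proof.
by elim/quotW => x; elim/quotW => y; rewrite -pi_tensorD !tlift_pi lfD.
Qed.

End Lift.

Definition tensor_scale (r : R) : tensor -> tensor :=
  tlift (fun m n => tens (r *: m) n).

Fact tensor_scale_balanced r : balanced (fun m n => tens (r *: m) n).
Proof.
split=> [n m m'|m n n'|s m n]; rewrite ?scalerDr ?tensDl ?tensDr //.
by rewrite scalerA mulrC -scalerA tensZ.
Qed.

Lemma tensor_scale_tens r m n : tensor_scale r (tens m n) = tens (r *: m) n.
Proof. exact: tlift_tens (tensor_scale_balanced r) m n. Qed.

Lemma tensor_scaleDr r : {morph tensor_scale r : x y / x + y}.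
Proof. exact: tliftD (tensor_scale_balanced r). Qed.

Fact tensor_scaleA r s x :
  tensor_scale r (tensor_scale s x) = tensor_scale (r * s) x.
Proof.
apply: (tensor_ext (f := fun x => tensor_scale r (tensor_scale s x))) x.
- by move=> x y; rewrite !tensor_scaleDr.
- exact: tensor_scaleDr.
- by move=> m n; rewrite !tensor_scale_tens scalerA.
Qed.

Fact tensor_scale1 : left_id 1 tensor_scale.
Proof.
apply: tensor_ext (tensor_scaleDr 1) _ _ => // m n.
by rewrite tensor_scale_tens scale1r.
Qed.

Fact tensor_scaleDl x : {morph tensor_scale^~ x : r s / r + s}.
Proof.
move=> r s; apply: (tensor_ext (g := fun x => tensor_scale r x + tensor_scale s x)) x.
- exact: tensor_scaleDr.
- by move=> x y; rewrite !tensor_scaleDr addrACA.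
- by move=> m n; rewrite !tensor_scale_tens scalerDl tensDl.
Qed.

HB.instance Definition _ := GRing.Zmodule_isLmodule.Build R tensor
  tensor_scaleA tensor_scale1 tensor_scaleDr tensor_scaleDl.

Lemma tensZl r m n : r *: tens m n = tens (r *: m) n.
Proof. exact: tensor_scale_tens. Qed.

Lemma tensZr r m n : r *: tens m n = tens m (r *: n).
Proof. by rewrite tensZl tensZ. Qed.

End TensorDef.

Arguments tensor {R} M N.
Arguments tens {R M N} m n.

Section TensorMap.
Variables (R : comPzRingType) (M M' N N' : lmodType R).
Variables (f : {linear M -> M'}) (g : {linear N -> N'}).

Definition tensor_map : tensor M N -> tensor M' N' :=
  tlift (fun m n => tens (f m) (g n)).

Fact tensor_map_balanced : balanced (fun m n => tens (f m) (g n)).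
Proof.
split=> [n m m'|m n n'|r m n]; rewrite ?raddfD ?tensDl ?tensDr //.
by rewrite !linearZ tensZ.
Qed.

Lemma tensor_map_tens m n : tensor_map (tens m n) = tens (f m) (g n).
Proof. exact: tlift_tens tensor_map_balanced m n. Qed.

Lemma tensor_mapD : {morph tensor_map : x y / x + y}.
Proof. exact: tliftD tensor_map_balanced. Qed.

End TensorMap.

Definition flat (R : comPzRingType) (M : lmodType R) : Prop :=
  forall (N N' : lmodType R) (g : {linear N -> N'}),
    injective g -> injective (tensor_map (M := M) idfun g).

Definition finitely_generated (R : comPzRingType) (M : lmodType R) : Prop :=
  exists (n : nat) (e : 'I_n -> M),
    forall x, exists c : 'I_n -> R, x = \sum_i c i *: e i.


(* Based on comPzRingType rather than on comAlgType, which excludes the zero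
   ring: the zero algebra is one of the test algebras of a group functor. *)
Record comAlg (R : comPzRingType) := ComAlg {
  comAlg_ring : comPzRingType;
  comAlg_str : {rmorphism R -> comAlg_ring} }.

Definition comAlg_sort (R : comPzRingType) (S : comAlg R) : Type :=
  comAlg_ring S.
Coercion comAlg_sort : comAlg >-> Sortclass.

Section ComAlgTheory.
Variables (R : comPzRingType) (S : comAlg R).

HB.instance Definition _ := GRing.ComPzRing.on (comAlg_sort S).

Definition alg_str : R -> S := comAlg_str S.
HB.instance Definition _ := GRing.RMorphism.on alg_str.

Definition comAlg_scale (r : R) (x : S) : S := alg_str r * x.

Fact comAlg_scaleA r s x :
  comAlg_scale r (comAlg_scale s x) = comAlg_scale (r * s) x.
Proof. by rewrite /comAlg_scale rmorphM mulrA. Qed.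
Fact comAlg_scale1 : left_id 1 comAlg_scale.
Proof. by move=> x; rewrite /comAlg_scale rmorph1 mul1r. Qed.
Fact comAlg_scaleDr : right_distributive comAlg_scale +%R.
Proof. by move=> r x y; rewrite /comAlg_scale mulrDr. Qed.
Fact comAlg_scaleDl x : {morph comAlg_scale^~ x : r s / r + s}.
Proof. by move=> r s; rewrite /comAlg_scale rmorphD mulrDl. Qed.

HB.instance Definition _ := GRing.Zmodule_isLmodule.Build R (comAlg_sort S)
  comAlg_scaleA comAlg_scale1 comAlg_scaleDr comAlg_scaleDl.

Lemma alg_scaleE r (x : S) : r *: x = alg_str r * x. Proof. by []. Qed.

Lemma alg_scaleAl r (x y : S) : r *: (x * y) = r *: x * y.
Proof. by rewrite !alg_scaleE mulrA. Qed.

Lemma alg_scaleAr r (x y : S) : r *: (x * y) = x * (r *: y).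
Proof. by rewrite !alg_scaleE mulrCA. Qed.

End ComAlgTheory.

Record algHom (R : comPzRingType) (S T : comAlg R) := AlgHom {
  algHom_fun :> S -> T;
  algHom_zmod : zmod_morphism algHom_fun;
  algHom_monoid : monoid_morphism algHom_fun;
  algHom_str : forall r, algHom_fun (alg_str S r) = alg_str T r }.

Section AlgHomTheory.
Variables (R : comPzRingType).

Section Instances.
Variables (S T : comAlg R) (h : algHom S T).
HB.instance Definition _ :=
  GRing.isZmodMorphism.Build S T (algHom_fun h) (algHom_zmod h).
HB.instance Definition _ :=
  GRing.isMonoidMorphism.Build S T (algHom_fun h) (algHom_monoid h).
Fact algHom_scalable : scalable (algHom_fun h).
Proof. by move=> r x; rewrite !alg_scaleE rmorphM /= algHom_str. Qed.
HB.instance Definition _ :=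
  GRing.isScalable.Build R S T *:%R (algHom_fun h) algHom_scalable.
End Instances.

Definition algHom_id (S : comAlg R) : algHom S S :=
  @AlgHom R S S id (fun _ _ => erefl) (erefl, fun _ _ => erefl)
    (fun _ => erefl).

Section Composition.
Variables (S T U : comAlg R) (k : algHom T U) (h : algHom S T).

Fact algHom_comp_zmod : zmod_morphism (k \o h).
Proof. by move=> x y /=; rewrite !raddfB. Qed.
Fact algHom_comp_monoid : monoid_morphism (k \o h).
Proof. by split=> [|x y] /=; rewrite ?rmorph1 ?rmorphM. Qed.
Fact algHom_comp_str r : (k \o h) (alg_str S r) = alg_str U r.
Proof. by rewrite /= !algHom_str. Qed.

Definition algHom_comp : algHom S U :=
  AlgHom algHom_comp_zmod algHom_comp_monoid algHom_comp_str.

End Composition.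

End AlgHomTheory.

Definition finitely_generated_ideal (P : comPzRingType) (I : {pred P}) : Prop :=
  exists (n : nat) (a : 'I_n -> P),
    forall x, x \in I <-> exists c : 'I_n -> P, x = \sum_i c i * a i.

Definition mpolyAlg (R : comNzRingType) (n : nat) : comAlg R :=
  ComAlg (mpolyC n (R := R) : {rmorphism R -> {mpoly R[n]}}).

Definition finitely_presented (R : comNzRingType) (B : comAlg R) : Prop :=
  exists (n : nat) (p : algHom (mpolyAlg R n) B),
    (forall b, exists f, p f = b) /\
    finitely_generated_ideal [pred f : mpolyAlg R n | p f == 0].

Record groupFunctor (R : comPzRingType) := GroupFunctor {
  gf_obj :> comAlg R -> groupType;
  gf_map : forall S T : comAlg R, algHom S T -> gf_obj S -> gf_obj T;
  gf_mapM : forall (S T : comAlg R) (h : algHom S T),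
    {morph gf_map h : x y / (x * y)%g};
  gf_map_id : forall S : comAlg R, gf_map (algHom_id S) =1 id;
  gf_map_comp : forall (S T U : comAlg R) (k : algHom T U) (h : algHom S T),
    gf_map (algHom_comp k h) =1 gf_map k \o gf_map h }.

Definition gf_isomorphic (R : comPzRingType) (F G : groupFunctor R) : Prop :=
  exists phi : forall S : comAlg R, F S -> G S,
    [/\ forall S, bijective (phi S),
        forall S, {morph phi S : x y / (x * y)%g}
      & forall (S T : comAlg R) (h : algHom S T) (x : F S),
          phi T (gf_map h x) = gf_map h (phi S x)].

(* An affine group scheme is given by its functor of points, together with an
   isomorphism of set-valued functors with Hom_R(ag_ring, -). *)
Record affineGroup (R : comPzRingType) := AffineGroup {
  ag_functor :> groupFunctor R;
  ag_ring : comAlg R;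
  ag_point : forall S : comAlg R, algHom ag_ring S -> ag_functor S;
  ag_point_bij : forall S : comAlg R, bijective (@ag_point S);
  ag_point_nat : forall (S T : comAlg R) (h : algHom S T) (x : algHom ag_ring S),
    ag_point (algHom_comp h x) = gf_map h (ag_point x) }.

Record algebraicGroup (R : comNzRingType) := AlgebraicGroup {
  algg_affine :> affineGroup R;
  algg_fp : finitely_presented (ag_ring algg_affine) }.

Definition flat_group (R : comNzRingType) (G : algebraicGroup R) : Prop :=
  flat (ag_ring G : lmodType R).

(* No associativity, commutativity or unit is assumed; the product of x and y is
   alg_mul (tens x y). *)
Record algebra (R : comPzRingType) := Algebra {
  alg_mod :> lmodType R;
  alg_mul : {linear tensor alg_mod alg_mod -> alg_mod} }.

Record algAut (R : comPzRingType) (A : algebra R) := AlgAut {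
  aut_fun :> A -> A;
  aut_inv : A -> A;
  aut_linear : linear aut_fun;
  aut_mul : forall x y : A,
    aut_fun (alg_mul A (tens x y)) = alg_mul A (tens (aut_fun x) (aut_fun y));
  aut_funK : cancel aut_fun aut_inv;
  aut_invK : cancel aut_inv aut_fun }.

Section AutGroup.
Variables (R : comPzRingType) (A : algebra R).
Implicit Types f g : algAut A.

HB.instance Definition _ f :=
  GRing.isLinear.Build R A A *:%R (aut_fun f) (aut_linear f).

Lemma algAut_eq f g : f =1 g -> f = g.
Proof.
case: f g => [f f' fl fm fK f'K] [g g' gl gm gK g'K] /= /funext efg.
case: g / efg in gl gm gK g'K *.
have e : f' = g' by apply/funext => x; rewrite -[x in LHS]g'K fK.
case: g' / e in gK g'K *.
by rewrite (Prop_irrelevance gl fl) (Prop_irrelevance gm fm) (Prop_irrelevance gK fK) (Prop_irrelevance g'K f'K).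
Qed.

Definition aut1 : algAut A :=
  @AlgAut R A id id (fun _ _ _ => erefl) (fun _ _ => erefl)
    (fun _ => erefl) (fun _ => erefl).

Section Operations.
Variables f g : algAut A.

Fact autM_linear : linear (f \o g).
Proof. by move=> a x y /=; rewrite !linearP. Qed.
Fact autM_mul x y :
  (f \o g) (alg_mul A (tens x y)) = alg_mul A (tens ((f \o g) x) ((f \o g) y)).
Proof. by rewrite /= !aut_mul. Qed.
Fact autM_funK : cancel (f \o g) (aut_inv g \o aut_inv f).
Proof. by move=> x /=; rewrite !aut_funK. Qed.
Fact autM_invK : cancel (aut_inv g \o aut_inv f) (f \o g).
Proof. by move=> x /=; rewrite !aut_invK. Qed.

Definition autM : algAut A := AlgAut autM_linear autM_mul autM_funK autM_invK.

Fact autV_linear : linear (aut_inv f).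
Proof.
by move=> a x y; apply: (can_inj (aut_funK f)); rewrite linearP /= !aut_invK.
Qed.
Fact autV_mul x y :
  aut_inv f (alg_mul A (tens x y)) =
  alg_mul A (tens (aut_inv f x) (aut_inv f y)).
Proof. by apply: (can_inj (aut_funK f)); rewrite aut_mul !aut_invK. Qed.

Definition autV : algAut A :=
  AlgAut autV_linear autV_mul (aut_invK f) (aut_funK f).

End Operations.

Fact autMA : associative autM. Proof. by move=> f g h; apply: algAut_eq. Qed.
Fact aut1M : left_id aut1 autM. Proof. by move=> f; apply: algAut_eq. Qed.
Fact autM1 : right_id aut1 autM. Proof. by move=> f; apply: algAut_eq. Qed.
Fact autVM : left_inverse aut1 autV autM.
Proof. by move=> f; apply: algAut_eq => x /=; rewrite aut_funK. Qed.
Fact autMV : right_inverse aut1 autV autM.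
Proof. by move=> f; apply: algAut_eq => x /=; rewrite aut_invK. Qed.

HB.instance Definition _ := gen_eqMixin (algAut A).
HB.instance Definition _ := gen_choiceMixin (algAut A).
HB.instance Definition _ := isGroup.Build (algAut A) autMA aut1M autM1 autVM autMV.

End AutGroup.

Section BaseChangeModule.
Variables (R : comPzRingType) (S : comAlg R) (V : lmodType R).

(* Carries the S-module structure, whereas tensor S V carries the R-module one. *)
Definition base_change : Type := tensor S V.
HB.instance Definition _ := GRing.Zmodule.on base_change.

Definition bc_tens (s : S) (v : V) : base_change := tens s v.

Definition bc_scale (s : S) : base_change -> base_change :=
  tlift (fun s' v => tens (s * s') v).

Fact bc_scale_balanced s : balanced (fun (s' : S) (v : V) => tens (s * s') v).
Proof.
split=> [v s1 s2|s1 v w|r s1 v]; rewrite ?mulrDr ?tensDl ?tensDr //.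
by rewrite -alg_scaleAr tensZ.
Qed.

Fact bc_scale_tens s s' v : bc_scale s (bc_tens s' v) = bc_tens (s * s') v.
Proof. exact: tlift_tens (bc_scale_balanced s) s' v. Qed.

Fact bc_scaleDr : right_distributive bc_scale +%R.
Proof. by move=> s; exact: tliftD (bc_scale_balanced s). Qed.

Fact bc_scaleA s t x : bc_scale s (bc_scale t x) = bc_scale (s * t) x.
Proof.
apply: (tensor_ext (f := fun x => bc_scale s (bc_scale t x))) x.
- by move=> x y; rewrite !bc_scaleDr.
- exact: bc_scaleDr.
- by move=> s' v; rewrite !bc_scale_tens mulrA.
Qed.

Fact bc_scale1 : left_id 1 bc_scale.
Proof.
apply: tensor_ext (bc_scaleDr 1) _ _ => // s v.
by rewrite bc_scale_tens mul1r.
Qed.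

Fact bc_scaleDl x : {morph bc_scale^~ x : s t / s + t}.
Proof.
move=> s t; apply: (tensor_ext (g := fun x => bc_scale s x + bc_scale t x)) x.
- exact: bc_scaleDr.
- by move=> x y; rewrite !bc_scaleDr addrACA.
- by move=> s' v; rewrite !bc_scale_tens mulrDl -tensDl.
Qed.

HB.instance Definition _ := GRing.Zmodule_isLmodule.Build S base_change
  bc_scaleA bc_scale1 bc_scaleDr bc_scaleDl.

Lemma bc_tensZ (s s' : S) v : s *: bc_tens s' v = bc_tens (s * s') v.
Proof. exact: bc_scale_tens. Qed.

Lemma bc_tensE (s : S) v : bc_tens s v = s *: bc_tens 1 v.
Proof. by rewrite bc_tensZ mulr1. Qed.

Lemma bc_ext (Z : zmodType) (f g : base_change -> Z) :
  {morph f : x y / x + y} -> {morph g : x y / x + y} ->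
  (forall s v, f (bc_tens s v) = g (bc_tens s v)) -> f =1 g.
Proof. exact: tensor_ext. Qed.

End BaseChangeModule.

Arguments bc_tens {R S V} s v.

Section BaseChangeAlgebra.
Variables (R : comPzRingType) (S : comAlg R) (A : algebra R).

Local Notation "x ** y" := (alg_mul A (tens x y)) (at level 40).
Local Notation AS := (base_change S A).

Fact alg_mulDl (x x' y : A) : (x + x') ** y = x ** y + x' ** y.
Proof. by rewrite tensDl linearD. Qed.
Fact alg_mulDr (x y y' : A) : x ** (y + y') = x ** y + x ** y'.
Proof. by rewrite tensDr linearD. Qed.
Fact alg_mulZl r (x y : A) : (r *: x) ** y = r *: (x ** y).
Proof. by rewrite -tensZl linearZ. Qed.
Fact alg_mulZr r (x y : A) : x ** (r *: y) = r *: (x ** y).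
Proof. by rewrite -tensZr linearZ. Qed.

Definition bc_mul_tens (s : S) (a : A) : AS -> AS :=
  tlift (fun s' a' => bc_tens (s * s') (a ** a')).

Definition bc_mul2 (x y : AS) : AS := tlift (fun s a => bc_mul_tens s a y) x.

Fact bc_mul_tens_balanced s a :
  balanced (fun (s' : S) (a' : A) => bc_tens (s * s') (a ** a')).
Proof.
rewrite /bc_tens; split=> [a' s1 s2|s1 a1 a2|r s1 a1].
- by rewrite mulrDr tensDl.
- by rewrite alg_mulDr tensDr.
- by rewrite -alg_scaleAr tensZ alg_mulZr.
Qed.

Fact bc_mul_tensE s a s' a' :
  bc_mul_tens s a (bc_tens s' a') = bc_tens (s * s') (a ** a').
Proof. exact: tlift_tens (bc_mul_tens_balanced s a) s' a'. Qed.

Fact bc_mul_tensD s a : {morph bc_mul_tens s a : x y / x + y}.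
Proof. exact: tliftD (bc_mul_tens_balanced s a). Qed.

Fact bc_mul2_balanced y : balanced (fun s a => bc_mul_tens s a y).
Proof.
split=> [a s1 s2|s a1 a2|r s a].
- apply: (bc_ext (g := fun y => bc_mul_tens s1 a y + bc_mul_tens s2 a y)) y.
  + exact: bc_mul_tensD.
  + by move=> x y; rewrite !bc_mul_tensD addrACA.
  + by move=> s' a'; rewrite !bc_mul_tensE mulrDl /bc_tens tensDl.
- apply: (bc_ext (g := fun y => bc_mul_tens s a1 y + bc_mul_tens s a2 y)) y.
  + exact: bc_mul_tensD.
  + by move=> x y; rewrite !bc_mul_tensD addrACA.
  + by move=> s' a'; rewrite !bc_mul_tensE alg_mulDl /bc_tens tensDr.
- apply: (bc_ext (f := bc_mul_tens (r *: s) a)) y.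
  + exact: bc_mul_tensD.
  + exact: bc_mul_tensD.
  + move=> s' a'.
    by rewrite !bc_mul_tensE -alg_scaleAl alg_mulZl /bc_tens tensZ.
Qed.

Lemma bc_mul2E s a s' a' :
  bc_mul2 (bc_tens s a) (bc_tens s' a') = bc_tens (s * s') (a ** a').
Proof.
rewrite /bc_mul2 (tlift_tens (bc_mul2_balanced (bc_tens s' a')) s a).
exact: bc_mul_tensE.
Qed.

Fact bc_mul2_tens s a y : bc_mul2 (bc_tens s a) y = bc_mul_tens s a y.
Proof. exact: tlift_tens (bc_mul2_balanced y) s a. Qed.

Fact bc_mul2Dl y : {morph bc_mul2^~ y : x x' / x + x'}.
Proof. exact: tliftD (bc_mul2_balanced y). Qed.

Fact bc_mul2Dr x : {morph bc_mul2 x : y y' / y + y'}.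
Proof.
move=> y y'.
apply: (bc_ext (f := bc_mul2^~ (y + y'))
               (g := fun x => bc_mul2 x y + bc_mul2 x y')) x.
- exact: bc_mul2Dl.
- by move=> x x'; rewrite !bc_mul2Dl addrACA.
- by move=> s a; rewrite !bc_mul2_tens bc_mul_tensD.
Qed.

Fact bc_mul2Zl (c : S) x y : bc_mul2 (c *: x) y = c *: bc_mul2 x y.
Proof.
apply: (bc_ext (f := fun x => bc_mul2 (c *: x) y)
               (g := fun x => c *: bc_mul2 x y)) x.
- by move=> x x'; rewrite scalerDr bc_mul2Dl.
- by move=> x x'; rewrite bc_mul2Dl scalerDr.
move=> s a; apply: (bc_ext (g := fun y => c *: bc_mul2 (bc_tens s a) y)) y.
- exact: bc_mul2Dr.
- by move=> y y'; rewrite bc_mul2Dr scalerDr.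
- by move=> s' a'; rewrite bc_tensZ !bc_mul2E bc_tensZ mulrA.
Qed.

Fact bc_mul2Zr (c : S) x y : bc_mul2 x (c *: y) = c *: bc_mul2 x y.
Proof.
apply: (bc_ext (f := fun x => bc_mul2 x (c *: y))
               (g := fun x => c *: bc_mul2 x y)) x.
- exact: bc_mul2Dl.
- by move=> x x'; rewrite bc_mul2Dl scalerDr.
move=> s a; apply: (bc_ext (f := fun y => bc_mul2 (bc_tens s a) (c *: y))
                           (g := fun y => c *: bc_mul2 (bc_tens s a) y)) y.
- by move=> y y'; rewrite scalerDr bc_mul2Dr.
- by move=> y y'; rewrite bc_mul2Dr scalerDr.
- by move=> s' a'; rewrite bc_tensZ !bc_mul2E bc_tensZ mulrCA.
Qed.

Definition bc_mul : tensor AS AS -> AS := tlift bc_mul2.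

Fact bc_mul2_bal : balanced bc_mul2.
Proof.
split=> [y x x'|x y y'|c x y]; [exact: bc_mul2Dl | exact: bc_mul2Dr |].
by rewrite bc_mul2Zl bc_mul2Zr.
Qed.

Lemma bc_mulE x y : bc_mul (tens x y) = bc_mul2 x y.
Proof. exact: tlift_tens bc_mul2_bal x y. Qed.

Fact bc_mul_linear : linear bc_mul.
Proof.
have mD : {morph bc_mul : x y / x + y} := tliftD bc_mul2_bal.
move=> c x y; rewrite mD; congr (_ + _).
apply: (tensor_ext (f := fun x => bc_mul (c *: x))
                   (g := fun x => c *: bc_mul x)) x.
- by move=> x x'; rewrite scalerDr mD.
- by move=> x x'; rewrite mD scalerDr.
- by move=> x x'; rewrite tensZl !bc_mulE bc_mul2Zl.
Qed.

HB.instance Definition _ :=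
  GRing.isLinear.Build S (tensor AS AS) AS *:%R bc_mul bc_mul_linear.

Definition bc_algebra : algebra S := @Algebra S AS bc_mul.

End BaseChangeAlgebra.

Arguments bc_algebra {R} S A.

Section BaseChangeAlong.
Variables (R : comPzRingType).

Section Maps.
Variables (S T : comAlg R) (h : algHom S T).

Definition bc_along (V : lmodType R) : base_change S V -> base_change T V :=
  tensor_map h idfun.

Section Module.
Variable V : lmodType R.
Local Notation hV := (@bc_along V).

Lemma bc_alongE s v : hV (bc_tens s v) = bc_tens (h s) v.
Proof. exact: tensor_map_tens. Qed.

Lemma bc_alongD : {morph hV : x y / x + y}.
Proof. exact: tensor_mapD. Qed.

Lemma bc_alongZ s x : hV (s *: x) = h s *: hV x.
Proof.
apply: (bc_ext (f := fun x => hV (s *: x)) (g := fun x => h s *: hV x)) x.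
- by move=> x y; rewrite scalerDr bc_alongD.
- by move=> x y; rewrite bc_alongD scalerDr.
- by move=> s' v; rewrite bc_tensZ !bc_alongE bc_tensZ rmorphM.
Qed.

(* The base change along h of an S-linear endomorphism f, through the
   identification of T (x)_S (S (x)_R V) with T (x)_R V; it is the unique
   T-linear map that commutes with f through bc_along (see bc_extend_along). *)
Definition bc_extend (f : base_change S V -> base_change S V) :
    base_change T V -> base_change T V :=
  tlift (fun (t : T) (v : V) => t *: hV (f (bc_tens 1 v))).

Section Extend.
Variable f : base_change S V -> base_change S V.
Hypothesis f_lin : linear f.

Let fD : {morph f : x y / x + y}.
Proof. by move=> x y; have := f_lin 1 x y; rewrite !scale1r. Qed.

Let fZ s x : f (s *: x) = s *: f x.
Proof.
have f0 : f 0 = 0 by apply: (addrI (f 0)); rewrite -fD !addr0.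
by have := f_lin s x 0; rewrite f0 !addr0.
Qed.

Fact bc_extend_balanced :
  balanced (fun (t : T) (v : V) => t *: hV (f (bc_tens 1 v))).
Proof.
split=> [v t t'|t v w|r t v].
- by rewrite scalerDl.
- by rewrite /bc_tens tensDr fD bc_alongD scalerDr.
- have -> : bc_tens 1 (r *: v) = alg_str S r *: bc_tens 1 v :> base_change S V.
    by rewrite bc_tensZ mulr1 /bc_tens -tensZ alg_scaleE mulr1.
  by rewrite fZ bc_alongZ algHom_str scalerA mulrC -alg_scaleE.
Qed.

Lemma bc_extendE t v :
  bc_extend f (bc_tens t v) = t *: hV (f (bc_tens 1 v)).
Proof. exact: tlift_tens bc_extend_balanced t v. Qed.

Fact bc_extendD : {morph bc_extend f : x y / x + y}.
Proof. exact: tliftD bc_extend_balanced. Qed.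

Fact bc_extendZ t x : bc_extend f (t *: x) = t *: bc_extend f x.
Proof.
apply: (bc_ext (f := fun x => bc_extend f (t *: x))
               (g := fun x => t *: bc_extend f x)) x.
- by move=> x y; rewrite scalerDr bc_extendD.
- by move=> x y; rewrite bc_extendD scalerDr.
- by move=> s' v; rewrite bc_tensZ !bc_extendE scalerA.
Qed.

Fact bc_extend_linear : linear (bc_extend f).
Proof. by move=> t x y; rewrite bc_extendD bc_extendZ. Qed.

Lemma bc_extend_along x : bc_extend f (hV x) = hV (f x).
Proof.
apply: (bc_ext (f := fun x => bc_extend f (hV x)) (g := fun x => hV (f x))) x.
- by move=> x y; rewrite bc_alongD bc_extendD.
- by move=> x y; rewrite fD bc_alongD.
- by move=> s v; rewrite bc_alongE bc_extendE [bc_tens s v]bc_tensE fZ bc_alongZ.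
Qed.

End Extend.

Lemma bc_span (Z : zmodType) (p q : base_change T V -> Z) :
  {morph p : x y / x + y} -> {morph q : x y / x + y} ->
  (forall t x, p (t *: hV x) = q (t *: hV x)) -> p =1 q.
Proof.
move=> pD qD e; apply: bc_ext => // t v.
have -> : bc_tens t v = t *: hV (bc_tens 1 v).
  by rewrite bc_alongE rmorph1 -bc_tensE.
exact: e.
Qed.

End Module.

Lemma bc_along_mul (A : algebra R) (x y : base_change S A) :
  bc_along (bc_mul2 x y) = bc_mul2 (bc_along x) (bc_along y).
Proof.
apply: (bc_ext (f := fun x => bc_along (bc_mul2 x y))
               (g := fun x => bc_mul2 (bc_along x) (bc_along y))) x.
- by move=> x x'; rewrite bc_mul2Dl bc_alongD.
- by move=> x x'; rewrite bc_alongD bc_mul2Dl.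
move=> s a.
apply: (bc_ext (f := fun y => bc_along (bc_mul2 (bc_tens s a) y))
               (g := fun y => bc_mul2 (bc_along (bc_tens s a)) (bc_along y))) y.
- by move=> y y'; rewrite bc_mul2Dr bc_alongD.
- by move=> y y'; rewrite bc_alongD bc_mul2Dr.
- by move=> s' a'; rewrite !(bc_mul2E, bc_alongE) rmorphM.
Qed.

Fact bc_extend_comp (V : lmodType R) (f g : base_change S V -> base_change S V) :
  linear f -> linear g ->
  bc_extend (f \o g) =1 bc_extend f \o bc_extend g.
Proof.
move=> fl gl; have fgl : linear (f \o g) by move=> c x y /=; rewrite gl fl.
apply: bc_span => [||t x] /=.
- exact: bc_extendD.
- by move=> x y /=; rewrite !bc_extendD.
- by rewrite !bc_extendZ // !bc_extend_along.
Qed.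

Fact bc_extend_id (V : lmodType R) (f : base_change S V -> base_change S V) :
  f =1 id -> bc_extend f =1 id.
Proof.
move=> fid; have fl : linear f by move=> c x y; rewrite !fid.
apply: bc_span => [||t x] //; first exact: bc_extendD.
by rewrite bc_extendZ // bc_extend_along // fid.
Qed.

Variable A : algebra R.

Section AutExtend.
Variable f : algAut (bc_algebra S A).

Let fl : linear f := @aut_linear _ _ f.
Let gl : linear (aut_inv f) := @autV_linear _ _ f.

Fact aut_extend_mul (x y : bc_algebra T A) :
  bc_extend f (alg_mul (bc_algebra T A) (tens x y)) =
  alg_mul (bc_algebra T A) (tens (bc_extend f x) (bc_extend f y)).
Proof.
rewrite /= !bc_mulE.
apply: (bc_span (p := fun x => bc_extend f (bc_mul2 x y))
                (q := fun x => bc_mul2 (bc_extend f x) (bc_extend f y))) x.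
- by move=> x x'; rewrite bc_mul2Dl bc_extendD.
- by move=> x x'; rewrite bc_extendD // bc_mul2Dl.
move=> t x.
apply: (bc_span (p := fun y => bc_extend f (bc_mul2 (t *: bc_along x) y))
  (q := fun y => bc_mul2 (bc_extend f (t *: bc_along x)) (bc_extend f y))) y.
- by move=> y y'; rewrite bc_mul2Dr bc_extendD.
- by move=> y y'; rewrite bc_extendD // bc_mul2Dr.
move=> u y; rewrite bc_mul2Zl bc_mul2Zr !bc_extendZ // bc_mul2Zl bc_mul2Zr.
rewrite -bc_along_mul !bc_extend_along // -bc_along_mul.
by have := aut_mul f x y; rewrite /= !bc_mulE => ->.
Qed.

Fact aut_extend_funK : cancel (bc_extend f) (bc_extend (aut_inv f)).
Proof.
move=> x; rewrite -[LHS](bc_extend_comp gl fl) bc_extend_id // => z.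
exact: (aut_funK f z).
Qed.

Fact aut_extend_invK : cancel (bc_extend (aut_inv f)) (bc_extend f).
Proof.
move=> x; rewrite -[LHS](bc_extend_comp fl gl) bc_extend_id // => z.
exact: (aut_invK f z).
Qed.

Definition aut_extend : algAut (bc_algebra T A) :=
  @AlgAut _ (bc_algebra T A) (bc_extend f) (bc_extend (aut_inv f))
    (bc_extend_linear fl) aut_extend_mul aut_extend_funK aut_extend_invK.

End AutExtend.

End Maps.

Fact aut_extendM (A : algebra R) (S T : comAlg R) (h : algHom S T) :
  {morph aut_extend h (A := A) : f g / (f * g)%g}.
Proof.
move=> f g; apply: algAut_eq => x.
exact: (bc_extend_comp h (@aut_linear _ _ f) (@aut_linear _ _ g)).
Qed.

Fact aut_extend_id (A : algebra R) (S : comAlg R) :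
  aut_extend (algHom_id S) (A := A) =1 id.
Proof.
move=> f; apply: algAut_eq => x.
have fl := @aut_linear _ _ f; rewrite /=.
apply: (bc_ext (f := bc_extend (algHom_id S) f) (g := f)) x.
- exact: bc_extendD.
- by move=> x y; rewrite raddfD.
move=> s a; rewrite bc_extendE // [in RHS]bc_tensE [RHS]linearZ /=.
congr (_ *: _); move: (aut_fun _ _) => y.
apply: (bc_ext (f := bc_along (algHom_id S) (V := A)) (g := id)) y => //.
- exact: bc_alongD.
- by move=> s' a'; rewrite bc_alongE.
Qed.

Fact aut_extend_comp (A : algebra R) (S T U : comAlg R)
    (k : algHom T U) (h : algHom S T) :
  aut_extend (algHom_comp k h) (A := A) =1 aut_extend k (A := A) \o aut_extend h (A := A).
Proof.
move=> f; apply: algAut_eq => x /=.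
have fl := @aut_linear _ _ f; have hfl := bc_extend_linear h fl.
apply: (bc_ext (g := bc_extend k (bc_extend h f))) x.
- exact: bc_extendD.
- exact: bc_extendD.
move=> u a; rewrite !bc_extendE // scale1r; congr (_ *: _).
move: (aut_fun _ _) => y.
apply: (bc_ext (f := bc_along (algHom_comp k h) (V := A))
               (g := fun y => bc_along k (bc_along h y))) y.
- exact: bc_alongD.
- by move=> y y'; rewrite !bc_alongD.
- by move=> s a'; rewrite !bc_alongE.
Qed.

Definition Aut_functor (A : algebra R) : groupFunctor R :=
  @GroupFunctor R (fun S => algAut (bc_algebra S A) : groupType)
    (fun S T h => aut_extend h (A := A))
    (@aut_extendM A) (@aut_extend_id A) (@aut_extend_comp A).

End BaseChangeAlong.

Definition ideal_closed (R : comNzRingType) (I : {pred R}) : Prop :=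
  0 \in I /\ forall a, {in I &, forall u v, a * u + v \in I}.

(* idealr_closed describes proper ideals. *)
Definition maximal_ideal (R : comNzRingType) (m : {pred R}) : Prop :=
  idealr_closed m /\
  forall J : {pred R}, idealr_closed J -> {subset m <= J} -> {subset J <= m}.

(* Fields are included. *)
Record dedekind (R : idomainType) : Prop := Dedekind {
  dedekind_noetherian :
    forall I : {pred R}, ideal_closed I -> finitely_generated_ideal I;
  dedekind_integrally_closed : forall x : {fraction R},
    integralOver (@tofrac R) x -> exists r : R, x = tofrac r;
  dedekind_prime_maximal : forall P : {pred R},
    idealr_closed P -> prime_idealr_closed P -> (exists2 x, x \in P & x != 0) ->
    maximal_ideal P }.

(* Main.v *)
(* A flat G over a Dedekind domain has a matrix representation c whose entries generate
   B = O(G): a finitely generated subcomodule of B generating B as an algebra is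
   torsion-free, hence projective.  Since B is finitely presented, a matrix h over S is a
   point of G iff every relation of bounded degree between the entries of c holds for h,
   that is, iff the substitution c |-> c h respects the kernel of the evaluation
   pi : P -> W at c, where P is the free module on noncommutative words of bounded length
   and W, a submodule of B, is the image.
   The algebra is A = R e + R t + V + P + W with V = R^n.  The element e is a left identity
   and right multiplication by e has eigenvalues 1, g1, g2, g3, g4 on the five summands;
   these are units with unit differences, so that every automorphism fixes e and preserves
   the summands.  The products t t = t + (empty word), t p, v p and p t = pi(p) then force
   an automorphism to fix t and to be determined by its restriction h to V; it induces the
   substitution by h on P, and h descends to W exactly when h is a point of G. *)

Require Import Defs.
From HB Require Import structures.
From mathcomp Require Import all_boot all_algebra.
From mathcomp Require Import boolp.
From mathcomp Require Import mpoly.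

Set Implicit Arguments.
Unset Strict Implicit.
Unset Printing Implicit Defensive.

Import GRing.Theory.
Local Open Scope ring_scope.
Local Open Scope quotient_scope.

(** * Ideals and torsion-free modules over Dedekind domains *)

(** The automorphisms of S (x) A must be found for every R-algebra S, zero divisors and nilpotents
    included. Invertible differences of eigenvalues survive every base change, so the summands can
    be recovered over S. To keep the number of eigenvalues independent of n, the rows of c do not
    each get a copy of V: the row index of an entry is coded by repeated left multiplication by t,
    and a single copy of V supplies the column index. Words need not commute, since the
    commutativity of B is among the relations that pi kills. The main obstacle is that S (x) W -> S
    (x) B may fail to be injective, so a relation in S (x) W cannot be tested in S (x) B. That a
    point descends to S (x) W is therefore proved for the universal point only, with S = B flat, and
    pushed forward along B -> S. Conversely, the counit of B gives a linear form on S (x) W whose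
    composite with pi is evaluation at the identity matrix; it reads the relations for h off an
    automorphism. *)

Section LinearSets.
Variables (R : comPzRingType) (M : lmodType R) (N : M -> Prop).

Definition linear_closed_set := N 0 /\ forall a x y, N x -> N y -> N (a *: x + y).

(** By the dual basis lemma, for a closed set [N] this means being finitely generated and
    projective. The forms [phi] live on all of [M] but are constrained on [N] only, so that [N] need
    not be turned into a module. *)
Definition dual_basis_on :=
  exists k (v : 'I_k -> M) (phi : 'I_k -> M -> R),
    [/\ forall i, N (v i),
        forall i a x y, N x -> N y -> phi i (a *: x + y) = a * phi i x + phi i y &
        forall x, N x -> x = \sum_i phi i x *: v i].

Hypothesis Nc : linear_closed_set.

Lemma linear_set_sum n (c : 'I_n -> R) v :
  (forall i, N (v i)) -> N (\sum_i c i *: v i).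
Proof.
case: Nc => N0 NP Nv; elim/big_ind: _ => // [x y Nx Ny|i _].
  by rewrite -[x]scale1r; exact: NP.
by rewrite -[_ *: _]addr0; exact: NP.
Qed.

End LinearSets.

Section Ideals.
Variable R : comNzRingType.
Implicit Types I J : {pred R}.

Lemma ideal_mul I a x : ideal_closed I -> x \in I -> a * x \in I.
Proof. by move=> [I0 IP] xI; rewrite -[_ * _]addr0; exact: IP. Qed.

Lemma ideal_add I x y : ideal_closed I -> x \in I -> y \in I -> x + y \in I.
Proof. by move=> [_ IP] xI yI; rewrite -[x]mul1r; exact: IP. Qed.

Lemma ideal_sum I n (x : 'I_n -> R) :
  ideal_closed I -> (forall i, x i \in I) -> \sum_i x i \in I.
Proof.
move=> Ic xI; elim/big_ind: _ => // [|u v]; first by case: Ic.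
exact: ideal_add.
Qed.

Lemma idealr_ideal I : idealr_closed I -> ideal_closed I.
Proof. by case=> I0 _ IP; split. Qed.

Hypothesis noeth :
  forall I, ideal_closed I -> finitely_generated_ideal I.

(** Without a maximal member there is a sequence in [F] that never stabilizes; its union is an ideal
    whose finitely many generators all lie in one term, a contradiction. The family [F] is arbitrary
    so as to cover both the proper ideals above a given one and the colon ideals inside a maximal
    ideal. *)
Lemma noetherian_maximal (F : {pred R} -> Prop) I0 :
  (forall I, F I -> ideal_closed I) -> F I0 ->
  exists2 I, F I & forall J, F J -> {subset I <= J} -> {subset J <= I}.
Proof.
move=> Fid FI0; apply: contrapT => nomax.
have next (I : {I | F I}) : exists J : {I | F I},
    {subset sval I <= sval J} /\ ~ {subset sval J <= sval I}.
  case: I => I FI /=; apply: contrapT => H; apply: nomax; exists I => // J FJ IJ.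
  by apply: contrapT => nJI; apply: H; exists (exist _ J FJ).
have [f fP] := choice next.
pose s k := iter k f (exist _ I0 FI0).
have s_mono k l : (k <= l)%N -> {subset sval (s k) <= sval (s l)}.
  move=> /subnKC <-; elim: (l - k)%N => [|j IH]; first by rewrite addn0.
  by rewrite addnS => x /IH; case: (fP (s (k + j)%N)) => + _; apply.
pose U : {pred R} := fun x => `[< exists k, x \in sval (s k) >].
have Uc : ideal_closed U.
  split; first by apply/asboolP; exists 0%N; case: (Fid _ FI0).
  move=> a u v /asboolP[k uk] /asboolP[l vl]; apply/asboolP.
  exists (maxn k l); have sc := Fid _ (svalP (s (maxn k l))).
  apply: ideal_add => //; first apply: ideal_mul => //.
    exact: s_mono (leq_maxl _ _) _ uk.
  exact: s_mono (leq_maxr _ _) _ vl.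
have [n [a aP]] := noeth Uc.
have aU i : a i \in U.
  apply/aP; exists (fun j => (j == i)%:R).
  rewrite (bigD1 i) //= eqxx mul1r big1 ?addr0 // => j /negbTE->.
  by rewrite mul0r.
have [k kP] := choice (fun i => asboolW (aU i)).
pose K := \max_i k i; case: (fP (s K)) => _; apply => x xK.
have /aP[c ->] : x \in U by apply/asboolP; exists K.+1.
have sc := Fid _ (svalP (s K)).
apply: ideal_sum => // i; apply: ideal_mul => //.
exact: s_mono (leq_bigmax i) _ (kP i).
Qed.

Lemma exists_maximal_ideal I : idealr_closed I ->
  exists2 m : {pred R}, maximal_ideal m & {subset I <= m}.
Proof.
move=> Ic.
pose F (J : {pred R}) : Prop := @idealr_closed R J /\ {subset I <= J}.
have [|m [mc Im] mmax] := @noetherian_maximal F I _ (conj Ic (fun _ => id)).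
  by move=> J [/idealr_ideal].
exists m => //; split=> // J Jc mJ; apply: mmax => //; split=> //.
by move=> x /Im/mJ.
Qed.

Lemma maximal_ideal_prime (m : {pred R}) : maximal_ideal m -> prime_idealr_closed m.
Proof.
move=> [mc mmax] u v uv; apply/orP; case: (boolP (u \in m)); first by left.
move=> num; right; have [m0 m1 mP] := mc; have mi := idealr_ideal mc.
pose J : {pred R} := fun x => `[< exists2 y, y \in m & exists r, x = y + r * u >].
case: (boolP (1 \in J)) => [/asboolP[y ym [r e]]|nJ].
  rewrite -[v]mul1r e mulrDl -mulrA; apply: ideal_add => //.
    by rewrite mulrC; exact: ideal_mul.
  exact: ideal_mul.
have Jc : idealr_closed J.
  split=> //.
    by apply/asboolP; exists 0 => //; exists 0; rewrite mul0r addr0.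
  move=> a _ _ /asboolP[y ym [r ->]] /asboolP[y' y'm [r' ->]]; apply/asboolP.
  exists (a * y + y'); first exact: mP.
  by exists (a * r + r'); rewrite mulrDr mulrDl mulrA addrACA.
have uJ : u \in J by apply/asboolP; exists 0 => //; exists 1; rewrite mul1r add0r.
case/negP: num; apply: (mmax J Jc) => // x xm.
by apply/asboolP; exists x => //; exists 0; rewrite mul0r addr0.
Qed.

End Ideals.

Lemma nonunit_maximal_ideal (R : comNzRingType) (x : R) :
  (forall I : {pred R}, ideal_closed I -> finitely_generated_ideal I) ->
  (forall y, y * x != 1) ->
  exists2 m : {pred R}, maximal_ideal m & x \in m.
Proof.
move=> noeth nux.
pose I : {pred R} := fun z => `[< exists y, z = y * x >].
have Ic : idealr_closed I.
  split; first by apply/asboolP; exists 0; rewrite mul0r.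
    by apply/asboolP => -[y /esym/eqP]; apply/negP.
  move=> a _ _ /asboolP[u ->] /asboolP[v ->]; apply/asboolP.
  by exists (a * u + v); rewrite mulrDl mulrA.
have [m mm Im] := exists_maximal_ideal noeth Ic.
by exists m => //; apply: Im; apply/asboolP; exists 1; rewrite mul1r.
Qed.

(** * Integrality and invertible ideals in a Dedekind domain *)

Section Dedekind.
Variable R : idomainType.
Hypothesis R_dedekind : dedekind R.
Implicit Types I J : {pred R}.

Let noeth := dedekind_noetherian R_dedekind.

Definition colon (d b : R) : {pred R} := fun x => `[< exists r, x * b = d * r >].

Lemma colonP d b x : reflect (exists r, x * b = d * r) (x \in colon d b).
Proof. exact: asboolP. Qed.

Lemma colon_ideal d b : ideal_closed (colon d b).
Proof.
split; first by apply/colonP; exists 0; rewrite mul0r mulr0.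
move=> a u v /colonP[r ur] /colonP[s vs]; apply/colonP.
by exists (a * r + s); rewrite mulrDl -mulrA ur vs mulrDr mulrCA.
Qed.

(* Among the ideals (d : b) contained in m, with b outside (d), a maximal one
   is prime, hence equal to m. *)
Lemma maximal_ideal_colon (m : {pred R}) d :
  maximal_ideal m -> d \in m -> d != 0 ->
  exists2 b, (forall r, b != d * r) & {subset m <= colon d b}.
Proof.
move=> mm dm d0; have [mc mmax] := mm; have [m0 m1 mP] := mc.
pose F J := (exists2 b, (forall r, b != d * r) & J = colon d b) /\ {subset J <= m}.
have F1 : F (colon d 1).
  split; last first.
    move=> x /colonP[r]; rewrite mulr1 mulrC => ->.
    by apply: ideal_mul => //; apply: idealr_ideal.
  exists 1 => // r; apply/eqP => e; case/negP: m1; rewrite e mulrC.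
  by apply: ideal_mul => //; apply: idealr_ideal.
have [|I [[b bP ->] Im] Imax] := noetherian_maximal noeth _ F1.
  by move=> J [[b _ ->] _]; exact: colon_ideal.
exists b => //.
have Cc : idealr_closed (colon d b).
  split; [by case: (colon_ideal d b) | | by case: (colon_ideal d b)].
  by apply: contra m1; exact: Im.
have Cp : prime_idealr_closed (colon d b).
  move=> u v uv; apply/orP; case: (boolP (v \in colon d b)); first by right.
  move=> nv; left.
  have nvb r : v * b != d * r.
    by apply: contra nv => /eqP e; apply/colonP; exists r.
  have sub_b w : {subset colon d b <= colon d (w * b)}.
    move=> x /colonP[r e]; apply/colonP; exists (w * r).
    by rewrite mulrCA e mulrCA.
  (* Maximality applies to (d : v b) only if this ideal stays in m. Otherwise it contains some [s]
     outside m, and (d : s b) serves instead: it stays in m because m is prime, and it contains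
     v. *)
  have [vm|/existsNP[s /not_implyP[/colonP[r es] nsm]]] :=
      EM (forall x, x \in colon d (v * b) -> x \in m).
    have Fv : F (colon d (v * b)) by split=> //; exists (v * b).
    apply: (Imax _ Fv (sub_b v)); apply/colonP; move/colonP: uv => [r e].
    by exists r; rewrite mulrA.
  case/negP: nv.
  have sm : {subset colon d (s * b) <= m}.
    move=> z /colonP[q e].
    have /Im : z * s \in colon d b by apply/colonP; exists q; rewrite -mulrA.
    by case/(maximal_ideal_prime mm)/orP => // /nsm.
  have Fs : F (colon d (s * b)).
    split=> //; exists (s * b) => // q; apply/eqP => e; case: nsm; apply: Im.
    by apply/colonP; exists q.
  apply: (Imax _ Fs (sub_b s)); apply/colonP; exists r.
  by rewrite mulrCA.
have [|_ Cmax] := dedekind_prime_maximal R_dedekind Cc Cp.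
  exists d => //; apply/colonP; exists b; by [].
exact: Cmax mc Im.
Qed.

(** Determinant trick: the fraction b / d maps a nonzero finitely generated ideal into itself, so it
    is an eigenvalue of a matrix over R, hence a root of a monic polynomial, and R is integrally
    closed. *)
Lemma dedekind_stable_multiple I b d : ideal_closed I ->
  (exists2 y, y \in I & y != 0) -> d != 0 ->
  (forall y, y \in I -> exists2 y', y' \in I & b * y = d * y') ->
  exists r, b = d * r.
Proof.
move=> Ic [y0 y0I y0n0] d0 bI.
have [k [g gP]] := noeth Ic.
have gI i : g i \in I.
  apply/gP; exists (fun j => (j == i)%:R).
  rewrite (bigD1 i) //= eqxx mul1r big1 ?addr0 // => j /negbTE->.
  by rewrite mul0r.
have /choice[A AP] (i : 'I_k) :
    exists c : 'I_k -> R, b * g i = d * \sum_j c j * g j.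
  by have [y /gP[c ->] e] := bI _ (gI i); exists c.
pose F : R -> {fraction R} := @tofrac R.
have F0 x : (F x == 0) = (x == 0) by rewrite tofrac_eq0.
pose x : {fraction R} := F b / F d.
pose M : 'M[R]_k := \matrix_(i, j) A j i.
have Fd0 : F d != 0 by rewrite F0.
suff : integralOver F x.
  case/(dedekind_integrally_closed R_dedekind) => r xr; exists r.
  apply/eqP; rewrite -subr_eq0 -tofrac_eq0 tofracB tofracM subr_eq0 -xr.
  by rewrite /x mulrC divfK.
exists (char_poly M); first exact: char_poly_monic.
rewrite map_char_poly -eigenvalue_root_char; apply/eigenvalueP.
exists (\row_i F (g i)).
  apply/rowP => i; rewrite !mxE /x mulrAC; apply: (mulIf Fd0).
  rewrite divfK // -rmorphM AP rmorphM rmorph_sum mulrC; congr (_ * _).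
  by apply: eq_bigr => j _; rewrite !mxE rmorphM mulrC.
apply: contra y0n0 => /eqP/rowP g0; have /gP[c ->] := y0I; apply/eqP.
apply: big1 => i _; have /eqP := g0 i; rewrite !mxE F0 => /eqP->.
by rewrite mulr0.
Qed.

(* With I' = (a : I) and J = I I' / a, suppose that J lies in a maximal ideal m.  Then
   b m <= (a) for some b outside (a), and b / a maps I' into itself, hence is integral. *)
Lemma dedekind_invertible I a : ideal_closed I -> a \in I -> a != 0 ->
  exists k (x y : 'I_k -> R), [/\ forall i, x i \in I,
    forall i z, z \in I -> exists r, y i * z = a * r &
    a = \sum_i x i * y i].
Proof.
move=> Ic aI a0.
pose I' : {pred R} := fun y => `[< forall z, z \in I -> exists r, y * z = a * r >].
pose J : {pred R} := fun r => `[< exists k (x y : 'I_k -> R),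
  [/\ forall i, x i \in I, forall i, y i \in I' & r * a = \sum_i x i * y i] >].
have I'c : ideal_closed I'.
  split; first by apply/asboolP => z _; exists 0; rewrite mul0r mulr0.
  move=> c u v /asboolP uI /asboolP vI; apply/asboolP => z zI.
  have [[r e] [s e']] := (uI z zI, vI z zI).
  by exists (c * r + s); rewrite mulrDl -mulrA e e' mulrDr mulrCA.
have Jc : ideal_closed J.
  split.
    apply/asboolP; exists 0%N, (fun=> 0), (fun=> 0).
    by rewrite big_ord0 mul0r; split=> // -[].
  move=> c u v /asboolP[k [x [y [xI yI e]]]] /asboolP[l [x' [y' [x'I y'I e']]]].
  apply/asboolP; exists (k + l)%N.
  exists (fun i => match split i with inl i => c * x i | inr i => x' i end).
  exists (fun i => match split i with inl i => y i | inr i => y' i end); split.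
  - by move=> i; case: split => // j; exact: ideal_mul.
  - by move=> i; case: split.
  rewrite big_split_ord mulrDl -mulrA e e' mulr_sumr /=; congr (_ + _).
    by apply: eq_bigr => i _; rewrite (unsplitK (inl i)) mulrA.
  by apply: eq_bigr => i _; rewrite (unsplitK (inr i)).
have JM z y : z \in I -> y \in I' -> exists2 r, r \in J & z * y = a * r.
  move=> zI yI'; have /asboolP/(_ z zI)[r e] := yI'; exists r; last first.
    by rewrite mulrC.
  apply/asboolP; exists 1%N, (fun=> z), (fun=> y).
  by rewrite big_ord1 mulrC -e mulrC.
have aI' : a \in I' by apply/asboolP => z _; exists z.
case: (boolP (1 \in J)) => [/asboolP[k [x [y [xI yI e]]]]|J1].
  exists k, x, y; split=> //; last by rewrite -e mul1r.
  by move=> i; have /asboolP := yI i.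
have [|m mm Jm] := @exists_maximal_ideal R noeth J; first by case: Jc; split.
have aJ : a \in J.
  by have [r rJ /(mulfI a0) ->] := JM _ _ aI aI'.
have [b bP mb] := maximal_ideal_colon mm (Jm _ aJ) a0.
have [|y yI'|r e] := dedekind_stable_multiple I'c _ a0 (b := b).
- by exists a.
(* As [a] is in I, I' lies in J and hence in m, which gives b y = a y'. For z in I the quotient z y
   / a is in J, hence in m, so that z y' = b (z y / a) is a multiple of [a]. *)
- have [r rJ e] := JM _ _ aI yI'; have /mb/colonP[y' ey'] := Jm _ rJ.
  exists y'; last first.
    by apply: (mulfI a0); rewrite mulrCA e mulrCA [b * r]mulrC ey'.
  apply/asboolP => z zI; have [r' r'J e'] := JM _ _ zI yI'.
  have /mb/colonP[r'' er''] := Jm _ r'J; exists r''.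
  rewrite -(mulfI a0 e) in ey'; apply: (mulfI a0).
  by rewrite mulrA -ey' -er'' [RHS]mulrA -e' mulrC mulrA.
by have /eqP := bP r.
Qed.

(* Unless m_0 depends on the other m_i, its coefficient in q x is a linear map from N to
   an ideal, which splits because the ideal is invertible. *)
Lemma dedekind_dual_basis (M : lmodType R) k (m : 'I_k -> M) q (N : M -> Prop) :
  (forall r (x : M), r *: x = 0 -> r = 0 \/ x = 0) ->
  q != 0 -> linear_closed_set N ->
  (forall x, N x -> exists c : 'I_k -> R, q *: x = \sum_i c i *: m i) ->
  dual_basis_on N.
Proof.
move=> tf; elim: k m q N => [|k IH] m q N q0 [N0 NP] Nm.
  exists 0%N, (fun=> 0), (fun _ _ => 0); split=> [[]//|[]//|x /Nm[c]].
  by rewrite !big_ord0 => /tf[/eqP|]//; rewrite (negbTE q0).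
have [[r r0 [d rd]]|indep] := EM (exists2 r, r != 0 &
    exists d : 'I_k -> R, r *: m ord0 = \sum_i d i *: m (lift ord0 i)).
  (* The denominator [q] in the statement serves this case: the relation eliminates m_0 at the cost
     of replacing [q] by [r * q]. *)
  apply: (IH (fun i => m (lift ord0 i)) (r * q)) => [|//|x /Nm[c cx]].
    by rewrite mulf_neq0.
  exists (fun i => c ord0 * d i + r * c (lift ord0 i)).
  rewrite -scalerA cx big_ord_recl scalerDr scalerA mulrC -scalerA rd !scaler_sumr.
  by rewrite -big_split; apply: eq_bigr => i _; rewrite scalerDl !scalerA.
pose K (x : M) (s : R) := exists c : 'I_k -> R,
  q *: x = s *: m ord0 + \sum_i c i *: m (lift ord0 i).
have Kex x : N x -> exists s, K x s.
  move=> /Nm[c cx]; exists (c ord0), (fun i => c (lift ord0 i)).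
  by rewrite cx big_ord_recl.
have Klin a x y s t : K x s -> K y t -> K (a *: x + y) (a * s + t).
  move=> [c e] [d e']; exists (fun i => a * c i + d i).
  rewrite scalerDr scalerA mulrC -scalerA e e' scalerDr addrACA !scalerA -scalerDl.
  rewrite scaler_sumr -big_split; congr (_ + _); apply: eq_bigr => i _.
  by rewrite scalerDl scalerA.
have K0 s : K 0 s -> s = 0.
  move=> [c e]; apply/eqP/negP => /negP s0; apply: indep; exists s => //.
  exists (fun i => - c i); apply/eqP; rewrite -subr_eq0 -sumrN.
  rewrite [X in _ + X](eq_bigr (fun i => c i *: m (lift ord0 i))) => [|i _]; last first.
    by rewrite scaleNr opprK.
  by rewrite -e scaler0 eqxx.
have Kuniq x s t : K x s -> K x t -> s = t.
  move=> xs xt; have := Klin (-1) _ _ _ _ xs xt.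
  by rewrite scaleN1r addNr mulN1r => /K0/eqP; rewrite addrC subr_eq0 => /eqP.
have [kappa kP] : exists f : M -> R, forall x, N x -> K x (f x).
  have H x : exists s, N x -> K x s.
    by have [/Kex[s Ks]|nN] := EM (N x); [exists s | exists 0].
  by have [f fP] := choice H; exists f.
have klin a x y : N x -> N y -> kappa (a *: x + y) = a * kappa x + kappa y.
  by move=> Nx Ny; apply: Kuniq (kP _ (NP _ _ _ Nx Ny)) (Klin _ _ _ _ _ _ _); exact: kP.
pose I : {pred R} := fun s => `[< exists2 x, N x & s = kappa x >].
have Ic : ideal_closed I.
  split.
    apply/asboolP; exists 0 => //; apply: Kuniq (kP _ N0).
    by exists (fun=> 0); rewrite scaler0 scale0r add0r big1 // => i _; rewrite scale0r.
  move=> a _ _ /asboolP[x Nx ->] /asboolP[y Ny ->]; apply/asboolP.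
  by exists (a *: x + y); [exact: NP | rewrite klin].
have IHker (N' : M -> Prop) : linear_closed_set N' ->
    (forall x, N' x -> N x /\ kappa x = 0) -> dual_basis_on N'.
  move=> N'c N'P; apply: (IH (fun i => m (lift ord0 i)) q) => // x /N'P[Nx k0].
  by have [c] := kP _ Nx; rewrite k0 scale0r add0r => e; exists c.
have [[a aI a0]|I0] := EM (exists2 a, a \in I & a != 0); last first.
  apply: IHker => // x Nx; split=> //; apply: contrapT => /eqP k0.
  by apply: I0; exists (kappa x) => //; apply/asboolP; exists x.
have [l [x [y [xI yI ea]]]] := dedekind_invertible Ic aI a0.
have kI z : N z -> kappa z \in I by move=> Nz; apply/asboolP; exists z.
have Nsum p (c : 'I_p -> R) u : (forall i, N (u i)) -> N (\sum_i c i *: u i).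
  exact: linear_set_sum.
have ksum p (c : 'I_p -> R) u : (forall i, N (u i)) ->
    kappa (\sum_i c i *: u i) = \sum_i c i * kappa (u i).
  have k0 : kappa 0 = 0.
    have := klin 0 0 0 N0 N0; rewrite scale0r add0r mul0r add0r.
    by have := klin (-1) 0 0 N0 N0; rewrite scaler0 add0r mulN1r addNr.
  elim: p c u => [|p IHp] c u Nu; first by rewrite !big_ord0.
  by rewrite !big_ord_recl klin ?IHp //; exact: Nsum.
have /choice[n nP] (i : 'I_l) : exists n, N n /\ x i = kappa n.
  by have /asboolP[n Nn e] := xI i; exists n.
have /choice[psi psiP] (i : 'I_l) :
    exists f : M -> R, forall z, N z -> y i * kappa z = a * f z.
  have H z : exists r, N z -> y i * kappa z = a * r.
    by have [/kI/(yI i)[r e]|nN] := EM (N z); [exists r | exists 0].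
  by have [f fP] := choice H; exists f.
have psilin i c u w : N u -> N w -> psi i (c *: u + w) = c * psi i u + psi i w.
  move=> Nu Nw; apply: (mulfI a0); rewrite -psiP; last exact: NP.
  by rewrite klin // mulrDr mulrCA !psiP // mulrDr mulrCA.
(* Since [a] is the sum of the x_i y_i, [psi i] is y_i kappa / a and kappa (n_i) = x_i, the
   subtracted sum has the same [kappa] as z. Thus [rest] retracts N onto the kernel of [kappa], to
   which the induction hypothesis applies. *)
pose rest z := z - \sum_i psi i z *: n i.
have Nn i : N (n i) by case: (nP i).
have Nrest z : N z -> N (rest z).
  by move=> Nz; rewrite /rest addrC -scaleN1r; apply: NP => //; exact: Nsum.
have restlin c u w : N u -> N w -> rest (c *: u + w) = c *: rest u + rest w.
  move=> Nu Nw; rewrite /rest scalerBr scaler_sumr addrACA -opprD -big_split.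
  by congr (_ - _); apply: eq_bigr => i _; rewrite psilin // scalerDl scalerA.
have krest z : N z -> kappa (rest z) = 0.
  move=> Nz; rewrite /rest addrC -scaleN1r klin //; last exact: Nsum.
  rewrite ksum // mulN1r; apply/eqP; rewrite addrC subr_eq0; apply/eqP/(mulfI a0).
  rewrite mulr_sumr [in LHS]ea mulr_suml; apply: eq_bigr => i _.
  by rewrite -mulrA psiP // mulrCA (proj2 (nP i)) [X in _ * X]mulrC.
have [|z []//|p [v [phi [vN' philin phiE]]]] :=
    IHker (fun z => N z /\ kappa z = 0).
  split=> [|c u w [Nu ku] [Nw kw]]; last first.
    by split; [exact: NP | rewrite klin // ku kw mulr0 addr0].
  by split=> //; have := klin (-1) 0 0 N0 N0; rewrite scaler0 add0r mulN1r addNr.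
have N'rest z : N z -> N (rest z) /\ kappa (rest z) = 0.
  by move=> Nz; split; [exact: Nrest | exact: krest].
exists (l + p)%N.
exists (fun i => match split i with inl i => n i | inr i => v i end).
exists (fun i z => match split i with inl i => psi i z | inr i => phi i (rest z) end).
split.
- by move=> i; case: split => j //; case: (vN' j).
- move=> i c u w Nu Nw; case: split => j; first exact: psilin.
  by rewrite restlin // philin //; exact: N'rest.
- move=> z Nz; rewrite big_split_ord /=.
  rewrite (eq_bigr (fun i => psi i z *: n i)) => [|i _]; last first.
    by rewrite (unsplitK (inl i)).
  rewrite [X in _ + X](eq_bigr (fun i => phi i (rest z) *: v i)) => [|i _]; last first.
    by rewrite (unsplitK (inr i)).
  rewrite -phiE; last exact: N'rest.
  by rewrite /rest addrC subrK.
Qed.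

Lemma dedekind_unit (x : R) :
  (forall m : {pred R}, maximal_ideal m -> x \notin m) -> exists y, y * x = 1.
Proof.
move=> xm; apply: contrapT => nux.
have [|m /xm/negP] := @nonunit_maximal_ideal R x noeth; last by [].
by move=> y; apply/eqP => e; apply: nux; exists y.
Qed.

End Dedekind.

(** * Tensor products, flatness and dual bases *)

Record submodule (R : comPzRingType) (M : lmodType R) := Submodule {
  sm_set :> M -> Prop;
  sm_closed : linear_closed_set sm_set }.

Section SubQuotient.
Variables (R : comPzRingType) (M : lmodType R) (P : submodule M).

Definition sm_pred : {pred M} := fun x => `[< P x >].

Fact sm_pred_closed : subsemimod_closed sm_pred.
Proof.
have [P0 PP] := sm_closed P; split=> [|a x /asboolP Px].
  split=> [|x y /asboolP Px /asboolP Py]; apply/asboolP => //.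
  by rewrite -[x]scale1r; exact: PP.
by apply/asboolP; rewrite -[_ *: _]addr0; exact: PP.
Qed.
HB.instance Definition _ := GRing.isSubmodClosed.Build R M sm_pred sm_pred_closed.

Definition sub_mod : Type := {x : M | sm_pred x}.
HB.instance Definition _ := SubType.on sub_mod.
HB.instance Definition _ := Choice.on sub_mod.
HB.instance Definition _ := [SubChoice_isSubLmodule of sub_mod by <:].

Lemma sub_modP (x : sub_mod) : P (val x).
Proof. by case: x => x Px; apply/asboolP. Qed.

Lemma sub_mod_valP a (x y : sub_mod) : val (a *: x + y) = a *: val x + val y.
Proof. exact: (linearP val). Qed.

Definition quot_mod : Type := Quotient.quot sm_pred.
HB.instance Definition _ := GRing.Zmodule.on quot_mod.

Definition quot_pi (x : M) : quot_mod := \pi_(Quotient.quot sm_pred) x.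

Lemma quot_pi_eq x y : quot_pi x = quot_pi y <-> P (x - y).
Proof.
rewrite /quot_pi; split => [/eqP|Pxy].
  by rewrite -Quotient.idealrBE => /asboolP.
by apply/eqP; rewrite -Quotient.idealrBE; apply/asboolP.
Qed.

Lemma quot_piD : {morph quot_pi : x y / x + y}.
Proof. by move=> x y; rewrite /quot_pi raddfD. Qed.

Lemma quot_pi_repr (q : quot_mod) : quot_pi (repr q) = q.
Proof. exact: reprK. Qed.

Definition quot_scale (a : R) (q : quot_mod) : quot_mod := quot_pi (a *: repr q).

Fact quot_scale_pi a x : quot_scale a (quot_pi x) = quot_pi (a *: x).
Proof.
apply/quot_pi_eq; rewrite -scalerBr -[_ *: _]addr0.
have [P0 PP] := sm_closed P; apply: PP => //; apply/quot_pi_eq.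
exact: quot_pi_repr.
Qed.

Fact quot_scaleA a b q : quot_scale a (quot_scale b q) = quot_scale (a * b) q.
Proof. by rewrite -[q]quot_pi_repr !quot_scale_pi scalerA. Qed.
Fact quot_scale1 : left_id 1 quot_scale.
Proof. by move=> q; rewrite -[q]quot_pi_repr quot_scale_pi scale1r. Qed.
Fact quot_scaleDr : right_distributive quot_scale +%R.
Proof.
move=> a p q; rewrite -[p]quot_pi_repr -[q]quot_pi_repr -quot_piD.
by rewrite !quot_scale_pi -quot_piD scalerDr.
Qed.
Fact quot_scaleDl q : {morph quot_scale^~ q : a b / a + b}.
Proof.
by move=> a b; rewrite -[q]quot_pi_repr !quot_scale_pi -quot_piD scalerDl.
Qed.
HB.instance Definition _ := GRing.Zmodule_isLmodule.Build R quot_mod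
  quot_scaleA quot_scale1 quot_scaleDr quot_scaleDl.

Fact quot_pi_linear : linear quot_pi.
Proof. by move=> a x y; rewrite quot_piD -quot_scale_pi. Qed.
HB.instance Definition _ :=
  GRing.isLinear.Build R M quot_mod *:%R quot_pi quot_pi_linear.

End SubQuotient.

Section TensorMapLinear.
Variables (R : comPzRingType) (M M' N N' : lmodType R).
Variables (f : {linear M -> M'}) (g : {linear N -> N'}).

Fact tensor_map_linear : linear (tensor_map f g).
Proof.
move=> a x y; rewrite tensor_mapD; congr (_ + _).
apply: (tensor_ext (f := fun x => tensor_map f g (a *: x))
                   (g := fun x => a *: tensor_map f g x)) x.
- by move=> x1 x2; rewrite scalerDr tensor_mapD.
- by move=> x1 x2; rewrite tensor_mapD scalerDr.
- by move=> m n; rewrite tensZl !tensor_map_tens linearZ tensZl.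
Qed.
HB.instance Definition _ := GRing.isLinear.Build R (tensor M N) (tensor M' N') *:%R
  (tensor_map f g) tensor_map_linear.

End TensorMapLinear.

Section LinearMaps.
Variables (R : comPzRingType) (U V : lmodType R) (f : U -> V).
Hypothesis fl : linear f.

Lemma linear_map0 : f 0 = 0.
Proof. by have := fl (-1) 0 0; rewrite scaler0 addr0 scaleN1r addNr. Qed.
Lemma linear_mapZ a x : f (a *: x) = a *: f x.
Proof. by rewrite -[a *: x]addr0 fl linear_map0 addr0. Qed.
Lemma linear_mapD x y : f (x + y) = f x + f y.
Proof. by rewrite -[x in LHS]scale1r fl scale1r. Qed.
Lemma linear_map_sum I (r : seq I) (P : pred I) (F : I -> U) :
  f (\sum_(i <- r | P i) F i) = \sum_(i <- r | P i) f (F i).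
Proof. exact: (big_morph f linear_mapD linear_map0). Qed.

End LinearMaps.

Section TensorTheory.
Variables (R : comPzRingType) (M N : lmodType R).

Lemma tens0r (m : M) : tens m (0 : N) = 0.
Proof. by apply: (addrI (tens m 0)); rewrite -tensDr !addr0. Qed.

Lemma tensNr (m : M) (n : N) : tens m (- n) = - tens m n.
Proof. by apply: (addrI (tens m n)); rewrite -tensDr !subrr tens0r. Qed.

Lemma tens_suml I (r : seq I) (P : pred I) (F : I -> M) (n : N) :
  tens (\sum_(i <- r | P i) F i) n = \sum_(i <- r | P i) tens (F i) n.
Proof.
by apply: (big_morph (fun m => tens m n)) => [x y|]; rewrite ?tensDl ?tens0l.
Qed.

Lemma tens_sumr I (r : seq I) (P : pred I) (m : M) (F : I -> N) :
  tens m (\sum_(i <- r | P i) F i) = \sum_(i <- r | P i) tens m (F i).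
Proof.
by apply: (big_morph (fun n => tens m n)) => [x y|]; rewrite ?tensDr ?tens0r.
Qed.

Definition tens_at (n : N) (m : M) : tensor M N := tens m n.
Fact tens_at_linear n : linear (tens_at n).
Proof. by move=> a x y; rewrite /tens_at tensDl tensZl. Qed.
HB.instance Definition _ n :=
  GRing.isLinear.Build R M (tensor M N) *:%R (tens_at n) (tens_at_linear n).

Lemma tlift_linear (Q : lmodType R) (f : M -> N -> Q) :
  (forall n, linear (f^~ n)) -> (forall m, linear (f m)) ->
  balanced f /\ linear (tlift f).
Proof.
move=> fl fr.
have fb : balanced f.
  split=> [n|m|r m n]; [exact: linear_mapD|exact: linear_mapD|].
  by rewrite (linear_mapZ (fl n)) (linear_mapZ (fr m)).
split=> // a x y; rewrite (tliftD fb); congr (_ + _).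
apply: (tensor_ext (f := fun x => tlift f (a *: x)) (g := fun x => a *: tlift f x)) x.
- by move=> x1 x2; rewrite scalerDr (tliftD fb).
- by move=> x1 x2; rewrite (tliftD fb) scalerDr.
- by move=> m n; rewrite tensZl !(tlift_tens fb) (linear_mapZ (fl n)).
Qed.

Lemma tensor_bilinear (Q : lmodType R) (f : M -> N -> Q) :
  (forall n, linear (f^~ n)) -> (forall m, linear (f m)) ->
  exists h : {linear tensor M N -> Q}, forall m n, h (tens m n) = f m n.
Proof.
move=> fl fr; have [fb tl] := tlift_linear fl fr.
pose h : {linear tensor M N -> Q} := HB.pack (tlift f)
  (GRing.isLinear.Build R (tensor M N) Q *:%R _ tl).
by exists h => m n; exact: tlift_tens.
Qed.

End TensorTheory.

Section RightTensors.
Variables (R : comPzRingType) (M N : lmodType R).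

(** The image of M (x) P in M (x) N. The map from M (x) P need not be injective, so the image is
    used in its place. *)
Definition right_tens (P : N -> Prop) (x : tensor M N) := exists k (m : 'I_k -> M) n,
  (forall i, P (n i)) /\ x = \sum_i tens (m i) (n i).

Lemma right_tens_closed (P : N -> Prop) : linear_closed_set (right_tens P).
Proof.
split=> [|a x y [k [m [n [nP ->]]]] [l [m' [n' [n'P ->]]]]].
  by exists 0%N, (fun=> 0), (fun=> 0); split; [case | rewrite big_ord0].
exists (k + l)%N.
exists (fun i => match split i with inl i => a *: m i | inr i => m' i end).
exists (fun i => match split i with inl i => n i | inr i => n' i end); split.
  by move=> i; case: split.
rewrite big_split_ord /= scaler_sumr; congr (_ + _); apply: eq_bigr => i _.
  by rewrite (unsplitK (inl i)) tensZl.
by rewrite (unsplitK (inr i)).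
Qed.

Lemma right_tens1 (P : N -> Prop) m n : P n -> right_tens P (tens m n).
Proof. by exists 1%N, (fun=> m), (fun=> n); rewrite big_ord1. Qed.

Lemma tensor_right_tens (x : tensor M N) : right_tens (fun=> True) x.
Proof.
elim/tensor_ind: x => [|x y|m n]; last exact: right_tens1.
  by case: (right_tens_closed (fun=> True)).
by rewrite -[x in x + y]scale1r; case: (right_tens_closed (fun=> True)) => _; apply.
Qed.

(* Right exactness: the balanced map (m, [n]) |-> [m (x) n] inverts
   M (x) N / im (M (x) P) -> M (x) (N / P). *)
Lemma tensor_quot_ker (P : submodule N) (x : tensor M N) :
  tensor_map idfun (quot_pi P) x = 0 -> right_tens P x.
Proof.
pose K : submodule (tensor M N) := Submodule (right_tens_closed P).
pose f (m : M) (q : quot_mod P) : quot_mod K := quot_pi K (tens m (repr q)).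
have fE m n : f m (quot_pi P n) = quot_pi K (tens m n).
  apply/quot_pi_eq => /=; rewrite -[tens m n]scale1r.
  have -> : tens m (repr (quot_pi P n)) - 1 *: tens m n = tens m (repr (quot_pi P n) - n).
    by rewrite tensDr tensNr scale1r.
  by apply: right_tens1; apply/quot_pi_eq; rewrite quot_pi_repr.
have [fb fl] : balanced f /\ linear (tlift f).
  apply: tlift_linear => [q|m] a x1 y1.
    by rewrite -linearP /f tensDl tensZl.
  rewrite -[x1]quot_pi_repr -[y1]quot_pi_repr -linearP !fE -linearP.
  by rewrite tensDr tensZr.
have tE : forall y, tlift f (tensor_map idfun (quot_pi P) y) = quot_pi K y.
  apply: tensor_ext => [y z|y z|m n].
  - by rewrite tensor_mapD (tliftD fb).
  - exact: quot_piD.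
  - by rewrite tensor_map_tens (tlift_tens fb) fE.
move=> x0; have := tE x; rewrite x0.
by rewrite (linear_map0 fl) -[0 in LHS](linear0 (quot_pi K)) => /esym/quot_pi_eq; rewrite subr0.
Qed.

End RightTensors.

(** The forms of the dual basis give each tensor coordinates in its second factor, natural in that
    factor. A tensor is recovered from its coordinates, and an injective [g] is injective on each of
    them. *)
Lemma dual_basis_flat (R : comPzRingType) (M : lmodType R) :
  dual_basis_on (fun _ : M => True) -> flat M.
Proof.
move=> [k [v [phi [_ philin phiE]]]] N N' g ginj.
have phil i : linear (phi i : M -> R^o) by move=> a x y; exact: philin.
pose c (Q : lmodType R) i : tensor M Q -> Q := tlift (fun m n => phi i m *: n).
have cP (Q : lmodType R) i : balanced (fun m (n : Q) => phi i m *: n) /\ linear (c Q i).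
  apply: tlift_linear => [n|m] a x y.
    by rewrite philin // scalerDl scalerA.
  by rewrite scalerDr !scalerA mulrC.
have cD (Q : lmodType R) i : {morph c Q i : x y / x + y}.
  by case: (cP Q i) => b _; exact: tliftD.
have cE (Q : lmodType R) (x : tensor M Q) : x = \sum_i tens (v i) (c Q i x).
  apply: (tensor_ext (f := id) (g := fun x => \sum_i tens (v i) (c Q i x))) => //.
    by move=> y z; rewrite -big_split; apply: eq_bigr => i _; rewrite cD tensDr.
  move=> m n; rewrite [m in LHS]phiE // tens_suml; apply: eq_bigr => i _.
  by case: (cP Q i) => b _; rewrite /c (tlift_tens b) tensZ.
have cg i (x : tensor M N) : c N' i (tensor_map idfun g x) = g (c N i x).
  apply: (tensor_ext (f := fun x => c N' i (tensor_map idfun g x))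
                     (g := fun x => g (c N i x))) x.
  - by move=> x y; rewrite tensor_mapD cD.
  - by move=> x y; rewrite cD linearD.
  - move=> m n; rewrite tensor_map_tens.
    case: (cP N i) (cP N' i) => b _ [b' _].
    by rewrite /c (tlift_tens b) (tlift_tens b') linearZ.
move=> x y exy; rewrite [x]cE [y]cE; apply: eq_bigr => i _; congr (tens _ _).
by apply: ginj; rewrite -!cg exy.
Qed.

(** Flatness is applied to multiplication by r on R, which takes x (x) 1 to x (x) r = r x (x) 1 =
    0. *)
Lemma flat_torsion_free (R : idomainType) (M : lmodType R) :
  flat M -> forall r (x : M), r *: x = 0 -> r = 0 \/ x = 0.
Proof.
move=> Mfl r x rx; case: (eqVneq r 0) => [|r0]; first by left.
right.
have mlin : linear (fun s : R^o => (r * s : R^o)).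
  by move=> a s t; rewrite mulrDr /= mulrCA.
pose m : {linear R^o -> R^o} := HB.pack (fun s : R^o => (r * s : R^o))
  (GRing.isLinear.Build R R^o R^o *:%R _ mlin).
have minj : injective m by move=> s t /(mulfI r0).
have [bal _] : balanced (fun (y : M) (s : R^o) => s *: y) /\
    linear (tlift (fun (y : M) (s : R^o) => s *: y)).
  apply: tlift_linear => [n|y] a u w.
    by rewrite scalerDr !scalerA mulrC.
  by rewrite scalerDl scalerA.
have : tens x (1 : R^o) = tens 0 (1 : R^o).
  apply: (Mfl _ _ _ minj); rewrite !tensor_map_tens /= mulr1 tens0l.
  have -> : r = r *: (1 : R^o) by rewrite /GRing.scale /= mulr1.
  by rewrite -tensZ rx tens0l.
by move/(congr1 (tlift (fun (y : M) (s : R^o) => s *: y)));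
   rewrite !(tlift_tens bal) !scale1r.
Qed.

Section BilinearAlgebra.
Variables (R : comPzRingType) (M : lmodType R) (mu : M -> M -> M).
Hypotheses (mul : forall y, linear (mu^~ y)) (mur : forall x, linear (mu x)).

(** The [let] makes both proofs of linearity arguments of the constant, so that its linear structure
    can be inferred from the constant alone. *)
Definition bilinear_mul : tensor M M -> M :=
  let _ := conj mul mur in tlift mu.

Fact bilinear_mul_linear : linear bilinear_mul.
Proof. by case: (tlift_linear mul mur). Qed.
HB.instance Definition _ := GRing.isLinear.Build R (tensor M M) M *:%R
  bilinear_mul bilinear_mul_linear.

Definition bilinear_algebra : algebra R := @Algebra R M bilinear_mul.

Lemma bilinear_algebraE (x y : M) : alg_mul bilinear_algebra (tens x y) = mu x y.
Proof. by case: (tlift_linear mul mur) => b _; exact: tlift_tens b x y. Qed.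

End BilinearAlgebra.

(** * The tensor product of two commutative algebras and its universal property *)

Section TensorRing.
Variables (R : comPzRingType) (B C : comAlg R).

Fact comAlg_mul_linearl (y : C) : linear (fun x : C => x * y).
Proof. by move=> a x x'; rewrite mulrDl alg_scaleAl. Qed.
Fact comAlg_mul_linearr (x : C) : linear (fun y : C => x * y).
Proof. by move=> a y y'; rewrite mulrDr alg_scaleAr. Qed.

Definition comAlg_algebra : algebra R :=
  bilinear_algebra comAlg_mul_linearl comAlg_mul_linearr.

Definition tensor_ring : Type := tensor B C.
HB.instance Definition _ := GRing.Zmodule.on tensor_ring.

(** This is the product of the base change to [B] of the algebra underlying [C], so that its
    bilinearity is already known. *)
Definition tensor_mul (x y : tensor_ring) : tensor_ring :=
  @bc_mul2 R B comAlg_algebra x y.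

Fact tensor_mulE b c b' c' :
  tensor_mul (tens b c) (tens b' c') = tens (b * b') (c * c').
Proof. by rewrite [LHS]bc_mul2E bilinear_algebraE. Qed.
Fact tensor_mulDl : left_distributive tensor_mul +%R.
Proof. by move=> x y z; exact: (@bc_mul2Dl R B comAlg_algebra z x y). Qed.
Fact tensor_mulDr : right_distributive tensor_mul +%R.
Proof. by move=> x y z; exact: (@bc_mul2Dr R B comAlg_algebra x y z). Qed.

Fact tensor_mulC : commutative tensor_mul.
Proof.
move=> x y.
apply: (tensor_ext (f := tensor_mul^~ y) (g := tensor_mul y)) x => [x x'|x x'|b c].
- exact: tensor_mulDl.
- exact: tensor_mulDr.
apply: (tensor_ext (f := tensor_mul (tens b c)) (g := tensor_mul^~ (tens b c))) y.
- exact: tensor_mulDr.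
- by move=> y y'; exact: tensor_mulDl.
- by move=> b' c'; rewrite !tensor_mulE mulrC [c * _]mulrC.
Qed.

Fact tensor_mulA : associative tensor_mul.
Proof.
move=> x y z.
apply: (tensor_ext (f := fun x => tensor_mul x (tensor_mul y z))
                   (g := fun x => tensor_mul (tensor_mul x y) z)) x.
- by move=> x x'; rewrite tensor_mulDl.
- by move=> x x'; rewrite !tensor_mulDl.
move=> b c.
apply: (tensor_ext (f := fun y => tensor_mul (tens b c) (tensor_mul y z))
                   (g := fun y => tensor_mul (tensor_mul (tens b c) y) z)) y.
- by move=> y y'; rewrite tensor_mulDl tensor_mulDr.
- by move=> y y'; rewrite tensor_mulDr tensor_mulDl.
move=> b' c'.
apply: (tensor_ext (f := fun z => tensor_mul (tens b c) (tensor_mul (tens b' c') z))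
         (g := fun z => tensor_mul (tensor_mul (tens b c) (tens b' c')) z)) z.
- by move=> z z'; rewrite !tensor_mulDr.
- by move=> z z'; rewrite !tensor_mulDr.
- by move=> b'' c''; rewrite !tensor_mulE !mulrA.
Qed.

Fact tensor_mul1 : left_id (tens (1 : B) (1 : C) : tensor_ring) tensor_mul.
Proof.
move=> x; apply: (tensor_ext (f := tensor_mul (tens (1 : B) (1 : C))) (g := id)) x => //.
- exact: tensor_mulDr.
- by move=> b c; rewrite tensor_mulE !mul1r.
Qed.

HB.instance Definition _ := GRing.Zmodule_isComPzRing.Build tensor_ring
  tensor_mulA tensor_mulC tensor_mul1 tensor_mulDl.

Lemma tensor_ringM b c b' c' :
  (tens b c : tensor_ring) * tens b' c' = tens (b * b') (c * c').
Proof. exact: tensor_mulE. Qed.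

Definition tensor_str (r : R) : tensor_ring := tens (alg_str B r) (1 : C).

Fact tensor_str_zmod : zmod_morphism tensor_str.
Proof. by move=> r s; rewrite /tensor_str rmorphB tensDl tensNl. Qed.
Fact tensor_str_monoid : monoid_morphism tensor_str.
Proof.
by split=> [|r s]; rewrite /tensor_str ?rmorph1 // tensor_ringM rmorphM mulr1.
Qed.
HB.instance Definition _ :=
  GRing.isZmodMorphism.Build R tensor_ring tensor_str tensor_str_zmod.
HB.instance Definition _ :=
  GRing.isMonoidMorphism.Build R tensor_ring tensor_str tensor_str_monoid.

Definition tensorAlg : comAlg R := ComAlg (tensor_str : {rmorphism R -> tensor_ring}).

Lemma tensorAlgM (b b' : B) (c c' : C) :
  (tens b c : tensorAlg) * (tens b' c' : tensorAlg) = (tens (b * b') (c * c') : tensorAlg).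
Proof. exact: tensor_mulE. Qed.

(** The algebra B (x) C is an R-module through its structure map, the module B (x) C through the
    tensor product. Arguments on algebra maps use the first structure, arguments on submodules and
    flatness the second. *)
Lemma tensorAlg_scale (r : R) (x : tensorAlg) : r *: x = (r *: (x : tensor B C)).
Proof.
apply: (tensor_ext (f := fun x => r *: (x : tensorAlg) : tensor B C)
                   (g := fun x : tensor B C => r *: x)) x.
- by move=> x y; rewrite scalerDr.
- by move=> x y; rewrite scalerDr.
- move=> b c; rewrite alg_scaleE tensZl alg_scaleE.
  by rewrite [LHS]tensor_ringM mul1r.
Qed.

Definition tensor_inl (b : B) : tensorAlg := tens b (1 : C).
Definition tensor_inr (c : C) : tensorAlg := tens (1 : B) c.

Fact tensor_inl_zmod : zmod_morphism tensor_inl.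
Proof. by move=> x y; rewrite /tensor_inl tensDl tensNl. Qed.
Fact tensor_inl_monoid : monoid_morphism tensor_inl.
Proof. by split=> // x y; rewrite [RHS]tensor_ringM mulr1. Qed.
Fact tensor_inl_str r : tensor_inl (alg_str B r) = alg_str tensorAlg r.
Proof. by []. Qed.
Definition tensor_inlh := AlgHom tensor_inl_zmod tensor_inl_monoid tensor_inl_str.

Fact tensor_inr_zmod : zmod_morphism tensor_inr.
Proof. by move=> x y; rewrite /tensor_inr tensDr tensNr. Qed.
Fact tensor_inr_monoid : monoid_morphism tensor_inr.
Proof. by split=> // x y; rewrite [RHS]tensor_ringM mulr1. Qed.
Fact tensor_inr_str r : tensor_inr (alg_str C r) = alg_str tensorAlg r.
Proof.
rewrite /tensor_inr -[alg_str C r]mulr1 -alg_scaleE -tensZ alg_scaleE.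
by rewrite mulr1.
Qed.
Definition tensor_inrh := AlgHom tensor_inr_zmod tensor_inr_monoid tensor_inr_str.

Section Pair.
Variables (S : comAlg R) (f : algHom B S) (g : algHom C S).

Definition tensor_pair : tensorAlg -> S := tlift (fun b c => f b * g c).

Fact tensor_pair_balanced : balanced (fun b c => f b * g c).
Proof.
split=> [c b b'|b c c'|r b c]; rewrite ?raddfD ?mulrDl ?mulrDr //.
by rewrite !linearZ /= -alg_scaleAl alg_scaleAr.
Qed.

Lemma tensor_pairE b c : tensor_pair (tens b c) = f b * g c.
Proof. exact: tlift_tens tensor_pair_balanced b c. Qed.

Fact tensor_pairD : {morph tensor_pair : x y / x + y}.
Proof. exact: tliftD tensor_pair_balanced. Qed.

Fact tensor_pair_zmod : zmod_morphism tensor_pair.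
Proof.
move=> x y; apply: (addIr (tensor_pair y)).
by rewrite -tensor_pairD !subrK.
Qed.
Fact tensor_pair_monoid : monoid_morphism tensor_pair.
Proof.
split=> [|x y]; first by rewrite tensor_pairE !rmorph1 mulr1.
apply: (tensor_ext (f := fun x : tensorAlg => tensor_pair (x * y))
                   (g := fun x => tensor_pair x * tensor_pair y)) x.
- by move=> x x'; rewrite -tensor_pairD -mulrDl.
- by move=> x x'; rewrite -mulrDl tensor_pairD.
move=> b c.
apply: (tensor_ext (f := fun y => tensor_pair ((tens b c : tensorAlg) * y))
                   (g := fun y => tensor_pair (tens b c) * tensor_pair y)) y.
- by move=> y y'; rewrite -tensor_pairD -mulrDr.
- by move=> y y'; rewrite -mulrDr tensor_pairD.
move=> b' c'; rewrite [_ * _ in LHS]tensor_ringM !tensor_pairE !rmorphM.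
exact: mulrACA.
Qed.
Fact tensor_pair_str r : tensor_pair (alg_str tensorAlg r) = alg_str S r.
Proof. by rewrite tensor_pairE rmorph1 mulr1 algHom_str. Qed.
Definition tensor_pairh :=
  AlgHom tensor_pair_zmod tensor_pair_monoid tensor_pair_str.

End Pair.

End TensorRing.

(** * Coproduct, subcomodules and matrix coefficients *)

Lemma algHom_eq (R : comPzRingType) (S T : comAlg R) (f g : algHom S T) :
  f =1 g -> f = g.
Proof.
case: f g => [f fz fm fs] [g gz gm gs] /= /funext efg.
case: g / efg in gz gm gs *.
by rewrite (Prop_irrelevance gz fz) (Prop_irrelevance gm fm) (Prop_irrelevance gs fs).
Qed.

Definition baseAlg (R : comPzRingType) : comAlg R :=
  ComAlg (idfun : {rmorphism R -> R}).

Section Structure.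
Variables (R : comPzRingType) (S : comAlg R).
Fact struct_zmod : zmod_morphism (alg_str S : baseAlg R -> S).
Proof. exact: raddfB. Qed.
Fact struct_monoid : monoid_morphism (alg_str S : baseAlg R -> S).
Proof. by split; [exact: rmorph1 | exact: rmorphM]. Qed.
Definition struct_hom : algHom (baseAlg R) S :=
  AlgHom struct_zmod struct_monoid (fun _ => erefl).
End Structure.

Section Coproduct.
Variables (R : comPzRingType) (G : affineGroup R).
Local Notation B := (ag_ring G).
Local Notation pt := (ag_point (a := G)).
Local Notation B2 := (tensorAlg B B).
Local Notation inl := (tensor_inlh B B).
Local Notation inr := (tensor_inrh B B).

Lemma point_inj (S : comAlg R) : injective (@ag_point _ G S).
Proof. exact: bij_inj (ag_point_bij G S). Qed.

Lemma point_surj (S : comAlg R) (g : G S) : exists x, pt x = g.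
Proof. by case: (ag_point_bij G S) => f _ fK; exists (f g). Qed.

(** By Yoneda: the product of the two universal points of G over B (x) B is again a point, that is,
    a map from B to B (x) B. *)
Definition coproduct : algHom B B2 := sval (cid (point_surj (pt inl * pt inr)%g)).
Definition counit : algHom B (baseAlg R) := sval (cid (point_surj (1 : G (baseAlg R))%g)).

Lemma point_coproduct : pt coproduct = (pt inl * pt inr)%g.
Proof. exact: (svalP (cid (point_surj _))). Qed.
Lemma point_counit : pt counit = 1%g.
Proof. exact: (svalP (cid (point_surj _))). Qed.

Lemma coproduct_sum I (r : seq I) (P : pred I) (F : I -> B) :
  coproduct (\sum_(i <- r | P i) F i) =
  \sum_(i <- r | P i) (coproduct (F i) : tensor B B).
Proof.
by apply: (big_morph (fun b => coproduct b : tensor B B)) => [x y|];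
   [exact: (raddfD coproduct x y) | exact: (raddf0 coproduct)].
Qed.

Lemma coproductZ (a : R) (b : B) :
  coproduct (a *: b) = a *: (coproduct b : tensor B B).
Proof. by rewrite linearZ /= tensorAlg_scale. Qed.

(** By naturality, every product of two points is the image of the universal product under the map B
    (x) B -> S that they induce. *)
Lemma pointM (S : comAlg R) (x y : algHom B S) :
  (pt x * pt y)%g = pt (algHom_comp (tensor_pairh x y) coproduct).
Proof.
rewrite ag_point_nat point_coproduct gf_mapM -!ag_point_nat.
congr (pt _ * pt _)%g; apply: algHom_eq => b; rewrite /= tensor_pairE.
  by rewrite rmorph1 mulr1.
by rewrite rmorph1 mul1r.
Qed.

Lemma point1 (S : comAlg R) :
  1%g = pt (algHom_comp (struct_hom S) counit).
Proof.
rewrite ag_point_nat point_counit; apply: (mulgI (gf_map (struct_hom S) 1%g)).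
by rewrite mulg1 -gf_mapM mulg1.
Qed.

Lemma counitl b : tensor_pairh (algHom_comp (struct_hom B) counit) (algHom_id B)
  (coproduct b) = b.
Proof.
have : pt (algHom_comp (tensor_pairh (algHom_comp (struct_hom B) counit)
    (algHom_id B)) coproduct) = pt (algHom_id B) by rewrite -pointM -point1 mul1g.
by move=> /point_inj e; have := congr1 (fun f : algHom B B => f b) e.
Qed.

Lemma counitr b : tensor_pairh (algHom_id B) (algHom_comp (struct_hom B) counit)
  (coproduct b) = b.
Proof.
have : pt (algHom_comp (tensor_pairh (algHom_id B) (algHom_comp (struct_hom B) counit))
    coproduct) = pt (algHom_id B) by rewrite -pointM -point1 mulg1.
by move=> /point_inj e; have := congr1 (fun f : algHom B B => f b) e.
Qed.

Local Notation B3 := (tensorAlg B B2).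
Local Notation i1 := (tensor_inlh B B2).
Local Notation j := (tensor_inrh B B2).

Definition assoc3 : algHom B2 B3 := tensor_pairh i1 (algHom_comp j inl).

Lemma assoc3E (p q n : B) :
  assoc3 (tens p q : tensor B B) * j (inr n) = tens p (tens q n : B2).
Proof.
by rewrite /= tensor_pairE /= /tensor_inl /tensor_inr !tensorAlgM !mul1r !mulr1.
Qed.

(** Both sides come from a product of three universal points over [B3], bracketed in the two ways;
    injectivity of [ag_point] turns associativity of the group into an equality of maps. The right
    side needs [assoc3] because [B3] is bracketed as B (x) (B (x) B). *)
Lemma coassoc b : tensor_map idfun coproduct (coproduct b) =
  tensor_pairh (algHom_comp assoc3 coproduct) (algHom_comp j inr) (coproduct b).
Proof.
have e1 : algHom_comp (tensor_pairh (algHom_comp j inl) (algHom_comp j inr)) coproduct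
    = algHom_comp j coproduct.
  apply: algHom_eq => x /=.
  apply: (tensor_ext (f := tensor_pair (algHom_comp j inl) (algHom_comp j inr))
                     (g := j)) (coproduct x).
  - by move=> y z; exact: (tensor_pairD (algHom_comp j inl) (algHom_comp j inr) y z).
  - by move=> y z; rewrite raddfD.
  move=> p q; rewrite tensor_pairE /= /tensor_inr /tensor_inl [LHS]tensorAlgM mulr1.
  by congr (tens _ _); rewrite [LHS]tensorAlgM mulr1 mul1r.
have := mulgA (pt i1) (pt (algHom_comp j inl)) (pt (algHom_comp j inr)).
rewrite !pointM e1 => /point_inj e; have := congr1 (fun f : algHom B B3 => f b) e.
move=> /= <-.
apply: (tensor_ext (f := tensor_map idfun coproduct)
                   (g := tensor_pair i1 (algHom_comp j coproduct))) (coproduct b).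
- exact: tensor_mapD.
- by move=> y z; exact: (tensor_pairD i1 (algHom_comp j coproduct) y z).
- move=> p q; rewrite tensor_map_tens tensor_pairE /= /tensor_inl /tensor_inr.
  by rewrite [RHS]tensorAlgM mulr1 mul1r.
Qed.

Section Subcomodule.
Variable U : submodule B.

(** For flat [B] this is the largest subcomodule contained in [U]: it lies in [U] by the counit, is
    stable by coassociativity, and contains every element whose coproduct can be written with right
    factors in [U]. *)
Definition stable_set (b : B) : Prop := right_tens U (coproduct b).

Fact stable_set_closed : linear_closed_set stable_set.
Proof.
have [c0 cP] := @right_tens_closed R B B U.
split=> [|a x y xU yU]; rewrite /stable_set ?raddf0 //.
by rewrite linearP tensorAlg_scale; exact: cP.
Qed.
Definition stable_part : submodule B := Submodule stable_set_closed.

Lemma stable_part_sub b : stable_part b -> U b.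
Proof.
move=> [k [m [n [nU e]]]]; rewrite -[b]counitl e raddf_sum /=.
have [U0 UP] := sm_closed U.
elim/big_ind: _ => // [x y Ux Uy|i _]; first by rewrite -[x]scale1r; exact: UP.
by rewrite tensor_pairE /= -alg_scaleE -[_ *: _]addr0; exact: UP.
Qed.

Fact right_tens_B2_closed : linear_closed_set (right_tens U : B2 -> Prop).
Proof.
have [c0 cP] := @right_tens_closed R B B U.
by split=> // a x y xU yU; rewrite tensorAlg_scale; exact: cP.
Qed.
Let P2 : submodule B2 := Submodule right_tens_B2_closed.

Let dbar (q : quot_mod stable_part) : quot_mod P2 := quot_pi P2 (coproduct (repr q)).

Let dbarE b : dbar (quot_pi stable_part b) = quot_pi P2 (coproduct b).
Proof.
apply/quot_pi_eq; rewrite -raddfB.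
by apply/(quot_pi_eq stable_part); rewrite quot_pi_repr.
Qed.

Let dbar_linear : linear dbar.
Proof.
move=> a x y; rewrite -[x]quot_pi_repr -[y]quot_pi_repr -linearP !dbarE.
by rewrite linearP linearP.
Qed.
HB.instance Definition _ := GRing.isLinear.Build R (quot_mod stable_part) (quot_mod P2)
  *:%R dbar dbar_linear.

Let dbar_inj : injective dbar.
Proof.
move=> x y; rewrite -[x]quot_pi_repr -[y]quot_pi_repr !dbarE => /quot_pi_eq e.
by apply/quot_pi_eq; rewrite /= /stable_set raddfB.
Qed.

(* b lies in the stable part iff its image in (B (x) B) / im (B (x) U) vanishes, so
   B / stable_part embeds there; B being flat, coassociativity then puts the
   coproduct of b in the kernel of B (x) B -> B (x) (B / stable_part). *)
Lemma stable_part_coproduct b : flat (B : lmodType R) -> stable_part b ->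
  right_tens stable_part (coproduct b).
Proof.
move=> Bflat bE; apply: tensor_quot_ker; apply: (Bflat _ _ dbar dbar_inj).
have dE (x : tensor B B) :
    tensor_map idfun dbar (tensor_map idfun (quot_pi stable_part) x) =
    tensor_map idfun (quot_pi P2) (tensor_map idfun coproduct x).
  apply: (tensor_ext
    (f := fun x => tensor_map idfun dbar (tensor_map idfun (quot_pi stable_part) x))
    (g := fun x => tensor_map idfun (quot_pi P2) (tensor_map idfun coproduct x))) x.
  - by move=> x y; rewrite !tensor_mapD.
  - by move=> x y; rewrite !tensor_mapD.
  - by move=> m n; rewrite !tensor_map_tens /= dbarE.
rewrite dE [RHS]raddf0 coassoc; have [k [m [n [nU ->]]]] := bE; rewrite !raddf_sum /=.
rewrite big1 // => i _; rewrite tensor_pairE.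
apply: (tensor_ext (f := fun t => tensor_map idfun (quot_pi P2)
  (assoc3 t * j (inr (n i)))) (g := fun=> 0)) (coproduct (m i)).
- by move=> x y; rewrite raddfD mulrDl tensor_mapD.
- by move=> x y; rewrite addr0.
move=> p q; rewrite assoc3E tensor_map_tens /=.
rewrite (_ : quot_pi P2 _ = 0) ?tens0r // -[RHS](linear0 (quot_pi P2)).
by apply/quot_pi_eq; rewrite subr0; exact: right_tens1.
Qed.

End Subcomodule.

End Coproduct.

(** The factors stand in the order opposite to the group law, so that evaluating [c] at points is an
    antihomomorphism. This order fits a coaction with values in B (x) E, with scalars on the left as
    in S (x) W. *)
Definition matrix_rep (R : comPzRingType) (G : affineGroup R) n (c : 'M[ag_ring G]_n) :=
  map_mx (coproduct G) c = map_mx (tensor_inrh _ _) c *m map_mx (tensor_inlh _ _) c /\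
  map_mx (counit G) c = 1%:M.

Section MatrixCoefficients.
Variables (R : comPzRingType) (G : affineGroup R).
Local Notation B := (ag_ring G).
Local Notation B2 := (tensorAlg B B).
Local Notation inl := (tensor_inlh B B).
Local Notation inr := (tensor_inrh B B).

Variable E : submodule B.
Hypotheses (B_flat : flat (B : lmodType R)) (E_dual : dual_basis_on E).
Hypothesis E_stable : forall b, E b -> right_tens E (coproduct G b).

Local Notation Et := (sub_mod E).

Fact right_incl_linear : linear (tensor_map idfun val : tensor B Et -> B2).
Proof. by move=> a x y; rewrite tensorAlg_scale -linearP. Qed.
Let incl : {linear tensor B Et -> B2} :=
  HB.pack (tensor_map idfun val : tensor B Et -> B2)
    (GRing.isLinear.Build R (tensor B Et) B2 *:%R _ right_incl_linear).

Let incl_inj : injective incl.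
Proof. by move=> x y; apply: (B_flat (g := val)); exact: val_inj. Qed.

(** As [E] is projective but perhaps not free, the [v j] are only generators; they present [E] as
    the summand of R^k cut out by the idempotent [Em]. The coaction matrix [C], normalized by
    [C *m Em = C], is multiplicative with counit [Em]. Letting G act trivially on the complement,
    through [D = 1 - Em], makes the counit the identity matrix. *)
Lemma matrix_coefficients : exists n (c : 'M[B]_n), matrix_rep c /\
  forall b, E b -> exists (a : 'I_n -> 'I_n -> R) (a0 : R),
    b = alg_str B a0 + \sum_i \sum_j alg_str B (a i j) * c i j.
Proof.
have [k [v [phi [vE philin phiE]]]] := E_dual.
have [C0 C0P] : exists C : 'I_k -> 'I_k -> B,
    forall j, coproduct G (v j) = \sum_i tens (C j i) (v i) :> tensor B B.
  have H j : exists C : 'I_k -> B, coproduct G (v j) = \sum_i tens (C i) (v i) :> tensor B B.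
    have [l [m [y [yE ->]]]] := E_stable (vE j).
    exists (fun i => \sum_a phi i (y a) *: m a).
    transitivity (\sum_a \sum_i tens (phi i (y a) *: m a) (v i)); last first.
      by rewrite exchange_big; apply: eq_bigr => i _; rewrite tens_suml.
    apply: eq_bigr => a _; rewrite [y a in LHS]phiE // tens_sumr.
    by apply: eq_bigr => i _; rewrite tensZ.
  by have [C CP] := choice H; exists C.
pose Em : 'M[B]_k := \matrix_(j, i) alg_str B (phi i (v j)).
pose C : 'M[B]_k := \matrix_(j, i) \sum_l phi i (v l) *: C0 j l.
have phiv j : v j = \sum_i phi i (v j) *: v i by rewrite -phiE.
have CP j : coproduct G (v j) = \sum_i tens (C j i) (v i) :> tensor B B.
  rewrite C0P.
  transitivity (\sum_l \sum_i tens (phi i (v l) *: C0 j l) (v i)).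
    apply: eq_bigr => l _; rewrite [v l in LHS]phiv tens_sumr.
    by apply: eq_bigr => i _; rewrite tensZ.
  by rewrite exchange_big; apply: eq_bigr => i _; rewrite mxE tens_suml.
pose ve i : Et := exist _ (v i) (asboolT (vE i)).
have phisum i n (s : 'I_n -> R) (w : 'I_n -> B) : (forall l, E (w l)) ->
    phi i (\sum_l s l *: w l) = \sum_l s l * phi i (w l).
  have [E0 _] := sm_closed E; move=> wE.
  have phi0 : phi i 0 = 0.
    by have := philin i (-1) 0 0 E0 E0; rewrite scaler0 addr0 mulN1r addNr.
  elim: n s w wE => [|n IH] s w wE; first by rewrite !big_ord0.
  rewrite !big_ord_recl philin ?IH //; apply: linear_set_sum => //.
  exact: sm_closed.
have EmE : Em *m Em = Em.
  apply/matrixP => j i; rewrite !mxE [in RHS]phiv phisum // rmorph_sum.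
  by apply: eq_bigr => l _; rewrite !mxE rmorphM.
have /choice[th thE] l : exists h : {linear tensor B Et -> B},
    forall b e, h (tens b e) = phi l (val e) *: b.
  apply: (@tensor_bilinear R B Et B (fun b e => phi l (val e) *: b)) => [e|b] a x y.
    by rewrite scalerDr !scalerA mulrC.
  by rewrite sub_mod_valP philin ?scalerDl ?scalerA //; exact: sub_modP.
have CEm : C *m Em = C.
  apply/matrixP => j i; rewrite !mxE.
  transitivity (\sum_l \sum_a (phi i (v l) * phi l (v a)) *: C0 j a).
    apply: eq_bigr => l _; rewrite !mxE mulrC -alg_scaleE scaler_sumr.
    by apply: eq_bigr => a _; rewrite scalerA.
  rewrite exchange_big; apply: eq_bigr => a _; rewrite -scaler_suml; congr (_ *: _).
  by rewrite [in RHS]phiv phisum //; apply: eq_bigr => l _; rewrite mulrC.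
clearbody C.
have Cphi j i : C j i = \sum_l phi i (v l) *: C j l.
  by rewrite -[in LHS]CEm mxE; apply: eq_bigr => l _; rewrite mxE mulrC -alg_scaleE.
have EmC : Em *m C = C.
  apply/matrixP => j i.
  have : \sum_l tens (C j l) (ve l) =
         \sum_a \sum_l tens (phi a (v j) *: C a l) (ve l) :> tensor B Et.
    apply: incl_inj; rewrite !raddf_sum /=.
    transitivity (coproduct G (v j) : tensor B B).
      by rewrite CP; apply: eq_bigr => l _; rewrite tensor_map_tens.
    rewrite [v j in LHS]phiv !raddf_sum /=; apply: eq_bigr => a _.
    rewrite linearZ /= tensorAlg_scale CP scaler_sumr raddf_sum /=.
    by apply: eq_bigr => l _; rewrite tensor_map_tens [LHS]tensZl.
  move=> /(congr1 (th i)); rewrite !raddf_sum /= => e.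
  rewrite [RHS]Cphi; under [RHS]eq_bigr do rewrite -[v _]/(val (ve _)) -thE.
  rewrite e mxE; apply: eq_bigr => a _; rewrite raddf_sum mxE -alg_scaleE [C a i]Cphi.
  by rewrite scaler_sumr; apply: eq_bigr => l _; rewrite /= thE !scalerA mulrC.
have coprC j i : coproduct G (C j i) = \sum_l tens (C j l) (C l i) :> tensor B B.
  pose X1 : tensor B (tensor B Et) :=
    \sum_l tensor_map idfun (tens_at (ve l)) (coproduct G (C j l)).
  pose X2 : tensor B (tensor B Et) :=
    \sum_l tens (C j l) (\sum_a tens (C l a) (ve a)).
  have X12 : X1 = X2.
    (* By flatness B (x) (B (x) E) embeds in B (x) (B (x) B), where coassociativity is available. *)
    apply: (B_flat incl_inj); have := coassoc (v j).
    rewrite CP !raddf_sum /= => e; symmetry.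
    transitivity (\sum_l tens (C j l) (coproduct G (v l)) : tensor B B2).
      apply: eq_bigr => l _; rewrite tensor_map_tens /= raddf_sum /= CP.
      by congr (tens _ _); apply: eq_bigr => a _; rewrite tensor_map_tens.
    transitivity (\sum_l tensor_map idfun (coproduct G) (tens (C j l) (v l))).
      by apply: eq_bigr => l _; rewrite tensor_map_tens.
    rewrite e; apply: eq_bigr => l _; rewrite tensor_pairE.
    apply: (tensor_ext
      (f := fun t => assoc3 G t * tensor_inrh B B2 (inr (v l)))
      (g := fun t => tensor_map idfun incl (tensor_map idfun (tens_at (ve l)) t)))
      (coproduct G (C j l)).
    - by move=> x y; rewrite raddfD mulrDl.
    - by move=> x y; rewrite !tensor_mapD.
    - by move=> p q; rewrite assoc3E !tensor_map_tens /= tensor_map_tens.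
  have := congr1 (tensor_map idfun (th i)) X12; rewrite !raddf_sum /= => e.
  transitivity (\sum_l tensor_map idfun (th i) (tens (C j l) (\sum_a tens (C l a) (ve a)))).
    rewrite -e [in LHS]Cphi coproduct_sum; apply: eq_bigr => l _; rewrite coproductZ.
    apply: (tensor_ext (f := fun t : tensor B B => phi i (v l) *: t)
      (g := fun t => tensor_map idfun (th i) (tensor_map idfun (tens_at (ve l)) t)))
      (coproduct G (C j l)).
    - by move=> x y; rewrite scalerDr.
    - by move=> x y; rewrite !tensor_mapD.
    - by move=> p q; rewrite !tensor_map_tens /= thE tensZr.
  apply: eq_bigr => l _; rewrite tensor_map_tens raddf_sum /= [C l i]Cphi.
  by congr (tens _ _); apply: eq_bigr => a _; rewrite thE.
pose D : 'M[B]_k := 1%:M - Em.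
have CD : C *m D = 0 by rewrite mulmxBr mulmx1 CEm subrr.
have DC : D *m C = 0 by rewrite mulmxBl mul1mx EmC subrr.
have DD : D *m D = D.
  by rewrite mulmxBr mulmx1 [_ *m Em]mulmxBl mul1mx EmE subrr subr0.
pose D0 : 'M[R]_k := \matrix_(j, i) ((j == i)%:R - phi i (v j)).
have DE : D = map_mx (alg_str B) D0.
  by apply/matrixP => j i; rewrite !mxE rmorphB rmorph_nat.
have mapD (S : comAlg R) (f : algHom B S) : map_mx f D = map_mx (alg_str S) D0.
  by rewrite DE; apply/matrixP => j i; rewrite !mxE algHom_str.
have mapA (S : comAlg R) (f : algHom B S) X Y :
    map_mx f (X + Y : 'M[B]_k) = map_mx f X + map_mx f Y.
  exact: map_mxD.
have mapM (S : comAlg R) (f : algHom B S) X Y :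
    map_mx f (X *m Y : 'M[B]_k) = map_mx f X *m map_mx f Y.
  exact: map_mxM.
clearbody D.
(* The coproduct of [C] is its left copy times its right copy; transposing gives the order required
   by [matrix_rep]. *)
exists k, (C + D)^T; split; first split.
- rewrite -!map_trmx -trmx_mul; congr (_^T); rewrite !mapA.
  have -> : map_mx (coproduct G) C = map_mx inl C *m map_mx inr C.
    apply/matrixP => j i; rewrite !mxE coprC; apply: eq_bigr => l _.
    by rewrite !mxE /= /tensor_inl /tensor_inr tensorAlgM mulr1 mul1r.
  rewrite mulmxDl !mulmxDr !mapD -(mapD _ inl) -!mapM CD DD.
  have -> : map_mx inl D = map_mx inr D by rewrite !mapD.
  by rewrite -mapM DC !map_mx0 addr0 add0r.
- have cC j l : counit G (C j l) = phi l (v j).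
    have := counitl (v j); rewrite CP raddf_sum /= => e.
    rewrite -e Cphi raddf_sum /= [RHS](_ : _ = phi l (\sum_i counit G (C j i) *: v i)).
      rewrite phisum //; apply: eq_bigr => i _.
      by rewrite linearZ /= alg_scaleE mulrC.
    by congr (phi l _); apply: eq_bigr => i _; rewrite tensor_pairE.
  rewrite -map_trmx mapA mapD; apply/matrixP => i j; rewrite !mxE cC.
  by rewrite /alg_str /= addrCA subrr addr0 eq_sym.
- move=> b bE.
  have vC j : v j = \sum_i (counit G (v i) : R) *: C j i.
    rewrite -[LHS]counitr CP raddf_sum; apply: eq_bigr => i _.
    by rewrite /= tensor_pairE /= mulrC.
  pose a i j : R := phi j b * counit G (v i).
  (* By the counit, b is a combination of entries of [C]. These differ from the entries of [C + D]
     by the constants [D0], which the constant term absorbs. *)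
  exists a, (- \sum_i \sum_j a i j * D0 j i).
  have bC : b = \sum_i \sum_j a i j *: C j i.
    rewrite {1}[b]phiE // exchange_big; apply: eq_bigr => j _.
    by rewrite {1}vC scaler_sumr; apply: eq_bigr => i _; rewrite scalerA.
  have -> : \sum_i \sum_j alg_str B (a i j) * (C + D)^T i j =
      \sum_i \sum_j a i j *: C j i + alg_str B (\sum_i \sum_j a i j * D0 j i).
    rewrite rmorph_sum -big_split; apply: eq_bigr => i _.
    rewrite rmorph_sum -big_split; apply: eq_bigr => j _.
    by rewrite mxE [(C + D) j i]mxE DE [map_mx _ _ _ _]mxE mulrDr rmorphM.
  by rewrite -bC rmorphN addrCA addNr addr0.
Qed.

End MatrixCoefficients.

(** * Words and substitutions *)

Section Words.
Variables (R : comPzRingType) (n D : nat).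

(* None is a marker: the block None, ..., None, Some j with i markers encodes the variable
   in position (i, j) of a matrix. *)
Definition word := seq (option 'I_n).
Definition wordmod : Type := {ffun D.-bseq (option 'I_n) -> R^o}.
HB.instance Definition _ := GRing.Lmodule.on wordmod.
Implicit Types (p q : wordmod) (w : word) (h c : 'M[R]_n) (v : 'cV[R]_n).

(** A word longer than [D] gives 0, so that prepending letters truncates at length [D]. *)
Definition word_basis w : wordmod := [ffun b => (val b == w)%:R].

Lemma word_basis_long w : (D < size w)%N -> word_basis w = 0.
Proof.
move=> lw; apply/ffunP => b; rewrite !ffunE; case: eqP => // e.
by move: lw; rewrite -e ltnNge size_bseq.
Qed.

Lemma word_basisE (b : D.-bseq (option 'I_n)) w : word_basis w b = (val b == w)%:R.
Proof. by rewrite ffunE. Qed.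

Lemma wordmod_sum I (r : seq I) (P : pred I) (F : I -> wordmod) b :
  (\sum_(i <- r | P i) F i) b = \sum_(i <- r | P i) F i b.
Proof. by apply: (big_morph (fun p : wordmod => p b)) => [x y|]; rewrite ffunE. Qed.

Lemma wordmodE p : p = \sum_b p b *: word_basis b.
Proof.
apply/ffunP => b; rewrite wordmod_sum (bigD1 b) //= big1 => [|b' nb].
  by rewrite ffunE word_basisE eqxx addr0 /GRing.scale /= mulr1.
by rewrite ffunE word_basisE eq_sym val_eqE (negbTE nb) scaler0.
Qed.

Lemma wordmod_ext (V : lmodType R) (f g : wordmod -> V) :
  linear f -> linear g -> (forall w, f (word_basis w) = g (word_basis w)) -> f =1 g.
Proof.
move=> fl gl fg p; rewrite [p]wordmodE !linear_map_sum //.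
by apply: eq_bigr => b _; rewrite !linear_mapZ // fg.
Qed.

Section Extend.
Variables (V : lmodType R) (F : word -> V).

Definition extend p : V := \sum_b p b *: F b.

Fact extend_linear : linear extend.
Proof.
move=> a p q; rewrite /extend scaler_sumr -big_split; apply: eq_bigr => b _.
by rewrite !ffunE scalerDl scalerA.
Qed.
HB.instance Definition _ := GRing.isLinear.Build R wordmod V *:%R extend extend_linear.

Lemma extend_basis w : (size w <= D)%N -> extend (word_basis w) = F w.
Proof.
move=> sw; rewrite /extend (bigD1 (Bseq sw)) //= big1 => [|b nb].
  by rewrite word_basisE eqxx scale1r addr0.
by rewrite word_basisE -[w]/(val (Bseq sw)) val_eqE (negbTE nb) scale0r.
Qed.

End Extend.

Definition has_length k p := forall b, p b != 0 -> size b = k.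

Lemma has_length_long k p : (D < k)%N -> has_length k p -> p = 0.
Proof.
move=> Dk pk; apply/ffunP => b; rewrite [RHS]ffunE; apply/eqP/negP => /negP/pk e.
by move: Dk; rewrite -e ltnNge size_bseq.
Qed.

Definition consl a := extend (fun w => word_basis (a :: w)).
HB.instance Definition _ a := GRing.Linear.on (consl a).

Lemma consl_basis a w : consl a (word_basis w) = word_basis (a :: w).
Proof.
have [sw|lw] := leqP (size w) D; first exact: extend_basis.
by rewrite !word_basis_long ?raddf0 // ltnW.
Qed.

Lemma has_length_basis w : has_length (size w) (word_basis w).
Proof. by move=> b; rewrite word_basisE; case: (eqVneq (val b) w) => [<-|]; rewrite ?eqxx. Qed.

Lemma has_length_lin k I (r : seq I) (P : pred I) (F : I -> wordmod) (s : I -> R) :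
  (forall i, has_length k (F i)) -> has_length k (\sum_(i <- r | P i) s i *: F i).
Proof.
move=> Fk b; apply: contraNeq => nb; rewrite wordmod_sum big1 // => i _.
rewrite ffunE; case: (eqVneq (F i b) 0) => [->|/Fk e]; first by rewrite scaler0.
by rewrite e eqxx in nb.
Qed.

Lemma has_length_consl a k p : has_length k p -> has_length k.+1 (consl a p).
Proof.
move=> pk b; apply: contraNeq => nb; rewrite wordmod_sum big1 // => b' _.
rewrite ffunE word_basisE; case: (eqVneq (p b') 0) => [->|/pk e]; first by rewrite scale0r.
by case: eqP => [eb|]; rewrite ?scaler0 //; rewrite eb /= e eqxx in nb.
Qed.

Definition consv v p := \sum_j v j 0 *: consl (Some j) p.

Lemma consv_linear v : linear (consv v).
Proof.
move=> a p q; rewrite /consv scaler_sumr -big_split; apply: eq_bigr => j _.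
by rewrite linearP scalerDr !scalerA mulrC.
Qed.
HB.instance Definition _ v := GRing.isLinear.Build R wordmod wordmod *:%R
  (consv v) (consv_linear v).

Lemma consv_linearl p : linear (consv^~ p).
Proof.
move=> a u v; rewrite /consv scaler_sumr -big_split; apply: eq_bigr => j _.
by rewrite !mxE scalerDl scalerA.
Qed.

Lemma consv_delta j p : consv (delta_mx j 0) p = consl (Some j) p.
Proof.
rewrite /consv (bigD1 j) //= big1 => [|i ij]; rewrite mxE.
  by rewrite !eqxx scale1r addr0.
by rewrite (negbTE ij) scale0r.
Qed.

(** Only the letters [Some j] are substituted, by column j of [h]. The markers record a row, which
    does not change; hence evaluating at [c] after the substitution is evaluating at [c *m h]. *)
Fixpoint act_word h w : wordmod :=
  match w with
  | [::] => word_basis [::]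
  | None :: w' => consl None (act_word h w')
  | Some j :: w' => consv (col j h) (act_word h w')
  end.

Definition act_words h := extend (act_word h).
HB.instance Definition _ h := GRing.Linear.on (act_words h).

Lemma act_words_linear h : linear (act_words h).
Proof. exact: linearP. Qed.

Lemma has_length_act_word h w : has_length (size w) (act_word h w).
Proof.
elim: w => [|[j|] w IH] /=; first exact: has_length_basis; last exact: has_length_consl.
by apply: has_length_lin => i; exact: has_length_consl.
Qed.

(** For a word longer than [D] both sides vanish, because a substitution preserves length. *)
Lemma act_words_basis h w : act_words h (word_basis w) = act_word h w.
Proof.
have [sw|lw] := leqP (size w) D; first exact: extend_basis.
by rewrite word_basis_long // raddf0 (has_length_long lw (@has_length_act_word h w)).
Qed.

Lemma act_words_consl h p : act_words h (consl None p) = consl None (act_words h p).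
Proof.
apply: (wordmod_ext (f := act_words h \o consl None) (g := consl None \o act_words h)) p => [a x y|a x y|w] /=.
- by rewrite !linearP.
- by rewrite !linearP.
- by rewrite consl_basis !act_words_basis.
Qed.

Lemma act_words_consv h v p : act_words h (consv v p) = consv (h *m v) (act_words h p).
Proof.
have -> : h *m v = \sum_j v j 0 *: col j h.
  apply/colP => i; rewrite mxE summxE; apply: eq_bigr => j _.
  by rewrite !mxE mulrC.
rewrite /consv linear_sum.
rewrite -[RHS](_ : \sum_j v j 0 *: consv (col j h) (act_words h p) = _); last first.
  rewrite /consv; under [RHS]eq_bigr do rewrite summxE scaler_suml.
  rewrite exchange_big; apply: eq_bigr => j _; rewrite scaler_sumr.
  by apply: eq_bigr => i _; rewrite !mxE scalerA.
apply: eq_bigr => j _; rewrite linearZ /=; congr (_ *: _).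
apply: (wordmod_ext (f := act_words h \o consl (Some j)) (g := consv (col j h) \o act_words h)) p => [a x y|a x y|w] /=.
- by rewrite !linearP.
- by rewrite !linearP.
- by rewrite consl_basis !act_words_basis.
Qed.

Lemma act_words_comp h h' p : act_words h (act_words h' p) = act_words (h *m h') p.
Proof.
apply: (wordmod_ext (f := act_words h \o act_words h') (g := act_words (h *m h'))) p => [a x y|a x y|w] /=.
- by rewrite !linearP.
- by rewrite linearP.
rewrite !act_words_basis; elim: w => [|[j|] w IH] /=.
- by rewrite act_words_basis.
- by rewrite act_words_consv IH !colE mulmxA.
- by rewrite act_words_consl IH.
Qed.

Lemma act_words1 p : act_words 1%:M p = p.
Proof.
apply: (wordmod_ext (f := act_words 1%:M) (g := id)) p => // [a x y|w]; first by rewrite linearP.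
rewrite act_words_basis; elim: w => //= [[j|] w ->]; last exact: consl_basis.
by rewrite colE mul1mx consv_delta consl_basis.
Qed.

(** [i] counts the markers since the last variable. A row index outside the matrix has to give 0,
    for the value to be compatible with substitutions of the columns; markers followed by no
    variable also give 0. *)
Fixpoint eval_word c (i : nat) w : R :=
  match w with
  | [::] => (i == 0)%:R
  | None :: w' => eval_word c i.+1 w'
  | Some j :: w' => (if insub i is Some i' then c i' j else 0) * eval_word c 0 w'
  end.

Definition eval_words c i : wordmod -> R^o := extend (eval_word c i : word -> R^o).
HB.instance Definition _ c i := GRing.Linear.on (eval_words c i).

(** Evaluation sees a prepended letter only if truncation does not occur; on a homogeneous element
    [k < D] guarantees this. *)
Lemma eval_words_consl c i a k p : has_length k p -> (k < D)%N ->
  eval_words c i (consl a p) = extend (fun w => eval_word c i (a :: w) : R^o) p.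
Proof.
move=> pk kD; rewrite /consl /extend linear_sum; apply: eq_bigr => b _.
rewrite linearZ /=; case: (eqVneq (p b) 0) => [->|/pk e]; first by rewrite !scale0r.
by congr (_ *: _); apply: extend_basis; rewrite /= e.
Qed.

Lemma eval_act_word c h i w : (size w <= D)%N -> eval_words c i (act_word h w) = eval_word (c *m h) i w.
Proof.
elim: w i => [|[j|] w IH] i sw; first exact: extend_basis.
  rewrite /= {1}/consv linear_sum.
  transitivity (\sum_l h l j * ((if insub i is Some i' then c i' l else 0) *
      eval_word (c *m h) 0 w)).
    apply: eq_bigr => l _; rewrite linearZ /= mxE (eval_words_consl _ _ _ (@has_length_act_word h w)) //=.
    congr (_ * _); rewrite -IH ?(ltnW sw) //.
    rewrite /extend /eval_words /extend mulr_sumr; apply: eq_bigr => b _.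
    by rewrite /GRing.scale /= mulrCA.
  case: insubP => [i' _ _|_]; last first.
    by rewrite mul0r big1 // => l _; rewrite mulr0.
  by rewrite mxE mulr_suml; apply: eq_bigr => l _; rewrite mulrA [h l j * _]mulrC.
by rewrite /= (eval_words_consl _ _ _ (@has_length_act_word h w)) //; exact: IH (ltnW sw).
Qed.

Lemma eval_act_words c h p : eval_words c 0 (act_words h p) = eval_words (c *m h) 0 p.
Proof.
rewrite {1}/act_words /extend linear_sum; apply: eq_bigr => b _; rewrite linearZ /=.
by rewrite eval_act_word ?size_bseq.
Qed.

End Words.

(** * The word algebra and its automorphisms *)

Section WordAlgebra.
Variables (R : comPzRingType) (n D : nat) (gam : nat -> R).
Local Notation P := (wordmod R n D).
Variables (W : lmodType R) (pi : P -> W).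
Hypothesis pi_linear : linear pi.

Definition walg : lmodType R := (R^o * R^o * 'cV[R]_n * P * W)%type.

Definition wtuple (a b : R) (v : 'cV[R]_n) (p : P) (w : W) : walg := (a, b, v, p, w).

Lemma wtupleP c a b v p w a' b' v' p' w' :
  c *: wtuple a b v p w + wtuple a' b' v' p' w' =
  wtuple (c * a + a') (c * b + b') (c *: v + v') (c *: p + p') (c *: w + w').
Proof. by []. Qed.

Lemma wtupleZ c a b v p w : c *: wtuple a b v p w = wtuple (c * a) (c * b) (c *: v) (c *: p) (c *: w).
Proof. by []. Qed.

Lemma wtupleD a b v p w a' b' v' p' w' : wtuple a b v p w + wtuple a' b' v' p' w' =
  wtuple (a + a') (b + b') (v + v') (p + p') (w + w').
Proof. by []. Qed.

(* Apart from the products with e = (1, 0, 0, 0, 0), the only nonzero ones are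
   t t = t + [::], t p = None :: p, v_j p = Some j :: p and p t = pi p. *)
Definition wmul (x y : walg) : walg :=
  let: (a, b, v, p, w) := x in let: (a', b', v', p', w') := y in
  wtuple (a * a') (a * b' + gam 1 * a' * b + b * b') (a *: v' + (gam 2 * a') *: v)
     (a *: p' + (gam 3 * a') *: p + (b * b') *: word_basis R D [::] + b *: consl None p' + consv v p')
     (a *: w' + (gam 4 * a') *: w + b' *: pi p).

Let addlin (V : lmodType R) (c : R) (x1 x2 y1 y2 z1 z2 : V) :
  x1 = c *: y1 + z1 -> x2 = c *: y2 + z2 -> x1 + x2 = c *: (y1 + y2) + (z1 + z2).
Proof. by move=> -> ->; rewrite scalerDr addrACA. Qed.

Lemma wmul_linearl y : linear (wmul^~ y).
Proof.
case: y => [[[[a' b'] v'] p'] w'] c [[[[a b] v] p] w] [[[[a1 b1] v1] p1] w1].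
rewrite -/(wtuple a b v p w) -/(wtuple a1 b1 v1 p1 w1) wtupleP /wmul /= wtupleP.
have ring1 (r s s1 : R) : r * (c * s + s1) = c * (r * s) + r * s1.
  by rewrite mulrDr mulrCA.
have ringl (r s s1 : R) : (c * s + s1) * r = c * (s * r) + s1 * r.
  by rewrite mulrDl mulrA.
have modl (V : lmodType R) (x : V) s s1 : (c * s + s1) *: x = c *: (s *: x) + s1 *: x.
  by rewrite scalerDl scalerA.
have modr (V : lmodType R) (x x1 : V) r : r *: (c *: x + x1) = c *: (r *: x) + r *: x1.
  by rewrite scalerDr !scalerA mulrC.
congr wtuple; first exact: ringl.
- apply: (@addlin R^o); last exact: ringl.
  by apply: (@addlin R^o); [exact: ringl | exact: ring1].
- by apply: addlin; [exact: modl | exact: modr].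
- apply: addlin; last exact: consv_linearl.
  apply: addlin; last exact: modl.
  apply: addlin; last by rewrite ringl modl.
  by apply: addlin; [exact: modl | exact: modr].
- apply: addlin; last by rewrite pi_linear modr.
  by apply: addlin; [exact: modl | exact: modr].
Qed.

Lemma wmul_linearr x : linear (wmul x).
Proof.
case: x => [[[[a' b'] v'] p'] w'] c [[[[a b] v] p] w] [[[[a1 b1] v1] p1] w1].
rewrite -/(wtuple a b v p w) -/(wtuple a1 b1 v1 p1 w1) wtupleP /wmul /= wtupleP.
have ring1 (r s s1 : R) : r * (c * s + s1) = c * (r * s) + r * s1.
  by rewrite mulrDr mulrCA.
have ringl (r s s1 : R) : (c * s + s1) * r = c * (s * r) + s1 * r.
  by rewrite mulrDl mulrA.
have modl (V : lmodType R) (x : V) s s1 : (c * s + s1) *: x = c *: (s *: x) + s1 *: x.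
  by rewrite scalerDl scalerA.
have modr (V : lmodType R) (x x1 : V) r : r *: (c *: x + x1) = c *: (r *: x) + r *: x1.
  by rewrite scalerDr !scalerA mulrC.
congr wtuple; first exact: ring1.
- apply: (@addlin R^o); last exact: ring1.
  by apply: (@addlin R^o); [exact: ring1 | rewrite ring1 ringl].
- by apply: addlin; [exact: modr | rewrite ring1 modl].
- apply: addlin; last exact: linearP.
  apply: addlin; last by rewrite linearP modr.
  apply: addlin; last by rewrite ring1 modl.
  by apply: addlin; [exact: modr | rewrite ring1 modl].
- apply: addlin; last exact: modl.
  by apply: addlin; [exact: modr | rewrite ring1 modl].
Qed.

Definition wordAlgebra : algebra R := bilinear_algebra wmul_linearl wmul_linearr.

Lemma wordAlgebraE (x y : walg) : alg_mul wordAlgebra (tens x y) = wmul x y.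
Proof. exact: bilinear_algebraE. Qed.

Definition wone := wtuple 1 0 0 0 0.

Let pi0 : pi 0 = 0.
Proof. exact: linear_map0. Qed.

Let consv0 p : consv 0 p = 0 :> P.
Proof. by rewrite [consv _ _]big1 // => j _; rewrite mxE scale0r. Qed.

Local Ltac wsimp := rewrite /wmul /= ?(mulr1, mul1r, mulr0, mul0r, scaler0, scale0r,
  scale1r, add0r, addr0, linear0, consv0, pi0).

Lemma wmul1l x : wmul wone x = x.
Proof.
by case: x => [[[[a b] v] p] w]; wsimp.
Qed.

Lemma wmul1r a b v p w :
  wmul (wtuple a b v p w) wone = wtuple a (gam 1 * b) (gam 2 *: v) (gam 3 *: p) (gam 4 *: w).
Proof.
by wsimp.
Qed.

Lemma wmulTT b b' : wmul (wtuple 0 b 0 0 0) (wtuple 0 b' 0 0 0) =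
  wtuple 0 (b * b') 0 ((b * b') *: word_basis R D [::]) 0.
Proof. by wsimp. Qed.

Lemma wmulTP b p : wmul (wtuple 0 b 0 0 0) (wtuple 0 0 0 p 0) = wtuple 0 0 0 (b *: consl None p) 0.
Proof. by wsimp. Qed.

Lemma wmulVP v p : wmul (wtuple 0 0 v 0 0) (wtuple 0 0 0 p 0) = wtuple 0 0 0 (consv v p) 0.
Proof. by wsimp. Qed.

Lemma wmulPT p b : wmul (wtuple 0 0 0 p 0) (wtuple 0 b 0 0 0) = wtuple 0 0 0 0 (b *: pi p).
Proof. by wsimp. Qed.

Hypothesis gam0 : gam 0 = 1.
Hypothesis gam_unit : forall i, (i < 5)%N -> exists y, y * gam i = 1.
Hypothesis gam_sep : forall i j, (i < j < 5)%N -> exists y, y * (gam i - gam j) = 1.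

Let gam_inj (V : lmodType R) i j (x : V) : (i < 5)%N -> (j < 5)%N -> i != j ->
  gam i *: x = gam j *: x -> x = 0.
Proof.
have H k l : (k < l < 5)%N -> gam k *: x = gam l *: x -> x = 0.
  move=> /gam_sep[y e] E; rewrite -[x]scale1r -e -scalerA scalerBl E subrr.
  by rewrite scaler0.
move=> i5 j5; rewrite neq_ltn => /orP[ij|ji].
  by apply: H; rewrite ij.
by move/esym; apply: H; rewrite ji.
Qed.

Let gam_cancel (V : lmodType R) i (x : V) : (i < 5)%N -> gam i *: x = 0 -> x = 0.
Proof.
by move=> /gam_unit[y e] E; rewrite -[x]scale1r -e -scalerA E scaler0.
Qed.

Lemma sort_eigen k a b v p w : (k < 5)%N ->
  wmul (wtuple a b v p w) wone = gam k *: wtuple a b v p w ->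
  [/\ k != 0 -> a = 0, k != 1 -> b = 0, k != 2 -> v = 0, k != 3 -> p = 0 &
      k != 4 -> w = 0].
Proof.
move=> k5; rewrite wmul1r wtupleZ => -[ea eb eval_word ep ew].
split=> nk; rewrite eq_sym in nk.
- by apply: (@gam_inj R^o 0 k) => //; rewrite gam0 scale1r.
- exact: (@gam_inj R^o 1 k).
- exact: (@gam_inj _ 2 k).
- exact: (@gam_inj _ 3 k).
- exact: (@gam_inj _ 4 k).
Qed.

Section Automorphism.
Variables (f f' : walg -> walg).
Hypotheses (f_lin : linear f) (fM : forall x y, f (wmul x y) = wmul (f x) (f y)).
Hypotheses (fK : cancel f f') (f'K : cancel f' f).

Let f0 : f 0 = 0.
Proof. exact: linear_map0. Qed.
Let fZ c x : f (c *: x) = c *: f x.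
Proof. exact: linear_mapZ. Qed.
Let fD x y : f (x + y) = f x + f y.
Proof. exact: linear_mapD. Qed.

(** As f is onto, f e is again a left identity, so (f e) e = e. Comparing components, the unit
    eigenvalues [gam 1] to [gam 4] kill all components of f e but the first, which is 1. *)
Lemma aut_wone : f wone = wone.
Proof.
have ul y : wmul (f wone) y = y by rewrite -[y]f'K -fM wmul1l.
have := ul wone; case: (f wone) => [[[[a b] v] p] w].
rewrite -/(wtuple a b v p w) wmul1r => -[-> eb eval_word ep ew].
rewrite (@gam_cancel R^o 1 b) // (@gam_cancel _ 2 v) // (@gam_cancel _ 3 p) //.
by rewrite (@gam_cancel _ 4 w).
Qed.

Lemma aut_eigen k x : wmul x wone = gam k *: x -> wmul (f x) wone = gam k *: f x.
Proof. by move=> e; rewrite -{1}aut_wone -fM e fZ. Qed.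

Let sortT b : wmul (wtuple 0 b 0 0 0) wone = gam 1 *: wtuple 0 b 0 0 0.
Proof. by rewrite wmul1r wtupleZ !scaler0 mulr0. Qed.
Let sortV v : wmul (wtuple 0 0 v 0 0) wone = gam 2 *: wtuple 0 0 v 0 0.
Proof. by rewrite wmul1r wtupleZ !scaler0 !mulr0. Qed.
Let sortP p : wmul (wtuple 0 0 0 p 0) wone = gam 3 *: wtuple 0 0 0 p 0.
Proof. by rewrite wmul1r wtupleZ !scaler0 !mulr0. Qed.
Lemma aut_sortT b : exists b', f (wtuple 0 b 0 0 0) = wtuple 0 b' 0 0 0.
Proof.
have := aut_eigen (sortT b); case: (f _) => [[[[a b'] v] p] w].
by move=> /(@sort_eigen 1)[]// -> // _ -> // -> // -> //; exists b'.
Qed.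
Lemma aut_sortV v : exists v', f (wtuple 0 0 v 0 0) = wtuple 0 0 v' 0 0.
Proof.
have := aut_eigen (sortV v); case: (f _) => [[[[a b'] v'] p] w].
by move=> /(@sort_eigen 2)[]// -> // -> // _ -> // -> //; exists v'.
Qed.
Lemma aut_sortP p : exists p', f (wtuple 0 0 0 p 0) = wtuple 0 0 0 p' 0.
Proof.
have := aut_eigen (sortP p); case: (f _) => [[[[a b'] v] p'] w].
by move=> /(@sort_eigen 3)[]// -> // -> // -> // _ -> //; exists p'.
Qed.
(** Write f t = s t. In t t = t + [::] the component along t gives s s = s, and s is a unit because
    the inverse map also preserves the line of t; hence s = 1. The component in P then shows that
    the empty word is fixed, which starts the induction on words. *)
Lemma aut_T1 : f (wtuple 0 1 0 0 0) = wtuple 0 1 0 0 0 /\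
  f (wtuple 0 0 0 (word_basis R D [::]) 0) = wtuple 0 0 0 (word_basis R D [::]) 0.
Proof.
have [t ft] := aut_sortT 1; have [q fq] := aut_sortP (word_basis R D [::]).
have [t' t'E] : exists t', f' (wtuple 0 1 0 0 0) = wtuple 0 t' 0 0 0.
  have : wmul (f' (wtuple 0 1 0 0 0)) wone = gam 1 *: f' (wtuple 0 1 0 0 0).
    by apply: (can_inj fK); rewrite fM fZ f'K aut_wone sortT.
  case: (f' _) => [[[[a b'] v] p] w].
  by move=> /(@sort_eigen 1)[]// -> // _ -> // -> // -> //; exists b'.
have tt' : t' * t = 1.
  have := f'K (wtuple 0 1 0 0 0); rewrite t'E.
  have -> : wtuple 0 t' 0 0 0 = t' *: wtuple 0 1 0 0 0 by rewrite wtupleZ !scaler0 mulr0 mulr1.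
  by rewrite fZ ft wtupleZ => -[].
have := fM (wtuple 0 1 0 0 0) (wtuple 0 1 0 0 0); rewrite ft !wmulTT !mulr1 scale1r.
have -> : wtuple 0 1 0 (word_basis R D [::]) 0 = wtuple 0 1 0 0 0 + wtuple 0 0 0 (word_basis R D [::]) 0.
  by rewrite wtupleD !addr0 add0r.
rewrite fD ft fq wtupleD !addr0 !add0r => -[e1 e2].
have t1 : t = 1 by rewrite -[t]mul1r -tt' -mulrA -e1.
by rewrite e2 t1 mulr1 scale1r.
Qed.

(** The component in W has the form [pi q] because f is known there only through q t = pi q.
    Well-definedness is part of the conclusion: if pi q = 0, then pi (act_words h q) = 0. Relations
    for [h] will be extracted from this. *)
Lemma aut_classify : exists h : 'M[R]_n, forall a b v p q,
  f (wtuple a b v p (pi q)) = wtuple a b (h *m v) (act_words h p) (pi (act_words h q)).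
Proof.
have [fT fN] := aut_T1.
pose h := \matrix_(i, j) (f (wtuple 0 0 (delta_mx j 0) 0 0)).1.1.2 i 0.
have fV v : f (wtuple 0 0 v 0 0) = wtuple 0 0 (h *m v) 0 0.
  have lin3 : linear (fun u => wtuple 0 0 u 0 0).
    by move=> c x y; rewrite wtupleP !mulr0 !scaler0 !addr0.
  have ve : v = \sum_j v j 0 *: delta_mx j 0.
    by rewrite {1}[v]matrix_sum_delta; apply: eq_bigr => j _; rewrite big_ord1.
  rewrite {1}ve (linear_map_sum lin3) (linear_map_sum f_lin).
  have hv : h *m v = \sum_j v j 0 *: (f (wtuple 0 0 (delta_mx j 0) 0 0)).1.1.2.
    apply/colP => i; rewrite mxE summxE; apply: eq_bigr => j _.
    by rewrite !mxE mulrC.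
  rewrite hv (linear_map_sum lin3); apply: eq_bigr => j _.
  rewrite (linear_mapZ lin3) fZ; have [u' ->] := aut_sortV (delta_mx j 0).
  by rewrite (linear_mapZ lin3).
have fP p : f (wtuple 0 0 0 p 0) = wtuple 0 0 0 (act_words h p) 0.
  have lin4 : linear (fun p => wtuple 0 0 0 p 0).
    by move=> c x y; rewrite wtupleP !mulr0 !scaler0 !addr0.
  apply: (wordmod_ext (f := fun p => f (wtuple 0 0 0 p 0))
                      (g := fun p => wtuple 0 0 0 (act_words h p) 0)) p => [c x y|c x y|w].
  - by rewrite lin4 f_lin.
  - by rewrite linearP lin4.
  rewrite act_words_basis; elim: w => [|[j|] w IH]; first exact: fN.
  - rewrite -consl_basis -consv_delta -wmulVP fM fV IH wmulVP.
    by rewrite /= colE.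
  - by rewrite -consl_basis -[consl _ _]scale1r -wmulTP fM fT IH wmulTP scale1r.
exists h => a b v p q.
have -> : wtuple a b v p (pi q) = a *: wone + (b *: wtuple 0 1 0 0 0 + (wtuple 0 0 v 0 0 +
    (wtuple 0 0 0 p 0 + wmul (wtuple 0 0 0 q 0) (wtuple 0 1 0 0 0)))).
  rewrite wmulPT scale1r !wtupleZ !wtupleD !mulr0 !mulr1 !scaler0.
  by rewrite !(addr0, add0r).
rewrite f_lin f_lin aut_wone fT !fD fV fM !fP fT wmulPT scale1r !wtupleZ !wtupleD.
by rewrite !mulr0 !mulr1 !scaler0 !(addr0, add0r).
Qed.

End Automorphism.

Section MakeAutomorphism.
Variables (h : 'M[R]_n) (value_act : W -> W).
Hypotheses (value_act_linear : linear value_act).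
Hypothesis value_act_pi : forall p, value_act (pi p) = pi (act_words h p).

(** Bijectivity is left to the group law: the inverse will be the map of the inverse point. *)
Definition waut (x : walg) : walg :=
  let: (a, b, v, p, w) := x in wtuple a b (h *m v) (act_words h p) (value_act w).

Lemma waut_linear : linear waut.
Proof.
move=> c [[[[a b] v] p] w] [[[[a' b'] v'] p'] w'].
rewrite -/(wtuple a b v p w) -/(wtuple a' b' v' p' w') wtupleP /waut /= wtupleP.
by rewrite value_act_linear !linearP.
Qed.

Lemma wautM x y : waut (wmul x y) = wmul (waut x) (waut y).
Proof.
case: x y => [[[[a b] v] p] w] [[[[a' b'] v'] p'] w'].
rewrite /wmul /waut /=; congr wtuple.
- by rewrite mulmxDr -!scalemxAr.
- by rewrite !raddfD /= !linearZ /= act_words_basis act_words_consl act_words_consv.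
- by rewrite !(linear_mapD value_act_linear) !(linear_mapZ value_act_linear) value_act_pi.
Qed.
End MakeAutomorphism.
End WordAlgebra.

(** * Base change *)

Section WordMap.
Variables (R S : comPzRingType) (f : {rmorphism R -> S}) (n D : nat).
Local Notation PR := (wordmod R n D).
Local Notation PS := (wordmod S n D).

Definition map_words (p : PR) : PS := [ffun b => f (p b)].

Lemma map_wordsD : {morph map_words : p q / p + q}.
Proof. by move=> p q; apply/ffunP => b; rewrite !ffunE rmorphD. Qed.

Lemma map_wordsZ a p : map_words (a *: p) = f a *: map_words p.
Proof. by apply/ffunP => b; rewrite !ffunE rmorphM. Qed.

Lemma map_words0 : map_words 0 = 0.
Proof. by apply/ffunP => b; rewrite !ffunE rmorph0. Qed.

Lemma map_words_basis w : map_words (word_basis R D w) = word_basis S D w.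
Proof. by apply/ffunP => b; rewrite !ffunE rmorph_nat. Qed.

Lemma map_words_sum I (r : seq I) (P : pred I) (F : I -> PR) :
  map_words (\sum_(i <- r | P i) F i) = \sum_(i <- r | P i) map_words (F i).
Proof. exact: (big_morph map_words map_wordsD map_words0). Qed.

Lemma map_words_extend (F : word n -> PR) (F' : word n -> PS) p :
  (forall w, map_words (F w) = F' w) -> map_words (extend F p) = extend F' (map_words p).
Proof.
move=> FF'; rewrite map_words_sum; apply: eq_bigr => b _.
by rewrite map_wordsZ FF' ffunE.
Qed.

Lemma map_words_consl a p : map_words (consl a p) = consl a (map_words p).
Proof. by apply: map_words_extend => w; rewrite map_words_basis. Qed.

Lemma map_words_consv v p : map_words (consv v p) = consv (map_mx f v) (map_words p).
Proof.
rewrite map_words_sum; apply: eq_bigr => j _.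
by rewrite map_wordsZ map_words_consl mxE.
Qed.

Lemma map_act_words h p : map_words (act_words h p) = act_words (map_mx f h) (map_words p).
Proof.
apply: map_words_extend => w; elim: w => [|[j|] w IH] /=; first exact: map_words_basis.
  by rewrite map_words_consv IH map_col.
by rewrite map_words_consl IH.
Qed.

Lemma map_eval_word c i (w : word n) : f (eval_word c i w) = eval_word (map_mx f c) i w.
Proof.
elim: w i => [|[j|] w IH] i //=; first by rewrite rmorph_nat.
rewrite rmorphM IH; congr (_ * _); case: insubP => [i' _ _|_].
  by rewrite mxE.
exact: rmorph0.
Qed.

Lemma map_eval_words c i p : f (eval_words c i p) = eval_words (map_mx f c) i (map_words p).
Proof.
rewrite /eval_words /extend rmorph_sum; apply: eq_bigr => b _.
by rewrite /GRing.scale /= rmorphM map_eval_word ffunE.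
Qed.

End WordMap.

Section SemilinearExtension.
Variables (R : comPzRingType) (S : comAlg R) (M : lmodType R) (N : lmodType S).
Variable phi : M -> N.
Hypotheses (phiD : {morph phi : x y / x + y})
  (phiZ : forall r x, phi (r *: x) = alg_str S r *: phi x).

Definition bc_lift : base_change S M -> N := tlift (fun (s : S) m => s *: phi m).

Let bal : balanced (fun (s : S) m => s *: phi m).
Proof.
split=> [m s s'|s m m'|r s m]; rewrite ?scalerDl ?phiD ?scalerDr //.
by rewrite phiZ scalerA alg_scaleE mulrC.
Qed.

Lemma bc_liftE s m : bc_lift (bc_tens s m) = s *: phi m.
Proof. exact: tlift_tens bal s m. Qed.

Lemma bc_lift_linear : linear bc_lift.
Proof.
have bD : {morph bc_lift : x y / x + y} := tliftD bal.
move=> s x y; rewrite bD; congr (_ + _).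
apply: (bc_ext (f := fun x => bc_lift (s *: x)) (g := fun x => s *: bc_lift x)) x.
- by move=> x1 x2; rewrite scalerDr bD.
- by move=> x1 x2; rewrite bD scalerDr.
- by move=> t m; rewrite bc_tensZ !bc_liftE scalerA.
Qed.

End SemilinearExtension.

Section BcTens.
Variables (R : comPzRingType) (S : comAlg R) (M : lmodType R).

Lemma bc_tens1D : {morph (bc_tens 1 : M -> base_change S M) : x y / x + y}.
Proof. by move=> x y; rewrite /bc_tens tensDr. Qed.

Lemma bc_tens1Z r (x : M) : bc_tens (1 : S) (r *: x) = alg_str S r *: bc_tens 1 x.
Proof. by rewrite bc_tensZ mulr1 /bc_tens -tensZ alg_scaleE mulr1. Qed.

Lemma bc_lin_ext (N : lmodType S) (f g : base_change S M -> N) :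
  linear f -> linear g -> (forall m, f (bc_tens 1 m) = g (bc_tens 1 m)) -> f =1 g.
Proof.
move=> fl gl fg; apply: bc_ext; try exact: linear_mapD.
by move=> s m; rewrite bc_tensE !linear_mapZ // fg.
Qed.

End BcTens.

Section BaseChangeWords.
Variables (R : comPzRingType) (n D : nat) (gam : nat -> R).
Variables (W : lmodType R) (pi : wordmod R n D -> W).
Hypothesis pi_linear : linear pi.
Variable S : comAlg R.
Local Notation str := (alg_str S).
Local Notation gamS := (fun i => str (gam i)).
Local Notation WS := (base_change S W).
Local Notation PS := (wordmod S n D).
Local Notation AR := (walg n D W).
Local Notation AS := (walg n D WS).
Local Notation A := (wordAlgebra gam pi_linear).

Definition bc_pi : PS -> WS := extend (fun w => bc_tens 1 (pi (word_basis R D w))).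

Lemma bc_pi_linear : linear bc_pi.
Proof. exact: linearP. Qed.
HB.instance Definition _ := GRing.isLinear.Build S PS WS *:%R bc_pi bc_pi_linear.

Lemma bc_pi_map_words p : bc_pi (map_words str p) = bc_tens 1 (pi p).
Proof.
rewrite [p in RHS]wordmodE (linear_map_sum pi_linear).
rewrite (big_morph _ (@bc_tens1D R S W) (id1 := 0)) /bc_tens ?tens0r //.
apply: eq_bigr => b _; rewrite ffunE (linear_mapZ pi_linear).
by rewrite -[RHS]/(bc_tens 1 _) bc_tens1Z.
Qed.

Lemma bc_pi_surj : (forall w, exists p, pi p = w) -> forall w, exists p, bc_pi p = w.
Proof.
move=> pis; elim/tensor_ind => [|x y [p <-] [q <-]|s w].
- by exists 0; exact: linear0.
- by exists (p + q); exact: linearD.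
- have [p <-] := pis w; exists (s *: map_words str p).
  rewrite (linear_mapZ bc_pi_linear) bc_pi_map_words.
  by rewrite bc_tensZ mulr1.
Qed.

Definition wscal (x : AR) : AS :=
  let: (a, b, v, p, w) := x in wtuple (str a) (str b) (map_mx str v) (map_words str p) (bc_tens 1 w).

Lemma wscalD : {morph wscal : x y / x + y}.
Proof.
case=> [[[[a b] v] p] w] [[[[a' b'] v'] p'] w'].
rewrite -/(wtuple a b v p w) -/(wtuple a' b' v' p' w') wtupleD /wscal /= wtupleD.
by rewrite !rmorphD map_mxD map_wordsD bc_tens1D.
Qed.

Lemma wscalZ r x : wscal (r *: x) = str r *: wscal x.
Proof.
case: x => [[[[a b] v] p] w].
rewrite -/(wtuple a b v p w) wtupleZ /wscal /= wtupleZ.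
by rewrite !rmorphM map_mxZ map_wordsZ bc_tens1Z.
Qed.

Lemma wscalM x y :
  wscal (wmul gam pi x y) = wmul gamS bc_pi (wscal x) (wscal y).
Proof.
case: x y => [[[[a b] v] p] w] [[[[a' b'] v'] p'] w'].
rewrite /wmul /wscal /=; congr wtuple.
- exact: rmorphM.
- by rewrite !rmorphD !rmorphM.
- by rewrite map_mxD !map_mxZ !rmorphM.
- by rewrite !map_wordsD !map_wordsZ !rmorphM map_words_basis map_words_consl map_words_consv.
- by rewrite !bc_tens1D !bc_tens1Z !rmorphM bc_pi_map_words.
Qed.

(** S (x) A is again a word algebra, over S and with S (x) W in place of W. The classification of
    automorphisms holds over any base ring and for any linear [pi], hence applies to it. *)
Definition bc_sorts : base_change S AR -> AS := bc_lift wscal.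

Lemma bc_sortsE s x : bc_sorts (bc_tens s x) = s *: wscal x.
Proof. exact: bc_liftE wscalD wscalZ s x. Qed.

Lemma bc_sorts_linear : linear bc_sorts.
Proof. exact: bc_lift_linear wscalD wscalZ. Qed.

Lemma bc_sortsM (x y : base_change S AR) :
  bc_sorts (@bc_mul2 R S A x y) = wmul gamS bc_pi (bc_sorts x) (bc_sorts y).
Proof.
have wl := wmul_linearl (fun i => str (gam i)) bc_pi_linear.
have wr := wmul_linearr (fun i => str (gam i)) bc_pi.
apply: (bc_lin_ext (f := fun x => bc_sorts (@bc_mul2 R S A x y))
  (g := fun x => wmul gamS bc_pi (bc_sorts x) (bc_sorts y))) x.
- by move=> s x x'; rewrite bc_mul2Dl bc_mul2Zl bc_sorts_linear.
- by move=> s x x'; rewrite bc_sorts_linear wl.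
move=> a; apply: (bc_lin_ext (f := fun y => bc_sorts (@bc_mul2 R S A (bc_tens 1 a) y))
  (g := fun y => wmul gamS bc_pi (bc_sorts (bc_tens 1 a)) (bc_sorts y))) y.
- by move=> s y y'; rewrite bc_mul2Dr bc_mul2Zr bc_sorts_linear.
- by move=> s y y'; rewrite bc_sorts_linear wr.
- by move=> b; rewrite bc_mul2E mulr1 !bc_sortsE !scale1r wordAlgebraE wscalM.
Qed.

Definition incW (w : W) : AR := wtuple 0 0 0 0 w.
Fact incW_linear : linear incW.
Proof. by move=> c x y; rewrite /incW wtupleP !mulr0 !scaler0 !addr0. Qed.

Local Notation one := (bc_tens 1 : AR -> base_change S AR).

Definition bc_unsort (x : AS) : base_change S AR :=
  let: (a, b, v, p, w) := x in
  a *: one (wtuple 1 0 0 0 0) + b *: one (wtuple 0 1 0 0 0) +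
  \sum_j v j 0 *: one (wtuple 0 0 (delta_mx j 0) 0 0) +
  extend (fun u => one (wtuple 0 0 0 (word_basis R D u) 0)) p +
  bc_lift (fun u => one (incW u)) w.

Let incW_lift : linear (bc_lift (fun u => one (incW u))).
Proof.
apply: bc_lift_linear => [x y|r x].
  by rewrite (linear_mapD incW_linear) bc_tens1D.
by rewrite (linear_mapZ incW_linear) bc_tens1Z.
Qed.

Let incW_liftE s w : bc_lift (fun u => one (incW u)) (bc_tens s w) = bc_tens s (incW w).
Proof.
rewrite bc_liftE ?bc_tensZ ?mulr1 // => [x y|r x].
  by rewrite (linear_mapD incW_linear) bc_tens1D.
by rewrite (linear_mapZ incW_linear) bc_tens1Z.
Qed.

Lemma bc_unsort_linear : linear bc_unsort.
Proof.
move=> c [[[[a b] v] p] w] [[[[a' b'] v'] p'] w'].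
rewrite -/(wtuple a b v p w) -/(wtuple a' b' v' p' w') wtupleP /bc_unsort /=.
rewrite incW_lift linearP !scalerDr !scalerA.
rewrite [X in _ = X]addrACA; congr (_ + _); rewrite [X in _ = X]addrACA; congr (_ + _).
rewrite [X in _ = X]addrACA; congr (_ + _).
  by rewrite [X in _ = X]addrACA -!scalerDl.
rewrite scaler_sumr -big_split; apply: eq_bigr => j _.
by rewrite !mxE scalerDl scalerA.
Qed.

Lemma bc_unsortK : cancel bc_unsort bc_sorts.
Proof.
case=> [[[[a b] v] p] w]; rewrite /bc_unsort !(linear_mapD bc_sorts_linear).
rewrite !(linear_mapZ bc_sorts_linear) !bc_sortsE !scale1r.
have -> : bc_sorts (bc_lift (fun u => one (incW u)) w) = wtuple 0 0 0 0 w.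
  apply: (bc_lin_ext (f := fun w => bc_sorts (bc_lift (fun u => one (incW u)) w))
    (g := fun w => wtuple 0 0 0 0 w)) w => [s x y|s x y|m].
  - by rewrite incW_lift bc_sorts_linear.
  - by rewrite wtupleP !mulr0 !scaler0 !addr0.
  - by rewrite incW_liftE bc_sortsE scale1r /wscal /= !rmorph0 map_mx0 map_words0.
have -> : bc_sorts (\sum_j v j 0 *: one (wtuple 0 0 (delta_mx j 0) 0 0)) = wtuple 0 0 v 0 0.
  have lin3 : linear (fun u : 'cV[S]_n => wtuple 0 0 u 0 0 : AS).
    by move=> c x y; rewrite wtupleP !mulr0 !scaler0 !addr0.
  rewrite [v in RHS]matrix_sum_delta (linear_map_sum bc_sorts_linear) (linear_map_sum lin3).
  apply: eq_bigr => j _; rewrite big_ord1 (linear_mapZ lin3) (linear_mapZ bc_sorts_linear).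
  rewrite bc_sortsE scale1r /wscal /= !rmorph0 map_delta_mx map_words0.
  by rewrite /bc_tens tens0r.
have -> : bc_sorts (extend (fun u => one (wtuple 0 0 0 (word_basis R D u) 0)) p) = wtuple 0 0 0 p 0.
  apply: (wordmod_ext (f := fun p => bc_sorts (extend (fun u => one (wtuple 0 0 0 (word_basis R D u) 0)) p))
    (g := fun p => wtuple 0 0 0 p 0)) p => [c x y|c x y|u].
  - by rewrite linearP bc_sorts_linear.
  - by rewrite wtupleP !mulr0 !scaler0 !addr0.
  have [su|lu] := leqP (size u) D; last first.
    by rewrite word_basis_long // linear0 (linear_map0 bc_sorts_linear).
  rewrite extend_basis // bc_sortsE scale1r /wscal /= !rmorph0 map_mx0 map_words_basis.
  by rewrite /bc_tens tens0r.
rewrite /wscal /= !rmorph1 !rmorph0 !map_mx0 !map_words0 /bc_tens !tens0r.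
by rewrite !wtupleZ !wtupleD !mulr1 !mulr0 !scaler0 !addr0 !add0r.
Qed.

Lemma bc_sortsK : cancel bc_sorts bc_unsort.
Proof.
apply: (bc_lin_ext (f := fun x => bc_unsort (bc_sorts x)) (g := id)) => // [s x y|m].
  by rewrite bc_sorts_linear bc_unsort_linear.
rewrite bc_sortsE scale1r; case: m => [[[[a b] v] p] w].
rewrite /wscal /bc_unsort /= incW_liftE.
have ve : v = \sum_j v j 0 *: delta_mx j 0.
  by rewrite {1}[v]matrix_sum_delta; apply: eq_bigr => j _; rewrite big_ord1.
have oneS I (r : seq I) (P : pred I) (F : I -> AR) :
    one (\sum_(i <- r | P i) F i) = \sum_(i <- r | P i) one (F i).
  by apply: (big_morph one (@bc_tens1D R S AR)); rewrite /bc_tens tens0r.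
have -> : \sum_j map_mx str v j 0 *: one (wtuple 0 0 (delta_mx j 0) 0 0) = one (wtuple 0 0 v 0 0).
  have lin3 : linear (fun u : 'cV[R]_n => wtuple 0 0 u 0 0 : AR).
    by move=> c x y; rewrite wtupleP !mulr0 !scaler0 !addr0.
  rewrite [v in RHS]ve (linear_map_sum lin3) oneS; apply: eq_bigr => j _.
  by rewrite (linear_mapZ lin3) bc_tens1Z mxE.
have -> : extend (fun u => one (wtuple 0 0 0 (word_basis R D u) 0)) (map_words str p) = one (wtuple 0 0 0 p 0).
  have lin4 : linear (fun u : wordmod R n D => wtuple 0 0 0 u 0 : AR).
    by move=> c x y; rewrite wtupleP !mulr0 !scaler0 !addr0.
  rewrite [p in RHS]wordmodE (linear_map_sum lin4) oneS; apply: eq_bigr => u _.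
  by rewrite (linear_mapZ lin4) bc_tens1Z ffunE.
rewrite -!bc_tens1Z -!bc_tens1D /incW; congr one.
by rewrite !wtupleZ !wtupleD !mulr1 !mulr0 !scaler0 !addr0 !add0r.
Qed.

Section Transport.
Variables (f f' : AS -> AS).
Hypotheses (f_lin : linear f) (fK : cancel f f') (f'K : cancel f' f).
Hypothesis fM : forall x y, f (wmul gamS bc_pi x y) = wmul gamS bc_pi (f x) (f y).

Let F (x : bc_algebra S A) : bc_algebra S A := bc_unsort (f (bc_sorts x)).
Let F' (x : bc_algebra S A) : bc_algebra S A := bc_unsort (f' (bc_sorts x)).

Fact transport_linear : linear F.
Proof. by move=> s x y; rewrite /F bc_sorts_linear f_lin bc_unsort_linear. Qed.

Fact transport_mul (x y : bc_algebra S A) :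
  F (alg_mul (bc_algebra S A) (tens x y)) = alg_mul (bc_algebra S A) (tens (F x) (F y)).
Proof.
apply: (can_inj bc_sortsK); rewrite /= !bc_mulE bc_sortsM /F !bc_unsortK.
by rewrite bc_sortsM fM.
Qed.

Fact transport_funK : cancel F F'.
Proof. by move=> x; rewrite /F /F' bc_unsortK fK bc_sortsK. Qed.
Fact transport_invK : cancel F' F.
Proof. by move=> x; rewrite /F /F' bc_unsortK f'K bc_sortsK. Qed.

Definition transport : algAut (bc_algebra S A) :=
  AlgAut transport_linear transport_mul transport_funK transport_invK.

Lemma bc_sorts_transport x : bc_sorts (transport x) = f (bc_sorts x).
Proof. exact: bc_unsortK. Qed.

End Transport.

Section Back.
Variable s : algAut (bc_algebra S A).

Definition back (x : AS) : AS := bc_sorts (s (bc_unsort x)).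

Lemma back_linear : linear back.
Proof. by move=> c x y; rewrite /back bc_unsort_linear (@aut_linear _ _ s) bc_sorts_linear. Qed.

Lemma backM x y : back (wmul gamS bc_pi x y) = wmul gamS bc_pi (back x) (back y).
Proof.
rewrite /back -bc_sortsM -[in LHS](bc_unsortK x) -[in LHS](bc_unsortK y) -bc_sortsM bc_sortsK.
by congr bc_sorts; have := aut_mul s (bc_unsort x) (bc_unsort y); rewrite /= !bc_mulE.
Qed.

Lemma backK : cancel back (fun x => bc_sorts (aut_inv s (bc_unsort x))).
Proof. by move=> x; rewrite /back bc_sortsK aut_funK bc_unsortK. Qed.

Lemma backVK : cancel (fun x => bc_sorts (aut_inv s (bc_unsort x))) back.
Proof. by move=> x; rewrite /back bc_sortsK aut_invK bc_unsortK. Qed.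

End Back.

End BaseChangeWords.

(** * Points act on the word algebra *)

Section MatrixRepPoints.
Variables (R : comPzRingType) (G : affineGroup R) (n : nat).
Variables (c : 'M[ag_ring G]_n).
Hypothesis c_rep : matrix_rep c.

Lemma matrix_repM (S : comAlg R) (x y z : algHom (ag_ring G) S) :
  ag_point z = (ag_point x * ag_point y)%g ->
  map_mx z c = map_mx y c *m map_mx x c.
Proof.
case: c_rep => cM _; rewrite pointM => /point_inj ->.
transitivity (map_mx (tensor_pairh x y) (map_mx (coproduct G) c)).
  by apply/matrixP => i j; rewrite !mxE.
rewrite cM map_mxM; congr (_ *m _); apply/matrixP => i j; rewrite !mxE /=.
  by rewrite tensor_pairE rmorph1 mul1r.
by rewrite tensor_pairE rmorph1 mulr1.
Qed.

Lemma matrix_rep1 (S : comAlg R) (x : algHom (ag_ring G) S) :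
  ag_point x = 1%g -> map_mx x c = 1%:M.
Proof.
case: c_rep => _ c1; rewrite point1 => /point_inj ->.
transitivity (map_mx (alg_str S) (map_mx (counit G) c)).
  by apply/matrixP => i j; rewrite !mxE.
by rewrite c1; apply/matrixP => i j; rewrite !mxE rmorph_nat.
Qed.

End MatrixRepPoints.

Section GroupAlgebra.
Variables (R : comPzRingType) (G : affineGroup R) (n D : nat).
Local Notation B := (ag_ring G).
Local Notation B2 := (tensorAlg B B).
Variables (c : 'M[B]_n) (gam : nat -> R).
Hypotheses (B_flat : flat (B : lmodType R)) (c_rep : matrix_rep c).
Hypothesis gam0 : gam 0 = 1.
Hypothesis gam_unit : forall i, (i < 5)%N -> exists y, y * gam i = 1.
Hypothesis gam_sep : forall i j, (i < j < 5)%N -> exists y, y * (gam i - gam j) = 1.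
Local Notation PR := (wordmod R n D).

Definition word_value (p : PR) : B := eval_words c 0 (map_words (alg_str B) p).

Fact word_value_linear : linear word_value.
Proof. by move=> a p q; rewrite /word_value map_wordsD map_wordsZ linearP alg_scaleE. Qed.

Fact value_closed : linear_closed_set (fun b : B => exists p, word_value p = b).
Proof.
split=> [|a _ _ [p <-] [q <-]]; last by exists (a *: p + q); exact: word_value_linear.
by exists 0; exact: linear_map0 word_value_linear.
Qed.
Definition value_sub : submodule B := Submodule value_closed.
Local Notation W := (sub_mod value_sub).

Definition value_pi (p : PR) : W :=
  exist _ (word_value p) (asboolT (ex_intro _ p erefl)).

Fact value_pi_linear : linear value_pi.
Proof.
by move=> a p q; apply: val_inj; rewrite sub_mod_valP /= word_value_linear.
Qed.

Lemma value_pi_surj w : exists p, value_pi p = w.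
Proof. by have [p pw] := sub_modP w; exists p; apply: val_inj. Qed.

Section Point.
Variables (S : comAlg R).
Local Notation WS := (base_change S W).
Local Notation piS := (bc_pi value_pi (S := S)).
Local Notation gamS := (fun i => alg_str S (gam i)).

Lemma gamS0 : gamS 0 = 1. Proof. by rewrite /= gam0 rmorph1. Qed.
Lemma gamS_unit i : (i < 5)%N -> exists y, y * gamS i = 1.
Proof.
by move=> /gam_unit[y e]; exists (alg_str S y); rewrite -rmorphM e rmorph1.
Qed.
Lemma gamS_sep i j : (i < j < 5)%N -> exists y, y * (gamS i - gamS j) = 1.
Proof.
by move=> /gam_sep[y e]; exists (alg_str S y); rewrite -rmorphB -rmorphM e rmorph1.
Qed.

End Point.

Section Along.
Variables (S T : comAlg R) (k : algHom S T).

Lemma bc_along0 : bc_along k (V := W) 0 = 0.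
Proof. by apply: (addrI (bc_along k 0)); rewrite -bc_alongD !addr0. Qed.

Lemma bc_along_pi (q : wordmod S n D) :
  bc_along k (bc_pi value_pi q) = bc_pi value_pi (map_words k q).
Proof.
rewrite /bc_pi /extend (big_morph _ (bc_alongD k (V := W)) bc_along0).
apply: eq_bigr => b _.
by rewrite bc_alongZ bc_alongE rmorph1 ffunE.
Qed.

End Along.

(* The universal point is the identity of B; there B (x) W embeds in B (x) B because B
   is flat, and the image of the word sum is the coproduct of its value. *)
Lemma universal_descent (p : PR) : word_value p = 0 ->
  bc_pi value_pi (act_words c (map_words (alg_str B) p)) = 0.
Proof.
move=> p0; pose inl := tensor_inlh B B; pose inr := tensor_inrh B B.
have valE (q : wordmod B n D) : tensor_map idfun val (bc_pi value_pi q) =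
    eval_words (map_mx inr c) 0 (map_words inl q) :> B2.
  rewrite /bc_pi /extend.
  rewrite (big_morph (tensor_map idfun val : base_change B W -> B2)
     (@tensor_mapD _ _ _ _ _ idfun val) (id1 := 0)); last exact: linear0.
  apply: eq_bigr => b _; rewrite bc_tensZ mulr1 [LHS]tensor_map_tens ffunE.
  have -> : eval_word (map_mx inr c) 0 b = inr (eval_word c 0 b) by rewrite map_eval_word.
  transitivity (inl (q b) * inr (eval_word c 0 b)); last by [].
  rewrite /= /tensor_inl /tensor_inr tensorAlgM mulr1 mul1r.
  congr (tens _ _); rewrite /word_value map_words_basis.
  by rewrite /eval_words extend_basis ?size_bseq.
apply: (B_flat (g := val) val_inj).
rewrite [LHS]valE linear0 map_act_words -[map_words inl _](_ : map_words (alg_str B2) p = _); last first.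
  by apply/ffunP => b; rewrite !ffunE; exact/esym/(algHom_str inl).
rewrite eval_act_words; case: c_rep => <- _.
have -> : map_words (alg_str B2) p = map_words (coproduct G) (map_words (alg_str B) p).
  by apply/ffunP => b; rewrite !ffunE; exact/esym/(algHom_str (coproduct G)).
by rewrite -map_eval_words -/(word_value p) p0 rmorph0.
Qed.

Section Omega.
Variables (S : comAlg R) (x : algHom B S).
Local Notation WS := (base_change S W).
Local Notation piS := (bc_pi value_pi (S := S)).
Local Notation h := (map_mx x c).

(** The point [x] is the pushforward along [x] of the identity of [B], and base change along [x]
    carries the universal relation to S, whatever S is. *)
Lemma point_descent (p : PR) : value_pi p = 0 -> piS (act_words h (map_words (alg_str S) p)) = 0.
Proof.
move=> /(congr1 val) /= /universal_descent e.
have := congr1 (bc_along x (V := W)) e; rewrite bc_along_pi map_act_words.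
have -> : map_words x (map_words (alg_str B) p) = map_words (alg_str S) p.
  by apply/ffunP => b; rewrite !ffunE; exact: (algHom_str x).
by move=> ->; exact: bc_along0.
Qed.

Definition value_lift (w : W) : PR := sval (cid (value_pi_surj w)).
Lemma value_liftK w : value_pi (value_lift w) = w.
Proof. exact: svalP (cid (value_pi_surj w)). Qed.

Definition value_act0 (w : W) : WS := piS (act_words h (map_words (alg_str S) (value_lift w))).

Lemma value_act0E p : value_act0 (value_pi p) = piS (act_words h (map_words (alg_str S) p)).
Proof.
apply/eqP; rewrite /value_act0 -subr_eq0 -linearB -linearB /=; apply/eqP.
have -> : forall q q' : PR, map_words (alg_str S) q - map_words (alg_str S) q' =
    map_words (alg_str S) (q - q').
  by move=> q q'; apply/ffunP => b; rewrite !ffunE rmorphB.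
apply: point_descent.
have e : value_pi (value_lift (value_pi p) - p) = value_pi (value_lift (value_pi p)) - value_pi p.
  by rewrite addrC -scaleN1r value_pi_linear scaleN1r addrC.
by rewrite e value_liftK subrr.
Qed.

Fact value_act0D : {morph value_act0 : u w / u + w}.
Proof.
move=> u w; rewrite -[u]value_liftK -[w]value_liftK -(linear_mapD value_pi_linear).
by rewrite !value_act0E map_wordsD (linear_mapD (act_words_linear _)) (linear_mapD (@bc_pi_linear _ _ _ _ value_pi S)).
Qed.

Fact value_act0Z r w : value_act0 (r *: w) = alg_str S r *: value_act0 w.
Proof.
rewrite -[w]value_liftK -(linear_mapZ value_pi_linear) !value_act0E map_wordsZ.
by rewrite (linear_mapZ (act_words_linear _)) (linear_mapZ (@bc_pi_linear _ _ _ _ value_pi S)).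
Qed.

Definition value_act : WS -> WS := bc_lift value_act0.

Lemma value_act_linear : linear value_act.
Proof. exact: bc_lift_linear value_act0D value_act0Z. Qed.

Lemma value_act_pi q : value_act (piS q) = piS (act_words h q).
Proof.
apply: (wordmod_ext (f := fun q => value_act (piS q)) (g := fun q => piS (act_words h q))) q.
- by move=> a p q; rewrite bc_pi_linear value_act_linear.
- by move=> a p q; rewrite act_words_linear bc_pi_linear.
move=> w; rewrite -(map_words_basis (alg_str S)) bc_pi_map_words; last exact: value_pi_linear.
by rewrite /value_act (bc_liftE value_act0D value_act0Z) scale1r value_act0E.
Qed.

End Omega.

Lemma bc_value_surj (S : comAlg R) w : exists q, bc_pi value_pi (S := S) q = w.
Proof. exact: (bc_pi_surj value_pi_linear value_pi_surj). Qed.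

Definition groupAlgebra : algebra R := wordAlgebra gam value_pi_linear.

Definition point_map (S : comAlg R) (z : algHom B S) :
    walg n D (base_change S W) -> walg n D (base_change S W) :=
  waut (map_mx z c) (value_act z).

Definition point_of (S : comAlg R) (g : G S) : algHom B S := sval (cid (point_surj g)).
Lemma point_ofK (S : comAlg R) (g : G S) : ag_point (point_of g) = g.
Proof. exact: svalP (cid (point_surj g)). Qed.
Lemma point_of_point (S : comAlg R) (x : algHom B S) : point_of (ag_point x) = x.
Proof. by apply: point_inj; rewrite point_ofK. Qed.

Section GroupAction.
Variable S : comAlg R.
Implicit Types g : G S.
Local Notation sorts := (@bc_sorts R n D W S).

(* A point x acts through map_mx x c, which reverses products: hence the inverse. *)
Definition group_map g := @point_map S (point_of g^-1%g).

Lemma group_mapM g g' u : group_map (g * g')%g u = group_map g (group_map g' u).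
Proof.
have e : map_mx (point_of (g * g')^-1%g) c =
    map_mx (point_of g^-1%g) c *m map_mx (point_of g'^-1%g) c.
  by apply: (matrix_repM c_rep); rewrite !point_ofK invgM.
case: u => [[[[a b] v] p] w]; rewrite /group_map /point_map /waut /= e mulmxA act_words_comp.
by have [q <-] := bc_value_surj w; rewrite !value_act_pi act_words_comp e.
Qed.

Lemma group_map1 u : group_map 1%g u = u.
Proof.
have e : map_mx (point_of (1 : G S)^-1%g) c = 1%:M.
  by apply: (matrix_rep1 c_rep); rewrite point_ofK invg1.
case: u => [[[[a b] v] p] w]; rewrite /group_map /point_map /waut /= e mul1mx act_words1.
by have [q <-] := bc_value_surj w; rewrite value_act_pi e act_words1.
Qed.

Lemma group_mapK g : cancel (group_map g) (group_map g^-1%g).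
Proof. by move=> u; rewrite -group_mapM mulVg group_map1. Qed.

Lemma group_mapVK g : cancel (group_map g^-1%g) (group_map g).
Proof. by move=> u; rewrite -group_mapM mulgV group_map1. Qed.

Lemma group_map_linear g : linear (group_map g).
Proof. by apply: waut_linear; exact: value_act_linear. Qed.

Lemma group_map_mul g u v :
  group_map g (wmul (fun i => alg_str S (gam i)) (bc_pi value_pi (S := S)) u v) =
  wmul (fun i => alg_str S (gam i)) (bc_pi value_pi (S := S)) (group_map g u) (group_map g v).
Proof. by apply: wautM; [exact: value_act_linear | exact: value_act_pi]. Qed.

Definition group_aut g : algAut (bc_algebra S groupAlgebra) :=
  transport value_pi_linear (group_map_linear g) (group_mapK g) (group_mapVK g)
    (group_map_mul g).

Lemma bc_sorts_group_aut g (u : base_change S groupAlgebra) :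
  sorts (group_aut g u) = group_map g (sorts u).
Proof. exact: bc_sorts_transport. Qed.

Lemma group_autM : {morph group_aut : g g' / (g * g')%g}.
Proof.
move=> g g'; apply: algAut_eq => u; apply: (can_inj (@bc_sortsK R n D W S)).
rewrite [LHS]bc_sorts_group_aut [LHS]group_mapM; symmetry.
by rewrite [LHS](bc_sorts_group_aut g) (bc_sorts_group_aut g').
Qed.

End GroupAction.

Section Naturality.
Variables (S T : comAlg R) (k : algHom S T).

Definition walg_along (u : walg n D (base_change S W)) : walg n D (base_change T W) :=
  let: (a, b, v, p, w) := u in wtuple (k a) (k b) (map_mx k v) (map_words k p) (bc_along k w).

Lemma walg_alongD : {morph walg_along : u v / u + v}.
Proof.
case=> [[[[a b] v] p] w] [[[[a' b'] v'] p'] w'].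
rewrite -/(wtuple a b v p w) -/(wtuple a' b' v' p' w') wtupleD /walg_along /= wtupleD.
by rewrite !rmorphD map_mxD map_wordsD bc_alongD.
Qed.

Lemma walg_alongZ s u : walg_along (s *: u) = k s *: walg_along u.
Proof.
case: u => [[[[a b] v] p] w].
rewrite -/(wtuple a b v p w) wtupleZ /walg_along /= wtupleZ.
by rewrite !rmorphM map_mxZ map_wordsZ bc_alongZ.
Qed.

Lemma bc_sorts_along (u : base_change S (walg n D W)) :
  @bc_sorts R n D W T (bc_along k u) = walg_along (@bc_sorts R n D W S u).
Proof.
have bS := @bc_sorts_linear R n D W S; have bT := @bc_sorts_linear R n D W T.
apply: (bc_ext (f := fun u => @bc_sorts R n D W T (bc_along k u))
               (g := fun u => walg_along (@bc_sorts R n D W S u))) u.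
- by move=> x y; rewrite bc_alongD (linear_mapD bT).
- by move=> x y; rewrite (linear_mapD bS) walg_alongD.
move=> s [[[[a b] v] p] w]; rewrite bc_alongE !bc_sortsE walg_alongZ; congr (_ *: _).
rewrite /wscal /walg_along /=; congr wtuple; rewrite ?algHom_str //.
- by apply/colP => i; rewrite !mxE; exact/esym/(algHom_str k).
- by apply/ffunP => i; rewrite !ffunE; exact/esym/(algHom_str k).
- by rewrite bc_alongE rmorph1.
Qed.

Lemma group_map_along g u :
  group_map (gf_map k g) (walg_along u) = walg_along (group_map g u).
Proof.
have e : point_of (gf_map k g)^-1%g = algHom_comp k (point_of g^-1%g).
  apply: point_inj; rewrite point_ofK ag_point_nat point_ofK.
  apply: (mulgI (gf_map k g)); rewrite mulgV -gf_mapM mulgV.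
  apply: (mulgI (gf_map k 1%g)).
  by rewrite mulg1 -gf_mapM mulg1.
have em : map_mx (point_of (gf_map k g)^-1%g) c = map_mx k (map_mx (point_of g^-1%g) c).
  by rewrite e; apply/matrixP => i j; rewrite !mxE.
case: u => [[[[a b] v] p] w]; rewrite /group_map /point_map /waut /walg_along /= em.
have [q <-] := bc_value_surj w.
rewrite value_act_pi !bc_along_pi value_act_pi em !map_act_words; congr wtuple.
by rewrite map_mxM.
Qed.

Lemma group_aut_along g :
  group_aut (gf_map k g) = aut_extend k (group_aut g).
Proof.
have fl := @aut_linear _ _ (group_aut g).
have gl := @aut_linear _ _ (group_aut (gf_map k g)).
apply: algAut_eq => u.
apply: (bc_span (h := k) (p := group_aut (gf_map k g)) (q := bc_extend k (group_aut g))) u.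
- exact: linear_mapD gl.
- exact: bc_extendD fl.
move=> t x; rewrite (linear_mapZ gl) bc_extendZ // bc_extend_along //; congr (_ *: _).
apply: (can_inj (@bc_sortsK R n D W T)).
by rewrite [LHS]bc_sorts_group_aut [RHS]bc_sorts_along bc_sorts_along group_map_along bc_sorts_group_aut.
Qed.

End Naturality.

Hypothesis c_separates : forall (S : comAlg R) (x y : algHom B S),
  map_mx x c = map_mx y c -> x = y.
Hypothesis c_relations : forall (S : comAlg R) (h : 'M[S]_n),
  (forall p, word_value p = 0 -> eval_words h 0 (map_words (alg_str S) p) = 0) ->
  exists x : algHom B S, map_mx x c = h.

Lemma group_aut_inj (S : comAlg R) : injective (@group_aut S).
Proof.
move=> g g' gg'.
have e u : group_map g u = group_map g' u.
  by rewrite -(@bc_unsortK R n D W S u) -[LHS]bc_sorts_group_aut gg' bc_sorts_group_aut.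
suff /c_separates/(congr1 (@ag_point _ G S)) :
    map_mx (point_of g^-1%g) c = map_mx (point_of g'^-1%g) c.
  by rewrite !point_ofK => /invg_inj.
apply/matrixP => i j.
have := congr1 (fun u : walg n D (base_change S W) => u.1.1.2 i 0)
  (e (wtuple 0 0 (delta_mx j 0) 0 0)).
by rewrite /= -!colE !mxE.
Qed.

(** The counit restricted to [W] extends to an S-linear form on S (x) W, and composing it with
    [bc_pi] gives evaluation at the identity matrix. No embedding of S (x) W in S (x) B is
    involved. *)
Lemma counit_descent (S : comAlg R) (q : wordmod S n D) :
  bc_pi value_pi q = 0 -> eval_words 1%:M 0 q = 0.
Proof.
pose e (w : W) : S^o := alg_str S (counit G (val w)).
have eD : {morph e : u w / u + w}.
  move=> u w; rewrite /e (linear_mapD (@sub_mod_valP _ _ value_sub)).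
  by rewrite (raddfD (counit G)) [alg_str S _]rmorphD.
have eZ r w : e (r *: w) = alg_str S r *: e w.
  rewrite /e (linear_mapZ (@sub_mod_valP _ _ value_sub)).
  by rewrite (algHom_scalable (counit G)) alg_scaleE [alg_str S _]rmorphM.
have eE : bc_lift e (bc_pi value_pi q) = eval_words 1%:M 0 q.
  apply: (wordmod_ext (f := fun q => bc_lift e (bc_pi value_pi q))
                      (g := eval_words 1%:M 0)) q => [a p q|a p q|w].
  - by rewrite bc_pi_linear (bc_lift_linear eD eZ).
  - exact: linearP.
  have [sw|lw] := leqP (size w) D; last first.
    by rewrite word_basis_long // !linear0 (linear_map0 (bc_lift_linear eD eZ)).
  rewrite /bc_pi extend_basis // (bc_liftE eD eZ) scale1r /e /eval_words extend_basis //=.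
  rewrite /word_value map_words_basis /eval_words extend_basis //.
  case: c_rep => _ c1.
  have -> : counit G (eval_word c 0 w) = eval_word (map_mx (counit G) c) 0 w by rewrite map_eval_word.
  rewrite c1 map_eval_word; congr (eval_word _ _ _).
  by apply/matrixP => i j; rewrite !mxE rmorph_nat.
by move=> q0; rewrite -eE q0 (linear_map0 (bc_lift_linear eD eZ)).
Qed.

Lemma group_aut_surj (S : comAlg R) (s : algAut (bc_algebra S groupAlgebra)) :
  exists g : G S, group_aut g = s.
Proof.
have [h hE] := aut_classify (bc_pi_linear value_pi (S := S)) (gamS0 S) (@gamS_unit S)
  (@gamS_sep S) (back_linear s) (backM s) (backK s) (backVK s).
have [p p0|x xc] := @c_relations S h.
  (* A relation p at [c] means pi p = 0, so the automorphism maps 0 to the class in S (x) W of p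
     after substitution by [h]. Evaluating this class at the identity matrix gives the value of p at
     [h]. *)
  have := hE 0 0 0 0 (map_words (alg_str S) p).
  rewrite bc_pi_map_words; last exact: value_pi_linear.
  have -> : value_pi p = 0 by apply: val_inj.
  have -> : wtuple 0 0 0 0 (bc_tens 1 0) = 0 :> walg n D (base_change S W).
    by rewrite /bc_tens tens0r.
  rewrite (linear_map0 (back_linear s)).
  move=> /(congr1 (fun u : walg n D (base_change S W) => u.2)) /= /esym/counit_descent.
  by rewrite eval_act_words mul1mx.
exists (ag_point x)^-1%g; apply: algAut_eq => u; apply: (can_inj (@bc_sortsK R n D W S)).
rewrite [LHS]bc_sorts_group_aut /group_map invgK point_of_point -[u in RHS](@bc_sortsK R n D W S).
rewrite -[RHS]/(back s (bc_sorts u)); case: (bc_sorts u) => [[[[a b] v] p] w].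
have [q <-] := bc_value_surj w; rewrite -/(wtuple a b v p _) hE.
by rewrite /point_map /waut /= value_act_pi xc.
Qed.

Lemma group_algebra_iso : gf_isomorphic G (Aut_functor groupAlgebra).
Proof.
exists group_aut; split.
- move=> S; have [f fP] := choice (@group_aut_surj S).
  by exists f => [g|s]; [apply: group_aut_inj; rewrite fP | exact: fP].
- by move=> S; exact: group_autM.
- by move=> S T k g; exact: group_aut_along.
Qed.

End GroupAlgebra.

(** * Points from relations between matrix coefficients *)

Section MpolyHom.
Variables (R : comNzRingType) (m : nat).
Local Notation PA := (mpolyAlg R m).

Lemma mpoly_hom_sum (S : comAlg R) (f : algHom PA S) (p : {mpoly R[m]}) :
  f p = \sum_(u <- msupp p) alg_str S p@_u * \prod_i f ('X_i : {mpoly R[m]}) ^+ u i.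
Proof.
have fM (a b : {mpoly R[m]}) : f (a * b) = f a * f b := rmorphM f a b.
have fD (a b : {mpoly R[m]}) : f (a + b) = f a + f b := raddfD f a b.
have f1 : f (1 : {mpoly R[m]}) = 1 := rmorph1 f.
have f0 : f (0 : {mpoly R[m]}) = 0 := raddf0 f.
have fX (a : {mpoly R[m]}) k : f (a ^+ k) = f a ^+ k.
  by elim: k => [|k IH]; rewrite ?expr0 // !exprS fM IH.
rewrite [p in LHS]mpolyE (big_morph f fD f0); apply: eq_bigr => u _.
rewrite -mul_mpolyC fM (algHom_str f); congr (_ * _).
rewrite mpolyXE_id (big_morph f fM f1); apply: eq_bigr => i _.
exact: fX.
Qed.

Lemma mpoly_hom_ext (S : comAlg R) (f g : algHom PA S) :
  (forall l, f ('X_l : {mpoly R[m]}) = g ('X_l : {mpoly R[m]})) -> f =1 g.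
Proof.
move=> fg p; rewrite !mpoly_hom_sum; apply: eq_bigr => u _; congr (_ * _).
by apply: eq_bigr => i _; rewrite fg.
Qed.

(* mmap requires a nonzero target ring, whence the case distinction. *)
Lemma mpoly_hom_exists (S : comAlg R) (y : 'I_m -> S) :
  exists f : algHom PA S, forall l, f ('X_l : {mpoly R[m]}) = y l.
Proof.
have [S0|S1] := eqVneq (1 : S) 0.
  have all0 (x : S) : x = 0 by rewrite -[x]mulr1 S0 mulr0.
  have fz : zmod_morphism (fun _ : PA => 0 : S) by move=> ? ?; rewrite subrr.
  have fm : monoid_morphism (fun _ : PA => 0 : S).
    by split=> [|? ?]; rewrite ?mulr0 ?S0.
  have fs r : (fun _ : PA => 0 : S) (alg_str PA r) = alg_str S r.
    by rewrite [RHS]all0.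
  by exists (AlgHom fz fm fs) => l; rewrite [RHS]all0.
pose S' : comNzRingType := HB.pack (comAlg_sort S)
  (GRing.PzSemiRing_isNonZero.Build (comAlg_sort S) S1).
pose str' : {rmorphism R -> S'} := alg_str S.
pose f (p : PA) : S := mmap str' (y : 'I_m -> S') p.
have fz : zmod_morphism f by move=> a b; exact: (raddfB (mmap str' (y : 'I_m -> S'))).
have fm : monoid_morphism f.
  split; first exact: (rmorph1 (mmap str' (y : 'I_m -> S'))).
  by move=> a b; exact: (rmorphM (mmap str' (y : 'I_m -> S'))).
have fs r : f (alg_str PA r) = alg_str S r.
  by rewrite -[alg_str PA r]/(mpolyC m r) /f mmapC.
exists (AlgHom fz fm fs) => l.
by rewrite /= /f mmapX mmap1U.
Qed.
End MpolyHom.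

Lemma algHom_factor (R : comPzRingType) (P B S : comAlg R) (q : algHom P B) (f : algHom P S) :
  (forall b, exists p, q p = b) -> (forall p, q p = 0 -> f p = 0) ->
  exists x : algHom B S, forall p, x (q p) = f p.
Proof.
move=> qs qf; have [l lP] := choice qs.
have qfE p p' : q p = q p' -> f p = f p'.
  move=> e; apply/eqP; rewrite -subr_eq0 -raddfB; apply/eqP/qf.
  by rewrite raddfB /= e subrr.
pose x b := f (l b).
have xq p : x (q p) = f p by apply: qfE; rewrite lP.
have xz : zmod_morphism x.
  by move=> a b; rewrite /x -raddfB; apply: qfE; rewrite raddfB /= !lP.
have xm : monoid_morphism x.
  split; first by rewrite -[RHS](rmorph1 f); apply: qfE; rewrite lP rmorph1.
  by move=> a b; rewrite /x -rmorphM; apply: qfE; rewrite rmorphM /= !lP.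
have xs r : x (alg_str B r) = alg_str S r by rewrite -(algHom_str q) xq algHom_str.
by exists (AlgHom xz xm xs).
Qed.

(** * Polynomials in the entries of a matrix, uniformly in the coefficient algebra *)

Section Expressions.
Variables (R : comPzRingType) (n : nat).
Local Notation family := (forall S : comAlg R, 'M[S]_n -> S).

Definition mono (S : comAlg R) (h : 'M[S]_n) (s : seq ('I_n * 'I_n)) : S :=
  \prod_(ij <- s) h ij.1 ij.2.

Definition mono_word (s : seq ('I_n * 'I_n)) : word n :=
  flatten [seq rcons (nseq (ij.1 : 'I_n) None) (Some ij.2) | ij <- s].

Lemma eval_word_nseq (S : comAlg R) (h : 'M[S]_n) i k w :
  eval_word h i (nseq k None ++ w) = eval_word h (i + k) w.
Proof. by elim: k i => [|k IH] i /=; rewrite ?addn0 // IH addSnnS. Qed.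

Lemma eval_mono_word (S : comAlg R) (h : 'M[S]_n) s : eval_word h 0 (mono_word s) = mono h s.
Proof.
rewrite /mono; elim: s => [|[i j] s IH]; first by rewrite big_nil.
have -> : mono_word ((i, j) :: s) = rcons (nseq i None) (Some j) ++ mono_word s by [].
rewrite big_cons.
rewrite cat_rcons eval_word_nseq /= add0n IH.
by rewrite valK.
Qed.

(** One list of terms serves all S, so that an identity verified at [c] over [B] can be demanded of
    [h] over S. *)
Definition expressible (F : family) := exists L : seq (R * seq ('I_n * 'I_n)),
  forall S h, F S h = \sum_(t <- L) alg_str S t.1 * mono h t.2.

Lemma expressible_const r : expressible (fun S _ => alg_str S r).
Proof.
exists [:: (r, [::])] => S h; rewrite big_seq1 /mono big_nil /=.
by rewrite mulr1.
Qed.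

Lemma expressible_var i j : expressible (fun S h => h i j).
Proof.
exists [:: (1, [:: (i, j)])] => S h; rewrite big_seq1 /mono big_seq1 /=.
by rewrite rmorph1 mul1r.
Qed.

Lemma expressible_add F F' : expressible F -> expressible F' ->
  expressible (fun S h => F S h + F' S h).
Proof. by move=> [L e] [L' e']; exists (L ++ L') => S h; rewrite big_cat /= e e'. Qed.

Lemma expressible_mul F F' : expressible F -> expressible F' ->
  expressible (fun S h => F S h * F' S h).
Proof.
move=> [L e] [L' e'].
exists [seq (t.1 * t'.1, t.2 ++ t'.2) | t <- L, t' <- L'] => S h.
rewrite big_allpairs_dep e e' mulr_suml; apply: eq_bigr => t _.
rewrite mulr_sumr; apply: eq_bigr => t' _.
by rewrite rmorphM /mono big_cat /= mulrACA.
Qed.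

Lemma expressible_sum I (r : seq I) (F : I -> family) :
  (forall i, expressible (F i)) -> expressible (fun S h => \sum_(i <- r) F i S h).
Proof.
move=> Fe; elim: r => [|i r IH].
  by exists [::] => S h; rewrite !big_nil.
have [L e] := expressible_add (Fe i) IH.
by exists L => S h; rewrite big_cons e.
Qed.

Lemma expressible_prod I (r : seq I) (F : I -> family) :
  (forall i, expressible (F i)) -> expressible (fun S h => \prod_(i <- r) F i S h).
Proof.
move=> Fe; elim: r => [|i r IH].
  have [L e] := expressible_const 1; exists L => S h.
  by rewrite big_nil -e rmorph1.
have [L e] := expressible_mul (Fe i) IH.
by exists L => S h; rewrite big_cons e.
Qed.

Lemma expressible_exp F k : expressible F -> expressible (fun S h => F S h ^+ k).
Proof.
move=> Fe; have [L e] := expressible_prod (iota 0 k) (fun _ => Fe).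
by exists L => S h; rewrite -e big_const_seq count_predT size_iota iter_mulr_1.
Qed.

(** The bound [D] on the length of words originates here: it is the length of the longest word among
    all terms of finitely many polynomials. *)
Lemma expressible_words (I : finType) (F : I -> family) :
  (forall i, expressible (F i)) -> exists D, forall i,
    exists p : wordmod R n D, forall S h, F i S h = eval_words h 0 (map_words (alg_str S) p).
Proof.
move=> /choice[L LP].
pose D := \max_i \max_(t <- L i) size (mono_word t.2).
exists D => i; exists (\sum_(t <- L i) t.1 *: word_basis R D (mono_word t.2)) => S h.
have sD t : t \in L i -> (size (mono_word t.2) <= D)%N.
  move=> tL; apply: leq_trans (leq_bigmax i); rewrite (big_rem t) //=.
  exact: leq_maxl.
rewrite LP map_words_sum linear_sum big_seq [RHS]big_seq; apply: eq_bigr => t tL.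
rewrite map_wordsZ linearZ /= map_words_basis /eval_words extend_basis ?sD //.
by rewrite eval_mono_word.
Qed.

End Expressions.

Section Relations.
Variables (R : comNzRingType) (G : affineGroup R) (n m : nat) (c : 'M[ag_ring G]_n).
Local Notation B := (ag_ring G).
Local Notation PA := (mpolyAlg R m).
Variable q : algHom PA B.
Hypothesis q_surj : forall b, exists f, q f = b.
Local Notation Xm l := (('X_l : {mpoly R[m]}) : PA).
Variables (a : 'I_m -> 'I_n -> 'I_n -> R) (a0 : 'I_m -> R).
Hypothesis q_var : forall l,
  q (Xm l) = alg_str B (a0 l) + \sum_i \sum_j alg_str B (a l i j) * c i j.

Let y (l : 'I_m) (S : comAlg R) (h : 'M[S]_n) : S :=
  alg_str S (a0 l) + \sum_i \sum_j alg_str S (a l i j) * h i j.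

Let y_expr l : expressible (y l).
Proof.
apply: expressible_add; first exact: expressible_const.
apply: (@expressible_sum _ _ _ _ (fun i S h => \sum_j alg_str S (a l i j) * h i j)) => i.
apply: (@expressible_sum _ _ _ _ (fun j S h => alg_str S (a l i j) * h i j)) => j.
by apply: expressible_mul; [exact: expressible_const | exact: expressible_var].
Qed.

Let f (S : comAlg R) (h : 'M[S]_n) : algHom PA S :=
  sval (cid (mpoly_hom_exists (fun l => y l h))).

Let fE (S : comAlg R) (h : 'M[S]_n) l : f h (Xm l) = y l h.
Proof. exact: (svalP (cid (mpoly_hom_exists (fun l => y l h)))). Qed.

Let f_expr (p : PA) : expressible (fun S h => f h p).
Proof.
have [L LP] : expressible (fun S h => \sum_(u <- msupp p) alg_str S (p : {mpoly R[m]})@_u *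
    \prod_(i <- index_enum 'I_m) y i h ^+ (u : 'X_{1..m}) i).
  apply: (@expressible_sum _ _ _ _ (fun u S h => alg_str S (p : {mpoly R[m]})@_u *
    \prod_(i <- index_enum 'I_m) y i h ^+ (u : 'X_{1..m}) i)) => u.
  apply: expressible_mul; first exact: expressible_const.
  apply: (@expressible_prod _ _ _ _ (fun i S h => y i h ^+ (u : 'X_{1..m}) i)) => i.
  exact: expressible_exp (y_expr i).
exists L => S h; rewrite -LP mpoly_hom_sum; apply: eq_bigr => u _.
by congr (_ * _); apply: eq_bigr => i _; rewrite fE.
Qed.

Lemma matrix_separates (S : comAlg R) (x z : algHom B S) :
  map_mx x c = map_mx z c -> x = z.
Proof.
move=> xz; apply: algHom_eq => b; have [p <-] := q_surj b.
apply: (mpoly_hom_ext (f := algHom_comp x q) (g := algHom_comp z q)) p => l /=.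
rewrite q_var !raddfD !raddf_sum /= !algHom_str; congr (_ + _).
apply: eq_bigr => i _; rewrite !raddf_sum; apply: eq_bigr => j _ /=.
rewrite !rmorphM /= !algHom_str; congr (_ * _).
by have /matrixP/(_ i j) := xz; rewrite !mxE.
Qed.

Lemma matrix_relations :
  finitely_generated_ideal [pred p : PA | q p == 0] ->
  exists D, forall (S : comAlg R) (h : 'M[S]_n),
    (forall p : wordmod R n D, eval_words c 0 (map_words (alg_str B) p) = 0 ->
      eval_words h 0 (map_words (alg_str S) p) = 0) ->
    exists x : algHom B S, map_mx x c = h.
Proof.
move=> [k [r rP]].
have /choice[C CP] (ij : 'I_n * 'I_n) : exists p, q p = c ij.1 ij.2 by exact: q_surj.
(* These finitely many relations suffice. The generators [r i] of the kernel of [q] make the map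
   from polynomials to S attached to [h] factor through [B]. The lifts [C ij] of the entries of [c]
   ensure that the resulting point has matrix [h], beyond agreeing with it on the combinations
   [y l]. *)
pose F (i : 'I_k + 'I_n * 'I_n) (S : comAlg R) (h : 'M[S]_n) : S :=
  match i with
  | Datatypes.inl i => f h (r i)
  | Datatypes.inr ij => f h (C ij) + alg_str S (-1) * h ij.1 ij.2
  end.
have Fe i : expressible (F i).
  case: i => [i|ij]; first exact: f_expr.
  apply: expressible_add; first exact: f_expr.
  by apply: expressible_mul; [exact: expressible_const | exact: expressible_var].
have [D DP] := expressible_words Fe; exists D => S h H.
have fc p : f c p = q p.
  by apply: (mpoly_hom_ext (f := f c) (g := q)) => l; rewrite fE q_var.
have Fh i : F i B c = 0 -> F i S h = 0.
  by have [p pP] := DP i; rewrite !pP; exact: H.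
have f_rel i : f h (r i) = 0.
  apply: (Fh (Datatypes.inl i)); rewrite /= fc.
  suff /(rP _) : exists d : 'I_k -> PA, r i = \sum_j d j * r j by move=> /eqP.
  exists (fun j => (j == i)%:R); rewrite (bigD1 i) //= eqxx mul1r big1 ?addr0 //.
  by move=> j /negbTE->; rewrite mul0r.
have f_ker p : q p = 0 -> f h p = 0.
  move=> p0; have /rP[d ->] : p \in [pred p : PA | q p == 0] by rewrite inE p0.
  rewrite raddf_sum big1 // => i _; rewrite [LHS]rmorphM /= f_rel.
  exact: mulr0.
have [x xq] := algHom_factor q_surj f_ker.
exists x; apply/matrixP => i j; rewrite mxE -[c i j]/(c (i, j).1 (i, j).2) -CP xq.
have := Fh (Datatypes.inr (i, j)); rewrite /= fc CP !rmorphN !rmorph1 !mulN1r subrr.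
by move=> /(_ erefl)/eqP; rewrite subr_eq0 => /eqP.
Qed.

End Relations.

(** * Faithful representations *)

Section DualBases.
Variable R : comPzRingType.

Lemma dual_basis_fin (M : lmodType R) (N : M -> Prop) (I : finType)
    (v : I -> M) (phi : I -> M -> R) :
  (forall i, N (v i)) ->
  (forall i a x y, N x -> N y -> phi i (a *: x + y) = a * phi i x + phi i y) ->
  (forall x, N x -> x = \sum_i phi i x *: v i) -> dual_basis_on N.
Proof.
move=> vN philin phiE; exists #|I|, (v \o enum_val), (fun i => phi (enum_val i)).
split=> [i|i|x Nx]; [exact: vN | exact: philin |].
by rewrite {1}[x]phiE // (reindex (@enum_val I I)) //; exact/onW_bij/enum_val_bij.
Qed.

Lemma dual_basis_regular : dual_basis_on (fun _ : R^o => True).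
Proof.
apply: (@dual_basis_fin R^o _ unit (fun _ => 1) (fun _ x => x)) => // x _.
by rewrite (big_pred1 tt) ?/GRing.scale /= ?mulr1 // => -[].
Qed.

Lemma dual_basis_col n : dual_basis_on (fun _ : 'cV[R]_n => True).
Proof.
apply: (@dual_basis_fin _ _ 'I_n (fun i => delta_mx i 0) (fun i x => x i 0)) => //.
  by move=> i a x y _ _; rewrite !mxE.
move=> x _; rewrite {1}[x]matrix_sum_delta; apply: eq_bigr => i _.
by rewrite big_ord1.
Qed.

Lemma dual_basis_words n D : dual_basis_on (fun _ : wordmod R n D => True).
Proof.
apply: (@dual_basis_fin (wordmod R n D) _ _ (fun b => word_basis R D (val b)) (fun b p => p b)) => //.
  by move=> b a x y _ _; rewrite !ffunE.
by move=> p _; exact: wordmodE.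
Qed.

Lemma dual_basis_prod (M N : lmodType R) :
  dual_basis_on (fun _ : M => True) -> dual_basis_on (fun _ : N => True) ->
  dual_basis_on (fun _ : (M * N)%type => True).
Proof.
move=> [k [v [phi [_ pl pe]]]] [l [w [psi [_ ql qe]]]].
apply: (@dual_basis_fin (M * N)%type _ ('I_k + 'I_l)%type
  (fun i => match i with inl i => (v i, 0) | inr i => (0, w i) end)
  (fun i x => match i with inl i => phi i x.1 | inr i => psi i x.2 end)) => //.
  by move=> [i|i] a x y _ _; [exact: pl | exact: ql].
move=> [x y] _; rewrite big_sumType /=.
have f1 : linear (fun x : M => (x, 0) : (M * N)%type).
  by move=> a x1 x2; congr (_, _); rewrite /= ?scaler0 ?addr0.
have f2 : linear (fun y : N => (0, y) : (M * N)%type).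
  by move=> a x1 x2; congr (_, _); rewrite /= ?scaler0 ?addr0.
transitivity (((x, 0) : M * N) + (0, y)); first by congr (_, _); rewrite ?addr0 ?add0r.
congr (_ + _).
  rewrite {1}[x]pe // (linear_map_sum f1); apply: eq_bigr => i _.
  by rewrite (linear_mapZ f1).
rewrite {1}[y]qe // (linear_map_sum f2); apply: eq_bigr => i _.
by rewrite (linear_mapZ f2).
Qed.

Lemma dual_basis_sub (M : lmodType R) (N : submodule M) :
  dual_basis_on N -> dual_basis_on (fun _ : sub_mod N => True).
Proof.
move=> [k [v [phi [vN pl pe]]]].
exists k, (fun i => exist _ (v i) (asboolT (vN i))), (fun i x => phi i (val x)).
split=> // [i a x y _ _|x _]; first by rewrite sub_mod_valP pl //; exact: sub_modP.
apply: val_inj; rewrite (linear_map_sum (@sub_mod_valP _ _ N)).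
rewrite [LHS]pe; last exact: sub_modP.
by apply: eq_bigr => i _; rewrite (linear_mapZ (@sub_mod_valP _ _ N)).
Qed.

Lemma dual_basis_finitely_generated (M : lmodType R) :
  dual_basis_on (fun _ : M => True) -> finitely_generated M.
Proof.
move=> [k [v [phi [_ _ pe]]]]; exists k, v => x.
by exists (phi^~ x); exact: pe.
Qed.

Lemma dual_basis_walg n D (W : lmodType R) :
  dual_basis_on (fun _ : W => True) -> dual_basis_on (fun _ : walg n D W => True).
Proof.
move=> Wd; apply: dual_basis_prod => //; apply: dual_basis_prod; last first.
  exact: dual_basis_words.
apply: dual_basis_prod; last exact: dual_basis_col.
by apply: dual_basis_prod; exact: dual_basis_regular.
Qed.

End DualBases.

Lemma dedekind_dual_basis_fin (R : idomainType) (R_dedekind : dedekind R)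
    (M : lmodType R) (I : finType) (m : I -> M) (N : submodule M) :
  (forall r (x : M), r *: x = 0 -> r = 0 \/ x = 0) ->
  (forall x, N x -> exists c : I -> R, x = \sum_i c i *: m i) -> dual_basis_on N.
Proof.
move=> tf Nm; apply: (dedekind_dual_basis R_dedekind (m := m \o enum_val) (q := 1)) => //.
- exact: oner_neq0.
- exact: sm_closed.
move=> x /Nm[c ->]; exists (c \o enum_val).
by rewrite scale1r (reindex (@enum_val I I)) //; exact/onW_bij/enum_val_bij.
Qed.

Section FaithfulRepresentation.
Variables (R : idomainType) (G : affineGroup R).
Local Notation B := (ag_ring G).
Hypotheses (R_dedekind : dedekind R) (B_flat : flat (B : lmodType R)).

(** [U] is spanned by right factors of the coproducts of the [y l], so its stable part contains
    them. That stable part is finitely generated and projective, being a submodule of the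
    torsion-free [B] inside the finitely generated [U]. *)
Lemma finite_set_representation m (y : 'I_m -> B) :
  exists n (c : 'M[B]_n), matrix_rep c /\
  forall l, exists (a : 'I_n -> 'I_n -> R) (a0 : R),
    y l = alg_str B a0 + \sum_i \sum_j alg_str B (a i j) * c i j.
Proof.
have /choice[k kP] l : exists k, exists (m u : 'I_k -> B),
    coproduct G (y l) = \sum_i tens (m i) (u i) :> tensor B B.
  by have [k [w [u [_ e]]]] := tensor_right_tens (coproduct G (y l) : tensor B B);
     exists k, w, u.
pose w l := sval (cid (kP l)); have wP l := svalP (cid (kP l)).
pose u l := sval (cid (wP l)); have uP l := svalP (cid (wP l)).
pose I := {l : 'I_m & 'I_(k l)}; pose v (i : I) := u (tag i) (tagged i).
pose Us (x : B) := exists s : I -> R, x = \sum_i s i *: v i.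
have Uc : linear_closed_set Us.
  split; first by exists (fun=> 0); rewrite big1 // => i _; rewrite scale0r.
  move=> a _ _ [s ->] [t ->]; exists (fun i => a * s i + t i).
  rewrite scaler_sumr -big_split; apply: eq_bigr => i _.
  by rewrite scalerDl scalerA.
pose U : submodule B := Submodule Uc.
have yE l : stable_part U (y l).
  exists (k l), (w l), (u l); split=> // i.
  exists (fun j => (j == Tagged (fun l => 'I_(k l)) i)%:R).
  rewrite (bigD1 (Tagged (fun l => 'I_(k l)) i)) //= eqxx scale1r big1 ?addr0 //.
  by move=> j /negbTE->; rewrite scale0r.
have Ed : dual_basis_on (stable_part U).
  apply: (dedekind_dual_basis_fin R_dedekind (m := v)).
    exact: flat_torsion_free.
  by move=> x /stable_part_sub.
have [n [c [cr cg]]] :=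
  matrix_coefficients B_flat Ed (fun b => @stable_part_coproduct _ _ U b B_flat).
by exists n, c; split=> // l; exact: cg.
Qed.

(** Projectivity of the summand [W] is what makes the algebra flat, the other summands being
    free. *)
Lemma value_sub_dual_basis n D (c : 'M[B]_n) : dual_basis_on (value_sub D c).
Proof.
apply: (dedekind_dual_basis_fin R_dedekind
  (m := fun b : D.-bseq (option 'I_n) => word_value c (word_basis R D b))).
  exact: flat_torsion_free.
move=> _ [p <-]; exists p.
rewrite {1}[p]wordmodE (linear_map_sum (word_value_linear c)).
by apply: eq_bigr => b _; rewrite (linear_mapZ (word_value_linear c)).
Qed.

End FaithfulRepresentation.

Lemma incongruent_unit (R : idomainType) (R_dedekind : dedekind R) (s : seq R) :
  (forall m : {pred R}, maximal_ideal m -> pairwise (fun x y => x - y \notin m) s) ->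
  forall i j, (i < j < size s)%N -> exists y, y * (s`_i - s`_j) = 1.
Proof.
move=> sP i j /andP[ij js]; apply: (dedekind_unit R_dedekind) => m /sP/(pairwiseP 0).
by apply=> //; rewrite inE // (ltn_trans ij).
Qed.

Theorem theorem2 (R : idomainType) (R_dedekind : dedekind R)
  (R_elements : exists g1 g2 g3 g4 g5 g6 : R,
     forall m : {pred R}, maximal_ideal m ->
       pairwise (fun x y => x - y \notin m) [:: 0; 1; g1; g2; g3; g4; g5; g6])
  (G : algebraicGroup R) (G_flat : flat_group G) :
  exists A : algebra R,
    [/\ flat A, finitely_generated A & gf_isomorphic G (Aut_functor A)].
Proof.
have [g1 [g2 [g3 [g4 [g5 [g6 gP]]]]]] := R_elements.
have gU := incongruent_unit R_dedekind gP.
(* The shift by one skips the 0 of the list: [gam 0 = 1] is the eigenvalue on R e, and incongruence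
   with that 0 makes the [gam i] with i < 5 units. *)
pose gam i := [:: 0; 1; g1; g2; g3; g4; g5; g6]`_i.+1.
have gam_unit i : (i < 5)%N -> exists y, y * gam i = 1.
  move=> i5; have [|y e] := gU 0%N i.+1; first by rewrite /= ltnS (leq_trans i5).
  by exists (- y); rewrite -e sub0r mulrN mulNr.
have gam_sep i j : (i < j < 5)%N -> exists y, y * (gam i - gam j) = 1.
  move=> /andP[ij j5]; apply: (gU i.+1 j.+1).
  by rewrite ltnS ij /= ltnS (leq_trans j5).
have [m [q [q_surj q_ker]]] := algg_fp G.
(* The images of the variables generate [B], hence so do the entries of [c], of which they are
   affine combinations. *)
have [n [c [c_rep cq]]] := finite_set_representation R_dedekind G_flat
  (fun l : 'I_m => q (('X_l : {mpoly R[m]}) : mpolyAlg R m)).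
have /choice[a /choice[a0 q_var]] := cq.
have [D DP] := matrix_relations q_surj q_var q_ker.
exists (groupAlgebra D c gam).
have Ad : dual_basis_on (fun _ : groupAlgebra D c gam => True).
  exact/dual_basis_walg/dual_basis_sub/value_sub_dual_basis.
split; first exact: dual_basis_flat.
  exact: dual_basis_finitely_generated.
apply: group_algebra_iso => //.
by move=> S x z; exact: (matrix_separates q_surj q_var).
Qed.
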